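(* Let $\hat{\mathcal{L}} \subset \hat{\mathcal{X}}_n$ be a finite-dimensional semi-simple real Lie subalgebra consisting of formal vector fields that all vanish at the origin. Then there exists a real Lie subalgebra $\mathcal{L} \subset \mathcal{X}_n$ of germs of $\mathcal{C}^\infty$ vector fields such that $T_{\underline{0}}(\mathcal{L}) = \hat{\mathcal{L}}$ and $T_{\underline{0}} : \mathcal{L} \to \hat{\mathcal{L}}$ is an isomorphism of Lie algebras.
   Context: $\mathcal{X}_n$ is the real Lie algebra of germs at $\underline{0} \in \mathbb{R}^n$ of $\mathcal{C}^\infty$ vector fields. $\hat{\mathcal{E}}_n = \mathbb{R}[[x_1,\dots,x_n]]$ is the ring of formal power series and $\hat{\mathcal{X}}_n$ is the real Lie algebra of formal vector fields $\sum_i \hat a_i \frac{\partial}{\partial x_i}$, $\hat a_i \in \hat{\mathcal{E}}_n$. $T_{\underline{0}} : \mathcal{X}_n \to \hat{\mathcal{X}}_n$ is the Lie algebra morphism sending a germ to its infinite Taylor expansion at $\underline{0}$. A Lie algebra is semi-simple if it has no nonzero solvable ideal. *)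

(* Defs.v *)
From HB Require Import structures.
From mathcomp Require Import all_boot all_order all_algebra.
From mathcomp Require Import generic_quotient ring_quotient.
From mathcomp Require Import all_classical all_reals all_analysis.

Set Implicit Arguments.
Unset Strict Implicit.
Unset Printing Implicit Defensive.

Import Order.TTheory GRing.Theory Num.Theory.
Import numFieldNormedType.Exports.

Local Open Scope classical_set_scope.
Local Open Scope ring_scope.
Local Open Scope quotient_scope.

Section LieNotions.
Context {R : pzRingType} {V : lmodType R}.
Context (br : V -> V -> V).
Implicit Types L J : set V.

Definition subspace L :=
  L 0 /\ forall (a : R) u v, L u -> L v -> L (a *: u + v).

Definition lie_subalgebra L :=
  subspace L /\ forall u v, L u -> L v -> L (br u v).

Definition lie_ideal L J :=
  [/\ subspace J, J `<=` L & forall u v, L u -> J v -> J (br u v)].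

Definition derived_algebra J : set V :=
  smallest subspace [set br u v | u in J & v in J].

Definition lie_solvable J := exists k, iter k derived_algebra J = [set 0].

Definition lie_semisimple L :=
  forall J, lie_ideal L J -> lie_solvable J -> J = [set 0].

Definition fin_dim L :=
  exists (d : nat) (e : 'I_d -> V),
    (forall i, L (e i)) /\
    (forall v, L v -> exists a : 'I_d -> R, v = \sum_i a i *: e i).

End LieNotions.

Definition lie_isomorphism {R : pzRingType} {V W : lmodType R}
    (brV : V -> V -> V) (brW : W -> W -> W) (L : set V) (M : set W)
    (f : V -> W) :=
  [/\ set_bij L M f,
      forall (a : R) u v, L u -> L v -> f (a *: u + v) = a *: f u + f v &
      forall u v, L u -> L v -> f (brV u v) = brW (f u) (f v)].

(* X stands for the vector field sum_i (X i) d/dx_i with coefficients in A, on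
   which d/dx_i acts as d i. *)
Definition vfield_bracket (A : comNzRingType) (n : nat) (d : 'I_n -> A -> A)
    (X Y : {ffun 'I_n -> A}) : {ffun 'I_n -> A} :=
  [ffun i => \sum_(j < n) (X j * d j (Y i) - Y j * d j (X i))].

Notation multi_index n := {ffun 'I_n -> nat}.

(* The series sum_m (f m) x^m. *)
Definition fps (R : comNzRingType) (n : nat) := multi_index n -> R.

Section FormalPowerSeries.
Context {R : comNzRingType} {n : nat}.
Implicit Types (f g h : fps R n) (m j k : multi_index n).

HB.instance Definition _ := GRing.Lmodule.copy (fps R n) (multi_index n -> R^o).

(* k ranges over the multi-indices bounded by m componentwise *)
Definition fps_mul f g : fps R n := fun m =>
  \sum_(k : {dffun forall i : 'I_n, 'I_(m i).+1})
    f [ffun i => k i : nat] * g [ffun i => (m i - k i)%N].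

Definition fps_one : fps R n := fun m => (m == [ffun=> 0%N])%:R.

Let box m := [seq [ffun i => nat_of_ord (k i)]
              | k : {dffun forall i : 'I_n, 'I_(m i).+1}].
Let msub m k : multi_index n := [ffun i => (m i - k i)%N].
Let madd m k : multi_index n := [ffun i => (m i + k i)%N].

Let mem_box m k : (k \in box m) = [forall i, (k i <= m i)%N].
Proof.
rewrite /box; apply/idP/forallP => [/mapP[k' _ ->] i|lekm].
  by rewrite ffunE -ltnS ltn_ord.
have ltkm i : (k i < (m i).+1)%N by rewrite ltnS.
apply/mapP; exists [ffun i => Ordinal (ltkm i)]; first by rewrite mem_enum.
by apply/ffunP => i; rewrite !ffunE.
Qed.

Let box_uniq m : uniq (box m).
Proof.
rewrite map_inj_uniq ?enum_uniq // => k k' /ffunP kk'.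
by apply/ffunP => i; apply: val_inj; have := kk' i; rewrite !ffunE.
Qed.

Let fps_mulE f g m : fps_mul f g m = \sum_(k <- box m) f k * g (msub m k).
Proof.
rewrite big_image; apply: eq_bigr => k _; congr (_ * g _).
by apply/ffunP => i; rewrite !ffunE.
Qed.

Let fps_mulC : commutative fps_mul.
Proof.
move=> f g; apply/funext => m; rewrite !fps_mulE.
have msubK k : [forall i, (k i <= m i)%N] -> msub m (msub m k) = k.
  by move=> /forallP km; apply/ffunP => i; rewrite !ffunE subKn.
have pm : perm_eq (box m) [seq msub m k | k <- box m].
  apply: uniq_perm => //.
    rewrite map_inj_in_uniq // => k k'; rewrite !mem_box => km k'm e.
    by rewrite -(msubK _ km) e msubK.
  move=> k; apply/idP/mapP => [km|[k' _ ->]].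
    exists (msub m k); last by rewrite msubK // -mem_box.
    by rewrite mem_box; apply/forallP => i; rewrite ffunE leq_subr.
  by rewrite mem_box; apply/forallP => i; rewrite ffunE leq_subr.
rewrite (perm_big _ pm) big_map; apply: eq_big_seq => k; rewrite mem_box => km.
by rewrite msubK // mulrC.
Qed.

Let fps_mulA : associative fps_mul.
Proof.
move=> f g h; apply/funext => m; rewrite !fps_mulE.
transitivity (\sum_(j <- box m) \sum_(k <- box m | [forall i, (j i <= k i)%N])
   f j * g (msub k j) * h (msub m k)).
  apply: eq_big_seq => j; rewrite mem_box => /forallP jm.
  rewrite fps_mulE big_distrr /= -[RHS]big_filter.
  have pm : perm_eq [seq k : multi_index n <- box m | [forall i, (j i <= k i)%N]]
                    [seq madd j l | l <- box (msub m j)].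
    apply: uniq_perm; first exact: filter_uniq.
      rewrite map_inj_uniq // => l l' /ffunP e; apply/ffunP => i.
      by have := e i; rewrite !ffunE => /addnI.
    move=> k; rewrite mem_filter mem_box; apply/andP/mapP.
      move=> [/forallP jk /forallP km]; exists (msub k j).
        by rewrite mem_box; apply/forallP => i; rewrite !ffunE leq_sub2r.
      by apply/ffunP => i; rewrite !ffunE subnKC.
    move=> [l]; rewrite mem_box => /forallP lm ->; split; apply/forallP => i.
      by rewrite ffunE leq_addr.
    by have := lm i; rewrite !ffunE leq_subRL.
  rewrite (perm_big _ pm) [RHS]big_map; apply: eq_bigr => l _.
  rewrite mulrA; congr (_ * g _ * h _); apply/ffunP => i; rewrite !ffunE.
    by rewrite addKn.
  by rewrite subnDA.
under eq_bigr do rewrite big_mkcond /=.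
rewrite exchange_big /=; apply: eq_big_seq => k; rewrite mem_box => /forallP km.
rewrite fps_mulE big_distrl /= -big_mkcond -[LHS]big_filter; apply: perm_big.
apply: uniq_perm => //; first exact: filter_uniq.
move=> j; rewrite mem_filter !mem_box andb_idr // => /forallP jk.
by apply/forallP => i; apply: leq_trans (jk i) (km i).
Qed.

Let fps_mul1 : left_id fps_one fps_mul.
Proof.
move=> f; apply/funext => m; rewrite fps_mulE.
have z : [ffun=> 0%N] \in box m.
  by rewrite mem_box; apply/forallP => i; rewrite ffunE.
rewrite (big_rem _ z) /= /fps_one eqxx mul1r big1_seq ?addr0.
  by congr f; apply/ffunP => i; rewrite !ffunE subn0.
by move=> k /=; rewrite mem_rem_uniq // inE => /andP[/negPf-> _]; rewrite mul0r.
Qed.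

Let fps_mulDl : left_distributive fps_mul +%R.
Proof.
move=> f g h; apply/funext => m; rewrite fps_mulE.
transitivity (fps_mul f h m + fps_mul g h m) => //.
by rewrite !fps_mulE -big_split /=; apply: eq_bigr => k _; rewrite -mulrDl.
Qed.

Let fps_one_neq0 : fps_one != 0 :> fps R n.
Proof.
apply/eqP => /(congr1 (fun f => f [ffun=> 0%N])).
by rewrite /fps_one eqxx => /eqP; rewrite oner_eq0.
Qed.

HB.instance Definition _ := GRing.Zmodule_isComNzRing.Build (fps R n)
  fps_mulA fps_mulC fps_mul1 fps_mulDl fps_one_neq0.

(* d/dx_i: the coefficient of x^m is (m i + 1) times that of x_i x^m in f *)
Definition fps_partial (i : 'I_n) f : fps R n :=
  fun m => f [ffun j => (m j + (i == j))%N] *+ (m i).+1.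

End FormalPowerSeries.

Notation formal_vfield R n := {ffun 'I_n -> fps R n}.

Definition formal_bracket (R : comNzRingType) (n : nat) :
    formal_vfield R n -> formal_vfield R n -> formal_vfield R n :=
  vfield_bracket (@fps_partial R n).

Definition vanishes_at0 (R : comNzRingType) (n : nat) (X : formal_vfield R n) :=
  forall i, X i [ffun=> 0%N] = 0.

Section SmoothFunctions.
Context {R : realType} {n : nat}.
Implicit Types (f g : 'rV[R]_n -> R) (U : set 'rV[R]_n).

Definition partial (i : 'I_n) f : 'rV[R]_n -> R := 'D_(delta_mx 0 i) f.

Definition C0_partials U f := forall x, U x ->
  {for x, continuous f} /\ forall i : 'I_n, derivable f x (delta_mx 0 i).

Definition smooth_on U f := forall s : seq 'I_n,
  C0_partials U (foldr partial f s).

(* f is C^oo on some open neighborhood of 0 *)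
Definition smooth_at0 f := exists2 U, open_nbhs (0 : 'rV[R]_n) U & smooth_on U f.

Fixpoint Ck_on U (k : nat) f : Prop :=
  C0_partials U f /\
  if k is k'.+1 then forall i, Ck_on U k' (partial i f) else True.

Lemma smooth_onP U f : smooth_on U f <-> forall k, Ck_on U k f.
Proof.
split=> [sf k|Cf s].
  elim: k f sf => [|k IH] f sf /=; first by split=> //; exact: (sf [::]).
  split=> [|i]; first exact: (sf [::]).
  by apply: IH => s; have := sf (rcons s i); rewrite foldr_rcons.
elim/last_ind: s f Cf => [|s i IH] f Cf; first by have [] := Cf 0%N.
by rewrite foldr_rcons; apply: IH => k; have [_] := Cf k.+1; exact.
Qed.

Section OnOpen.
Context (U : set 'rV[R]_n) (oU : open U).

Let nearU f g x : U x -> (forall y, U y -> f y = g y) -> {near x, f =1 g}.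
Proof.
move=> Ux fg; have : nbhs x U by exact: open_nbhs_nbhs.
by apply: filterS => y /fg.
Qed.

Lemma C0_partials_ext f g : (forall y, U y -> f y = g y) ->
  C0_partials U f -> C0_partials U g.
Proof.
move=> fg Cf x Ux; have [cf df] := Cf x Ux; have fgx := nearU Ux fg.
split=> [|i]; last exact: near_eq_derivable fgx (df i).
rewrite /prop_for /continuous_at -(fg _ Ux); apply: cvg_trans cf.
by apply: near_eq_cvg fgx.
Qed.

Lemma Ck_ext k f g : (forall y, U y -> f y = g y) ->
  Ck_on U k f -> Ck_on U k g.
Proof.
elim: k f g => [|k IH] f g fg [Cf Cdf]; (split; first exact: C0_partials_ext Cf) => //.
move=> i; apply: IH (Cdf i) => y Uy; apply: near_eq_derive.
exact: nearU.
Qed.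

Lemma C0_le k f : Ck_on U k f -> C0_partials U f.
Proof. by case: k => [|k] []. Qed.

Lemma Ck_S k f : Ck_on U k.+1 f -> Ck_on U k f.
Proof.
elim: k f => [|k IH] f [Cf df]; split=> // i; exact: IH.
Qed.

Lemma Ck_cst k a : Ck_on U k (cst a).
Proof.
have C0 b : C0_partials U (cst b).
  by move=> x _; split=> [|i]; [exact: cst_continuous | exact: derivable_cst].
elim: k a => [|k IH] a; split=> //.
move=> i; apply: Ck_ext (IH 0) => y Uy.
by rewrite /partial derive_cst.
Qed.

Lemma CkD k f g : Ck_on U k f -> Ck_on U k g -> Ck_on U k (f + g).
Proof.
elim: k f g => [|k IH] f g [Cf df] [Cg dg].
  split=> // x Ux; have [cf df'] := Cf x Ux; have [cg dg'] := Cg x Ux.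
  by split=> [|i]; [exact: continuousD | exact: derivableD].
split=> [x Ux|i].
  have [cf df'] := Cf x Ux; have [cg dg'] := Cg x Ux.
  by split=> [|i]; [exact: continuousD | exact: derivableD].
apply: Ck_ext (IH _ _ (df i) (dg i)) => y Uy.
by rewrite /partial deriveD //; [case: (Cf y Uy) | case: (Cg y Uy)].
Qed.

Lemma CkM k f g : Ck_on U k f -> Ck_on U k g -> Ck_on U k (f * g).
Proof.
elim: k f g => [|k IH] f g Cf Cg.
  split=> // x Ux; have [cf df'] := C0_le Cf Ux; have [cg dg'] := C0_le Cg Ux.
  by split=> [|i]; [exact: continuousM | exact: derivableM].
split=> [x Ux|i].
  have [cf df'] := C0_le Cf Ux; have [cg dg'] := C0_le Cg Ux.
  by split=> [|i]; [exact: continuousM | exact: derivableM].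
have CA := IH _ _ (Ck_S Cf) (proj2 Cg i).
have CB := IH _ _ (Ck_S Cg) (proj2 Cf i).
apply: Ck_ext (CkD CA CB) => y Uy.
by rewrite /partial deriveM //; [case: (C0_le Cf Uy) | case: (C0_le Cg Uy)].
Qed.

Lemma partial_eq_on f g i :
  (forall y, U y -> f y = g y) ->
  forall y, U y -> partial i f y = partial i g y.
Proof. by move=> fg y Uy; apply: near_eq_derive; exact: nearU. Qed.

End OnOpen.

Lemma Ck_sub k U V f : V `<=` U -> Ck_on U k f -> Ck_on V k f.
Proof.
move=> VU; elim: k f => [|k IH] f [Cf df].
  by split=> // x Vx; exact: (Cf x (VU x Vx)).
split=> [x Vx|i]; first exact: (Cf x (VU x Vx)).
by apply: IH; exact: df.
Qed.

Lemma smooth_at0_lift2 (op : ('rV[R]_n -> R) -> ('rV[R]_n -> R) -> 'rV[R]_n -> R)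
    f g :
  (forall U k u v, open U -> Ck_on U k u -> Ck_on U k v -> Ck_on U k (op u v)) ->
  smooth_at0 f -> smooth_at0 g -> smooth_at0 (op f g).
Proof.
move=> Cop [U [oU U0] /smooth_onP sf] [V [oV V0] /smooth_onP sg].
exists (U `&` V); first by split; [exact: openI|].
apply/smooth_onP => k; apply: Cop; first exact: openI.
- by apply: Ck_sub (sf k) => x [].
- by apply: Ck_sub (sg k) => x [].
Qed.

Lemma smooth_at0_cst a : smooth_at0 (cst a).
Proof.
exists setT; first by split; [exact: openT|].
by apply/smooth_onP => k; apply: Ck_cst; exact: openT.
Qed.

Lemma smooth_at0D f g : smooth_at0 f -> smooth_at0 g -> smooth_at0 (f + g).
Proof. by apply: smooth_at0_lift2 => *; exact: CkD. Qed.

Lemma smooth_at0M f g : smooth_at0 f -> smooth_at0 g -> smooth_at0 (f * g).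
Proof. by apply: smooth_at0_lift2 => *; exact: CkM. Qed.

Lemma smooth_at0Z a f : smooth_at0 f -> smooth_at0 (a *: f).
Proof. by move=> sf; exact: smooth_at0M (smooth_at0_cst a) sf. Qed.

Lemma smooth_at0_partial i f : smooth_at0 f -> smooth_at0 (partial i f).
Proof.
move=> [U U0 sf]; exists U => // s.
by have := sf (rcons s i); rewrite foldr_rcons.
Qed.

Definition smooth_pred : {pred 'rV[R]_n -> R} := fun f => `[< smooth_at0 f >].

Lemma smooth_predP f : reflect (smooth_at0 f) (f \in smooth_pred).
Proof. exact: asboolP. Qed.

Lemma smooth_subring_closed : subring_closed smooth_pred.
Proof.
split=> [|f g /smooth_predP sf /smooth_predP sg|
          f g /smooth_predP sf /smooth_predP sg]; apply/smooth_predP.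
- exact: smooth_at0_cst.
- by rewrite -scaleN1r; apply: smooth_at0D => //; exact: smooth_at0Z.
- exact: smooth_at0M.
Qed.

HB.instance Definition _ :=
  GRing.isSubringClosed.Build ('rV[R]_n -> R) smooth_pred smooth_subring_closed.

Record smooth_fun := SmoothFun {
  smooth_val :> 'rV[R]_n -> R;
  smooth_valP : smooth_val \in smooth_pred }.

HB.instance Definition _ := [isSub for smooth_val].
HB.instance Definition _ := [Choice of smooth_fun by <:].
HB.instance Definition _ := [SubChoice_isSubComNzRing of smooth_fun by <:].
End SmoothFunctions.

Arguments smooth_fun R n : clear implicits.

Section Germs.
Context {R : realType} {n : nat}.
Implicit Types (f g : smooth_fun R n).

Definition smooth_scale (a : R) f : smooth_fun R n :=
  SmoothFun (introT (smooth_predP _)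
    (smooth_at0Z a (elimT (smooth_predP _) (smooth_valP f)))).

Definition smooth_partial (i : 'I_n) f : smooth_fun R n :=
  SmoothFun (introT (smooth_predP _)
    (smooth_at0_partial i (elimT (smooth_predP _) (smooth_valP f)))).

Definition null_germ : {pred smooth_fun R n} :=
  fun f => `[< \forall x \near (0 : 'rV[R]_n), f x = 0 >].

Lemma null_germP f :
  reflect (\forall x \near (0 : 'rV[R]_n), f x = 0) (f \in null_germ).
Proof. exact: asboolP. Qed.

Lemma null_germ_closed : idealr_closed null_germ.
Proof.
split=> [||a f g /null_germP f0 /null_germP g0].
- by apply/null_germP; near=> x.
- apply/negP => /null_germP /nbhs_singleton /eqP.
  by rewrite -[X in X == _]/(1 : R) oner_eq0.
apply/null_germP; near=> x.
suff -> : (a * f + g) x = a x * f x + g x.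
  by rewrite (near f0) // (near g0) // mulr0 addr0.
by [].
Unshelve. all: by end_near. Qed.

HB.instance Definition _ :=
  isIdealr.Build (smooth_fun R n) null_germ null_germ_closed.

(* Germs at 0 of C^oo functions: smooth_fun R n modulo equality near 0. *)
Definition germ := {ideal_quot null_germ}.

HB.instance Definition _ := GRing.ComNzRing.on germ.
HB.instance Definition _ := EqQuotient.on germ.

Lemma germ_eqP f g :
  \pi_germ f = \pi_germ g <-> \forall x \near (0 : 'rV[R]_n), f x = g x.
Proof.
split=> [/eqP|fg].
  rewrite -Quotient.idealrBE => /null_germP; apply: filterS => x.
  by move=> /eqP; rewrite subr_eq0 => /eqP.
apply/eqP; rewrite -Quotient.idealrBE; apply/null_germP; apply: filterS fg => x.
by move=> fgx; rewrite /= -[LHS]/(f x - g x) fgx subrr.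
Qed.

Lemma germ_piD f g : \pi_germ (f + g) = \pi_germ f + \pi_germ g.
Proof. exact: Quotient.pi_add. Qed.

Lemma germ_piM f g : \pi_germ (f * g) = \pi_germ f * \pi_germ g.
Proof. exact: Quotient.pi_mul. Qed.

Definition germ_scale (a : R) (u : germ) : germ :=
  \pi_germ (smooth_scale a (repr u)).

Lemma germ_scale_pi a f : germ_scale a (\pi_germ f) = \pi_germ (smooth_scale a f).
Proof.
apply/germ_eqP; have /germ_eqP : \pi_germ (repr (\pi_germ f)) = \pi_germ f.
  by rewrite reprK.
by apply: filterS => x e; rewrite -[LHS]/(a * repr (\pi_germ f) x) e.
Qed.

Let germ_scaleA a b (u : germ) :
  germ_scale a (germ_scale b u) = germ_scale (a * b) u.
Proof.
rewrite -[u]reprK !germ_scale_pi; congr \pi_germ; apply: val_inj => /=.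
by rewrite ?reprK scalerA.
Qed.

Let germ_scale1 : left_id 1 germ_scale.
Proof.
move=> u; rewrite -[u]reprK germ_scale_pi; congr \pi_germ; apply: val_inj => /=.
by rewrite ?reprK scale1r.
Qed.

Let germ_scaleDr : right_distributive germ_scale +%R.
Proof.
move=> a u v; rewrite -[u]reprK -[v]reprK -germ_piD !germ_scale_pi.
rewrite -germ_piD; congr \pi_germ; apply: val_inj => /=.
by rewrite ?reprK scalerDr.
Qed.

Let germ_scaleDl u : {morph germ_scale^~ u : a b / a + b}.
Proof.
move=> a b /=; rewrite -[u]reprK !germ_scale_pi -germ_piD.
congr \pi_germ; apply: val_inj => /=; by rewrite ?reprK scalerDl.
Qed.

HB.instance Definition _ := GRing.Zmodule_isLmodule.Build R germ
  germ_scaleA germ_scale1 germ_scaleDr germ_scaleDl.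

Definition germ_partial (i : 'I_n) (u : germ) : germ :=
  \pi_germ (smooth_partial i (repr u)).

Lemma partial_near_eq i (f g : 'rV[R]_n -> R) :
  (\forall x \near (0 : 'rV[R]_n), f x = g x) ->
  \forall x \near (0 : 'rV[R]_n), partial i f x = partial i g x.
Proof.
by move=> /near_join; apply: filterS => x; exact: near_eq_derive.
Qed.

Lemma repr_germ f : \forall x \near (0 : 'rV[R]_n), repr (\pi_germ f) x = f x.
Proof. by apply/germ_eqP; rewrite reprK. Qed.

Lemma germ_partial_pi i f : germ_partial i (\pi_germ f) = \pi_germ (smooth_partial i f).
Proof. by apply/germ_eqP; apply: partial_near_eq; exact: repr_germ. Qed.

(* d^m f: the order in which the partial derivatives are taken does not matter
   for smooth f *)
Definition mpartial (m : multi_index n) (f : 'rV[R]_n -> R) : 'rV[R]_n -> R :=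
  foldr (fun i => iter (m i) (partial i)) f (enum 'I_n).

Definition taylor (f : 'rV[R]_n -> R) : fps R n :=
  fun m => mpartial m f 0 / (\prod_i (m i)`!)%:R.

Definition germ_taylor (u : germ) : fps R n := taylor (repr u).

Lemma germ_taylor_pi f : germ_taylor (\pi_germ f) = taylor f.
Proof.
apply/funext => m; congr (_ / _).
apply: (@nbhs_singleton _ (0 : 'rV[R]_n) (fun x => mpartial m _ x = mpartial m f x)).
rewrite /mpartial; elim: (enum _) => [|i s IH] /=; first exact: repr_germ.
by elim: (m i) => [|k IHk] //=; exact: partial_near_eq.
Qed.

End Germs.

Arguments germ R n : clear implicits.

Notation smooth_vfield R n := {ffun 'I_n -> germ R n}.

Definition smooth_bracket (R : realType) (n : nat) :
    smooth_vfield R n -> smooth_vfield R n -> smooth_vfield R n :=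
  vfield_bracket (@germ_partial R n).

(* The map T_0 from germs of vector fields to formal vector fields *)
Definition taylor_vfield (R : realType) (n : nat) (X : smooth_vfield R n) :
    formal_vfield R n :=
  [ffun i => germ_taylor (X i)].

(* Main.v *)
From HB Require Import structures.
Require Import Defs.
From mathcomp Require Import all_boot all_order all_algebra.
From mathcomp Require Import generic_quotient ring_quotient.
From mathcomp Require Import complex.
From mathcomp Require Import all_classical all_reals all_analysis.
From mathcomp Require Import ring lra.
Import Defs.

Set Implicit Arguments.
Unset Strict Implicit.
Unset Printing Implicit Defensive.

Import Order.TTheory GRing.Theory Num.Theory.
Import numFieldNormedType.Exports.

Local Open Scope classical_set_scope.
Local Open Scope ring_scope.
Local Open Scope quotient_scope.

(** Vector fields act on functions, and linearizing Lhat means finding an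
    n-tuple phi of series tangent to the identity whose span is invariant
    under Lhat. Since a semisimple Lhat acts faithfully by its linear parts
    (the fields of order at least 2 form a solvable ideal), such a phi is
    built degree by degree: the obstruction in each degree is a 1-cocycle with
    values in a finite-dimensional representation, hence a coboundary by
    Whitehead's lemma, which follows from Cartan's criterion and Casimir
    elements. By Borel's theorem phi is the Taylor expansion of germs of
    smooth functions, again with invertible Jacobian matrix J. For each matrix
    M in the linear part of Lhat, X = (phi M) J^-1 is the unique germ of
    vector field with X phi = phi M; this gives a Lie algebra of germs, and
    its expansion is Lhat because formal fields are also determined by their
    action on phi. No inverse of the coordinate change is needed.

    Borel's theorem is proved as by Peano, with the rational functions P_k(x)
    / (1 + t_k^2 |x|^2) in place of cut-off functions. *)

(** * Cartan's criterion *)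

(** The obstacle is the kernel of the Taylor map, the flat germs: lifting a basis of [Lhat]
    coefficient by coefficient would satisfy the bracket relations only up to flat germs.
    Prescribing the exact action on the lifted functions [phi] removes this ambiguity, since bracket
    relations then become matrix identities. So Borel's theorem is applied to [phi] alone, never to
    the fields. Identifying [Lhat] with the matrix algebra of its linear parts supplies a faithful
    representation at once, and the trace form of these matrices takes the place of the Killing
    form. Cartan's criterion needs eigenvalues and complex conjugates, whence a detour through
    [R[i]]; nilpotency descends to [R]. Whitehead's lemma is proved without complete reducibility: a
    Casimir element of nonzero trace is not nilpotent, so its Fitting decomposition splits off a
    nonzero part where the cocycle is explicitly trivial, and the dimension drops. Vectors are rows
    and matrices act on the right, which fixes the index convention for linear parts and the signs
    of the cocycles. *)

Lemma coprimep_prodXsubC (F : fieldType) (s : seq F) (M : nat) (a : F) :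
  a \notin s ->
  coprimep (\prod_(v <- s) ('X - v%:P) ^+ M) (('X - a%:P) ^+ M : {poly F}).
Proof.
elim: s => [|v s IH]; first by rewrite big_nil coprime1p.
rewrite inE negb_or => /andP[av /IH{}IH]; rewrite big_cons coprimepMl IH andbT.
apply: coprimep_expl; apply: coprimep_expr.
by rewrite coprimep_XsubC root_XsubC.
Qed.

(** Chinese remainder theorem for the pairwise coprime powers [('X - v%:P) ^+ M]. It serves twice:
    indicator residues give spectral idempotents, and complex conjugation gives a polynomial that
    turns [ad A] into [ad Y]. *)
Lemma poly_crt (F : fieldType) (s : seq F) (M : nat) (c : F -> F) : uniq s ->
  exists P : {poly F}, {in s, forall v, ('X - v%:P) ^+ M %| P - (c v)%:P}.
Proof.
elim: s => [|a s IH] /=; first by exists 0.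
move=> /andP[as_ us]; have [P HP] := IH us.
pose Q := \prod_(v <- s) ('X - v%:P) ^+ M : {poly F}.
have cop : coprimep Q (('X - a%:P) ^+ M) := coprimep_prodXsubC M as_.
have /Bezout_eq1_coprimepP[[u w] /= uw] := cop.
(* Since [u * Q = 1 - w * ('X - a%:P) ^+ M], the correction vanishes modulo [Q] and brings the
   residue at [a] to [c a]. *)
exists (P + u * Q * ((c a)%:P - P)) => v; rewrite inE => /orP[/eqP->|vs].
  have -> : P + u * Q * ((c a)%:P - P) - (c a)%:P =
     (P - (c a)%:P) * (w * ('X - a%:P) ^+ M).
    have -> : w * ('X - a%:P) ^+ M = 1 - u * Q by rewrite -uw addrAC subrr add0r.
    rewrite [RHS]mulrBr mulr1 addrAC; congr (_ + _).
    by rewrite mulrC -mulNr opprB.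
  by rewrite mulrA dvdp_mull.
rewrite addrAC dvdp_addr ?HP // -mulrA dvdp_mull // dvdp_mulr //.
by rewrite /Q (big_rem v) //= dvdp_mulr.
Qed.

(** Induction on the size, valid over any field: if [A = U V] is a rank factorization of smaller
    inner size, then [tr A = tr (V U)], and [V U] is again nilpotent. At full rank [A] is
    invertible, and nilpotency gives [1 = 0]. *)
Lemma mxtrace_nilpotent (F : fieldType) n k (A : 'M[F]_n) :
  A ^+ k = 0 -> \tr A = 0.
Proof.
elim/ltn_ind: n k A => n IH k A Ak.
have [lt_rn|] := ltnP (\rank A) n; last first.
  move=> rA; have uA : A \in unitmx by rewrite -row_full_unit /row_full eqn_leq rank_leq_col.
  suff E1 : (1%:M : 'M[F]_n) = 0 by rewrite -(mulmx1 A) E1 mulmx0 mxtrace0.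
  have uAk m : A ^+ m \in unitmx.
    elim: m => [|m IHm]; first by rewrite expr0 unitmx1.
    by rewrite exprS unitmx_mul uA IHm.
  by rewrite -(mulmxV (uAk k)) Ak mul0mx.
have := mulmx_base A.
move: (\rank A) lt_rn (col_base A) (row_base A) => r lt_rn U V UV; rewrite -UV mxtrace_mulC.
apply: (IH _ lt_rn k.+1).
suff -> m : (V *m U) ^+ m.+1 = V *m A ^+ m *m U by rewrite Ak mulmx0 mul0mx.
elim: m => [|m IHm]; first by rewrite expr1 expr0 mulmx1.
rewrite exprS IHm (exprS A) -[LHS]/(_ *m _) -[A * A ^+ m]/(A *m _).
by rewrite -{2}UV !mulmxA.
Qed.

(** With a rank factorization [E = U V], cancelling the full-rank factors in [E E = E] gives
    [V U = 1], and [tr E = tr (V U)]. *)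
Lemma mxtrace_idempotent (F : fieldType) n (E : 'M[F]_n) :
  E *m E = E -> \tr E = (\rank E)%:R.
Proof.
have := mulmx_base E; have := row_base_free E; have := col_base_full E.
move: (\rank E) (col_base E) (row_base E) => r U V fU fV UV EE; rewrite -{1}UV mxtrace_mulC.
suff -> : V *m U = 1%:M by rewrite mxtrace1.
have e1 : U *m (V *m U) *m V = U *m V by rewrite !mulmxA -mulmxA UV.
have {e1} e2 : V *m U *m V = V.
  by rewrite -[LHS]mul1mx -(mulVpmx fU) -mulmxA (mulmxA U) e1 mulmxA mulVpmx // mul1mx.
by rewrite -[LHS]mulmx1 -(mulmxVp fV) mulmxA e2.
Qed.

(** [e l] is the value at [A] of a polynomial that is 1 modulo [('X - l%:P) ^+ n.+1] and 0 modulo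
    the powers at the other eigenvalues. Multiplicities are at most the matrix size [n.+1], so [chi]
    is a multiple of the characteristic polynomial and kills [A] by Cayley-Hamilton; the identities
    become congruences checked root by root. *)
Lemma spectral_idempotents (C : closedFieldType) n (A : 'M[C]_n.+1) :
  exists (s : seq C) (e : C -> 'M[C]_n.+1),
   [/\ \sum_(l <- s) e l = 1, uniq s,
       forall l B, GRing.comm A B -> GRing.comm (e l) B,
       {in s, forall l, (A - l%:M) ^+ n.+1 * e l = 0} &
       {in s &, forall l m, e l * e m = if l == m then e l else 0}].
Proof.
have [r0 Hr0] := closed_field_poly_normal (char_poly A).
move: Hr0; rewrite (monicP (char_poly_monic A)) scale1r => Hr.
have sr : size r0 = n.+1.
  by have := size_char_poly A; rewrite Hr size_prod_XsubC => -[].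
pose s := undup r0.
have us : uniq s := undup_uniq _.
pose chi := \prod_(l <- s) ('X - l%:P) ^+ n.+1 : {poly C}.
have chi_dvd p : {in s, forall l, ('X - l%:P) ^+ n.+1 %| p} -> chi %| p.
  rewrite {}/chi; elim: s us => [|a s' IH] /=; first by rewrite big_nil dvd1p.
  move=> /andP[as_ us] H; rewrite big_cons Gauss_dvdp.
    by rewrite H ?mem_head //= IH // => l ls; apply: H; rewrite inE ls orbT.
  by rewrite coprimep_sym coprimep_prodXsubC.
have chiA p : chi %| p -> horner_mx A p = 0.
  have : char_poly A %| chi.
    rewrite Hr -big_undup_iterop_count /chi.
    apply: (big_ind2 (fun p q => p %| q)) => //; first by move=> *; apply: dvdp_mul.
    move=> l _; rewrite -[iterop _ _ _ _]/(('X - l%:P) ^+ _) dvdp_exp2l // -sr.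
    exact: count_size.
  move=> cd /(dvdp_trans cd) /dvdpP[q ->].
  by rewrite rmorphM /= Cayley_Hamilton mulr0.
pose cs (l v : C) := (v == l)%:R : C.
have /boolp.choice[P HP] : forall l, exists P : {poly C},
    {in s, forall v, ('X - v%:P) ^+ n.+1 %| P - (cs l v)%:P}.
  by move=> l; apply: poly_crt.
pose e l := horner_mx A (P l).
exists s, e; split=> //.
- apply/eqP; rewrite -subr_eq0; apply/eqP.
  have -> : \sum_(l <- s) e l - 1 = horner_mx A (\sum_(l <- s) P l - 1).
    by rewrite rmorphB rmorph1 raddf_sum.
  apply: chiA; apply: chi_dvd => v vs.
  rewrite (big_rem v) //= addrAC dvdp_addr; last by have := HP v v vs; rewrite /cs eqxx.
  rewrite big_seq; apply: (big_ind (fun p => _ %| p)) => //.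
    by move=> *; rewrite dvdp_addr.
  move=> l; rewrite mem_rem_uniq // inE => /andP[lv _].
  by have := HP l v vs; rewrite /cs eq_sym (negPf lv) subr0.
- move=> l B AB; exact: comm_horner_mx.
- move=> l ls; have -> : A - l%:M = horner_mx A ('X - l%:P).
    by rewrite rmorphB /= horner_mx_X horner_mx_C.
  rewrite -rmorphXn -rmorphM /=; apply: chiA; apply: chi_dvd => v vs.
  have [->|vl] := eqVneq v l; first by rewrite dvdp_mulr.
  rewrite dvdp_mull //; have := HP l v vs.
  by rewrite /cs (negPf vl) subr0.
- move=> l m ls ms; rewrite -rmorphM; case: ifPn => [/eqP <-{m ms}|lm].
    apply/eqP; rewrite -subr_eq0 -rmorphB; apply/eqP.
    apply: chiA; apply: chi_dvd => v vs.
    have -> : P l * P l - P l = P l * (P l - 1) by rewrite mulrBr mulr1.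
    have := HP l v vs; rewrite /cs; case: eqP => _ H; first by rewrite dvdp_mull.
    by rewrite dvdp_mulr //; move: H; rewrite subr0.
  apply: chiA; apply: chi_dvd => v vs.
  have [vl|vl] := eqVneq v l.
    by rewrite dvdp_mull //; have := HP m v vs; rewrite /cs vl (negPf lm) subr0.
  by rewrite dvdp_mulr //; have := HP l v vs; rewrite /cs (negPf vl) subr0.
Qed.

Definition mxbr (F : pzRingType) n (A B : 'M[F]_n) : 'M[F]_n := A *m B - B *m A.

Section PolyOperator.
Variables (F : fieldType) (V : lmodType F) (T : {linear V -> V}).
Implicit Types (P Q : {poly F}) (v : V).

(** This is [P(T)] for an operator on a module, without a choice of coordinates; [T] will be [ad A]
    acting on matrices. *)
Definition poly_op P v := \sum_(k < size P) P`_k *: iter k T v.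

Lemma poly_op_widen N P v : (size P <= N)%N ->
  poly_op P v = \sum_(k < N) P`_k *: iter k T v.
Proof.
move=> PN; rewrite /poly_op (big_ord_widen _ (fun k => P`_k *: iter k T v) PN).
rewrite [RHS](bigID (fun k : 'I_N => k < size P)%N) /= [X in _ + X]big1 ?addr0 // => k.
by rewrite -leqNgt => kP; rewrite nth_default // scale0r.
Qed.

Lemma poly_opD P Q v : poly_op (P + Q) v = poly_op P v + poly_op Q v.
Proof.
pose N := maxn (size P) (size Q).
rewrite !(@poly_op_widen N) ?leq_maxl ?leq_maxr ?size_polyD // -big_split /=.
by apply: eq_bigr => k _; rewrite coefD scalerDl.
Qed.

Lemma poly_opZ c P v : poly_op (c *: P) v = c *: poly_op P v.
Proof.
rewrite (@poly_op_widen (size P)) ?size_scale_leq // scaler_sumr.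
by apply: eq_bigr => k _; rewrite coefZ scalerA.
Qed.

Lemma poly_opC c v : poly_op c%:P v = c *: v.
Proof. by rewrite (@poly_op_widen 1) ?size_polyC_leq1 // big_ord1 coefC. Qed.

Lemma poly_opMX P v : poly_op (P * 'X) v = poly_op P (T v).
Proof.
rewrite (@poly_op_widen (size P).+1); last first.
  by rewrite (leq_trans (size_polyMleq _ _)) // size_polyX addn2.
rewrite big_ord_recl coefMX scale0r add0r.
by apply: eq_bigr => k _; rewrite coefMX /= -iterS iterSr.
Qed.

Lemma poly_op_is_linear P : linear (poly_op P).
Proof.
move=> c u v; rewrite /poly_op scaler_sumr -big_split /=; apply: eq_bigr => k _.
suff -> : iter k T (c *: u + v) = c *: iter k T u + iter k T v.
  by rewrite scalerDr !scalerA mulrC.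
by elim: {k}(k : nat) => //= k ->; rewrite linearP.
Qed.
HB.instance Definition _ P := GRing.isLinear.Build F V V _ (poly_op P) (poly_op_is_linear P).

Lemma poly_op_gen_eigen nu c i P v :
  iter i (fun w => T w - nu *: w) v = 0 -> ('X - nu%:P) ^+ i %| P - c%:P ->
  poly_op P v = c *: v.
Proof.
move=> Hv /dvdpP[q Pq].
have -> : P = q * ('X - nu%:P) ^+ i + c%:P by rewrite -Pq subrK.
rewrite poly_opD poly_opC; suff -> : poly_op (q * ('X - nu%:P) ^+ i) v = 0 by rewrite add0r.
elim: i v Hv {Pq} => [|i IH] v Hv; first by rewrite [v]Hv linear0.
rewrite exprSr mulrA; set Q := q * _ in IH *.
have -> : poly_op (Q * ('X - nu%:P)) v = poly_op Q (T v - nu *: v).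
  rewrite mulrBr poly_opD poly_opMX -mulrN -polyCN mulrC mul_polyC poly_opZ.
  by rewrite linearB linearZ scaleNr.
by apply: IH; rewrite -iterSr.
Qed.
End PolyOperator.

Section AdPolynomial.
Variables (F : fieldType) (n : nat).

Lemma mxbr_is_linear (A : 'M[F]_n) : linear (mxbr A).
Proof.
move=> a u v; rewrite /mxbr mulmxDr mulmxDl -scalemxAr -scalemxAl scalerBr.
by rewrite opprD addrACA.
Qed.
HB.instance Definition _ A := GRing.isLinear.Build F _ _ _ (mxbr A) (mxbr_is_linear A).

Variable A : 'M[F]_n.

(** [ad A - (l - m)] is the difference of left multiplication by [A - l] and right multiplication by
    [A - m], which commute. Any product of [i + j] of these contains [i] factors on the left or [j]
    on the right. *)
Lemma ad_gen_eigen (l m : F) i j V :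
  (A - l%:M) ^+ i *m V = 0 -> V *m (A - m%:M) ^+ j = 0 ->
  iter (i + j) (fun W => mxbr A W - (l - m) *: W) V = 0.
Proof.
set T := fun W => _.
have T0 k : iter k T 0 = 0.
  by elim: k => //= k ->; rewrite /T linear0 scaler0 subr0.
have TE W : T W = (A - l%:M) *m W - W *m (A - m%:M).
  rewrite /T /mxbr mulmxBl mulmxBr mul_scalar_mx mul_mx_scalar scalerBl.
  by rewrite !opprB addrACA [RHS]addrACA; congr (_ + _); rewrite addrC.
have TB k W1 W2 : iter k T (W1 - W2) = iter k T W1 - iter k T W2.
  elim: k => //= k ->; rewrite /T linearB scalerBr /= !opprD addrACA.
  by rewrite -opprD.
elim: i j V => [|i IHi].
  by move=> j V; rewrite expr0 mul1mx => -> _; exact: T0.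
elim=> [|j IHj] V; first by rewrite expr0 mulmx1 => _ ->; exact: T0.
rewrite exprSr exprS -![_ * _]/(_ *m _) => Hi Hj.
rewrite addSn iterSr TE TB.
rewrite IHi; first 1 last.
- by rewrite mulmxA.
- by rewrite -mulmxA exprS -[_ * _]/(_ *m _) Hj mulmx0.
rewrite addnS -addSn IHj ?subr0 //.
- by rewrite exprSr -[_ * _]/(_ *m _) mulmxA Hi mul0mx.
- by rewrite -mulmxA.
Qed.

End AdPolynomial.

(* Let Y = sum_l conj(l) e_l be the conjugate of the semisimple part of A. Then
   ad Y is a polynomial in ad A, whence tr (A Y) = 0, but
   tr (A Y) = sum_l |l|^2 rank (e_l). *)
Lemma nilpotent_of_mxtrace (C : numClosedFieldType) n (A : 'M[C]_n.+1)
    (N : nat) (u v : 'I_N -> 'M[C]_n.+1) :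
  A = \sum_i mxbr (u i) (v i) ->
  (forall i k, \tr (u i *m iter k (mxbr A) (v i)) = 0) -> A ^+ n.+1 = 0.
Proof.
move=> Auv tr0; have [s [e [e1 us ecomm egen eidem]]] := spectral_idempotents A.
pose Y := \sum_(l <- s) l^* *: e l.
(* The differences [l - m] are the eigenvalues of [ad A]. As conjugation is additive, [P(ad A)] acts
   by [l^* - m^*], exactly as [ad Y] does. The exponent is the one supplied by [ad_gen_eigen]. *)
have [P HP] := poly_crt (n.+1 + n.+1) (fun x => x^*) (undup_uniq [seq l - m | l <- s, m <- s]).
have YeE l : l \in s -> Y * e l = l^* *: e l.
  move=> ls; rewrite mulr_suml (big_rem l) //= -scalerAl eidem // eqxx big1_seq ?addr0 //.
  move=> m /=; rewrite mem_rem_uniq // inE => /andP[ml ms].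
  by rewrite -scalerAl eidem // (negPf ml) scaler0.
have eYE l : l \in s -> e l * Y = l^* *: e l.
  move=> ls; rewrite mulr_sumr (big_rem l) //= -scalerAr eidem // eqxx big1_seq ?addr0 //.
  move=> m /=; rewrite mem_rem_uniq // inE => /andP[ml ms].
  by rewrite -scalerAr eidem // eq_sym (negPf ml) scaler0.
have eA l : GRing.comm (e l) A by apply: ecomm.
have adP V : poly_op (mxbr A) P V = mxbr Y V.
  have -> : V = \sum_(l <- s) \sum_(m <- s) e l * V * e m.
    by under eq_bigr do rewrite -mulr_sumr e1 mulr1; rewrite -mulr_suml e1 mul1r.
  rewrite !raddf_sum; apply: eq_big_seq => l ls; rewrite !raddf_sum.
  apply: eq_big_seq => m ms /=.
  rewrite (@poly_op_gen_eigen _ _ _ (l - m) (l - m)^* (n.+1 + n.+1)).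
  - rewrite /mxbr -![_ *m _]/(_ * _) !mulrA YeE // -!mulrA eYE //.
    by rewrite -scalerAr -scalerAr -!scalerAl -scalerBl rmorphB.
  - apply: ad_gen_eigen; rewrite -![_ *m _]/(_ * _).
      by rewrite !mulrA egen // !mul0r.
    have /commrX -/(_ n.+1) : GRing.comm (e m) (A - m%:M).
      by apply: commrB => //; exact: (comm_mx_scalar _ _).
    move=> cmm; have -> : e l * V * e m * (A - m%:M) ^+ n.+1 = e l * V * ((A - m%:M) ^+ n.+1 * e m).
      by rewrite -mulrA; congr (_ * _).
    by rewrite egen // mulr0.
  by apply: HP; rewrite mem_undup; apply: allpairs_f.
(* Invariance gives [tr ([u, v] Y) = - tr (u [Y, v])], and [[Y, v]] is a combination of the iterates
   [(ad A)^k v], for which the trace vanishes by hypothesis. *)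
have trAY : \tr (A *m Y) = 0.
  rewrite {1}Auv mulmx_suml raddf_sum big1 //= => i _.
  have -> : \tr (mxbr (u i) (v i) *m Y) = - \tr (u i *m mxbr Y (v i)).
    rewrite /mxbr mulmxBl mulmxBr.
    rewrite [X in X = _]raddfB [in X in _ = X]raddfB /= opprB -!mulmxA; congr (_ - _).
    by rewrite mxtrace_mulC mulmxA.
  apply/eqP; rewrite oppr_eq0; apply/eqP.
  rewrite -adP /poly_op mulmx_sumr raddf_sum big1 //= => k _.
  by rewrite -scalemxAr linearZ /= tr0 mulr0.
have trAe l : l \in s -> \tr (A *m e l) = l * (\rank (e l))%:R.
  move=> ls; have -> : A *m e l = (A - l%:M) * e l + l *: e l.
    by rewrite mulrBl -[l%:M * _]/(_ *m _) mul_scalar_mx subrK.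
  rewrite raddfD /= linearZ /= (@mxtrace_idempotent _ _ (e l)); last first.
    by rewrite -[_ *m _]/(_ * _) eidem // eqxx.
  rewrite (@mxtrace_nilpotent _ _ n.+1) ?add0r //.
  have cAe : GRing.comm (A - l%:M) (e l).
    by apply: commr_sym; apply: commrB => //; exact: (comm_mx_scalar _ _).
  rewrite exprMn_comm //.
  have -> : forall k, e l ^+ k.+1 = e l.
    by elim=> [|k IH]; rewrite ?expr1 // exprS IH eidem // eqxx.
  exact: egen.
have sum0 : \sum_(l <- s) `|l| ^+ 2 * (\rank (e l))%:R = 0.
  rewrite -[RHS]trAY /Y mulmx_sumr raddf_sum; apply: eq_big_seq => l ls /=.
  by rewrite -scalemxAr linearZ /= trAe // mulrA normCKC.
(* In a vanishing sum of nonnegative terms each term is zero: either [l = 0] or [e l = 0], so only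
   the generalized kernel of [A] remains. *)
have Ae0 l : l \in s -> A ^+ n.+1 * e l = 0.
  move=> ls; move/eqP: sum0; rewrite psumr_eq0; last first.
    by move=> m _; rewrite mulr_ge0 ?exprn_ge0 ?ler0n.
  move=> /allP/(_ l ls)/=; rewrite mulf_eq0 expf_eq0 normr_eq0 pnatr_eq0 mxrank_eq0 /=.
  case/orP => [/eqP l0|/eqP->]; last by rewrite mulr0.
  by have := egen l ls; rewrite l0 raddf0 subr0.
by rewrite -[LHS]mulr1 -e1 mulr_sumr big_seq big1.
Qed.

Section DerivedAlgebra.
Context {R : pzRingType} {V : lmodType R} (br : V -> V -> V).
Implicit Types (L J : set V).

Lemma subspace0 J : subspace J -> J 0. Proof. exact: proj1. Qed.
Lemma subspaceD J u v : subspace J -> J u -> J v -> J (u + v).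
Proof. by move=> [_ H] Ju Jv; rewrite -[u]scale1r; apply: H. Qed.
Lemma subspaceZ J a u : subspace J -> J u -> J (a *: u).
Proof. by move=> [J0 H] Ju; rewrite -[_ *: _]addr0; apply: H. Qed.
Lemma subspaceB J u v : subspace J -> J u -> J v -> J (u - v).
Proof. by move=> sJ Ju Jv; rewrite -scaleN1r; apply: subspaceD => //; apply: subspaceZ. Qed.
Lemma subspace_sum J I (r : seq I) (P : pred I) (F : I -> V) : subspace J ->
  (forall i, P i -> J (F i)) -> J (\sum_(i <- r | P i) F i).
Proof.
move=> sJ JF; apply: (big_ind J) => //; first exact: subspace0.
by move=> *; exact: subspaceD.
Qed.

Lemma derived_algebra_subspace J : subspace (derived_algebra br J).
Proof.
split=> [A [sA _]|a u v Du Dv A [sA JA]]; first exact: subspace0.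
by case: (sA) => _; apply; [apply: Du|apply: Dv].
Qed.

Lemma derived_algebra_br J u v : J u -> J v -> derived_algebra br J (br u v).
Proof. by move=> Ju Jv A [_]; apply; exists u => //; exists v. Qed.

Lemma derived_algebra_min J A : subspace A ->
  (forall u v, J u -> J v -> A (br u v)) -> derived_algebra br J `<=` A.
Proof. by move=> sA JA x; apply; split=> // _ [u Ju [v Jv <-]]; apply: JA. Qed.

Lemma derived_algebra_sub J : lie_subalgebra br J -> derived_algebra br J `<=` J.
Proof. by move=> [sJ brJ]; apply: derived_algebra_min. Qed.

Lemma derived_algebra_subalgebra J :
  lie_subalgebra br J -> lie_subalgebra br (derived_algebra br J).
Proof.
move=> LJ; split=> [|u v Du Dv]; first exact: derived_algebra_subspace.
by apply: derived_algebra_br; apply: derived_algebra_sub.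
Qed.

Lemma iter_derived_subalgebra J k :
  lie_subalgebra br J -> lie_subalgebra br (iter k (derived_algebra br) J).
Proof. by move=> LJ; elim: k => //= k; exact: derived_algebra_subalgebra. Qed.

Lemma ideal_subalgebra L J : lie_ideal br L J -> lie_subalgebra br J.
Proof. by move=> [sJ JL H]; split=> // u v Ju Jv; apply: H => //; apply: JL. Qed.

End DerivedAlgebra.

(** Transfers subspaces given as predicates to [{vspace V}], where dimensions are available. A
    subspace of maximal dimension inside [P] is all of [P], since a further vector of [P] could be
    adjoined. *)
Lemma subspace_vspace (F : fieldType) (V : vectType F) (P : set V) :
  subspace P -> exists U : {vspace V}, forall v, v \in U <-> P v.
Proof.
move=> sP.
pose Q k := `[< exists U : {vspace V}, \dim U = k /\ forall v, v \in U -> P v >].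
have Q0 : exists k, Q k.
  exists 0%N; apply/asboolP; exists 0%VS; split; first exact: dimv0.
  by move=> v; rewrite memv0 => /eqP->; exact: subspace0.
have Qm k : Q k -> (k <= \dim {:V})%N.
  by move=> /asboolP[U [<- _]]; exact/dimvS/subvf.
case: (ex_maxnP Q0 Qm) => k /asboolP[U [dU UP]] maxk.
exists U => v; split=> [|Pv]; first exact: UP.
have /maxk : Q (\dim (U + <[v]>)%VS).
  apply/asboolP; exists (U + <[v]>)%VS; split=> // _ /memv_addP[u uU [_ /vlineP[c ->] ->]].
  by apply: subspaceD => //; [exact: UP|exact: subspaceZ].
rewrite -dU => dle; have : (U + <[v]> <= U)%VS.
  by rewrite -(geq_leqif (dimv_leqif_sup (addvSl U <[v]>))).
by move/subvP; apply; apply: (subvP (addvSr _ _)); exact: memv_line.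
Qed.

Lemma mxbrC (F : pzRingType) n (A B : 'M[F]_n) : mxbr A B = - mxbr B A.
Proof. by rewrite /mxbr opprB. Qed.
Lemma mxbrxx (F : pzRingType) n (A : 'M[F]_n) : mxbr A A = 0.
Proof. exact: subrr. Qed.

(** * Engel's theorem for matrix Lie algebras *)

Section Engel.
Variables (F : fieldType) (n : nat).
Local Notation M := 'M[F]_n.
Local Notation br := (@mxbr F n).

(* v is killed by right multiplication by all words of length k in T, so its rows
   lie in the k-th step of the flag of T. *)
Fixpoint killed (T : set M) (k : nat) (v : M) : Prop :=
  if k is k'.+1 then forall m, T m -> killed T k' (v *m m) else v = 0.

(** Taking [v = 1] shows that all products of [k] elements of [T] vanish: the associative algebra
    generated by [T] is nilpotent. *)
Definition flag_nilpotent T k := forall v, killed T k v.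

Section Killed.
Variable T : set M.

Lemma killed0 k : killed T k 0.
Proof. by elim: k => //= k IH m _; rewrite mul0mx. Qed.

Lemma killedP k a u v : killed T k u -> killed T k v -> killed T k (a *: u + v).
Proof.
elim: k a u v => [|k IH] a u v /=; first by move=> -> ->; rewrite scaler0 addr0.
by move=> ku kv m Tm; rewrite mulmxDl -scalemxAl; apply: IH; [apply: ku|apply: kv].
Qed.

Lemma killedB k u v : killed T k u -> killed T k v -> killed T k (u - v).
Proof. by move=> ku kv; rewrite addrC -scaleN1r; apply: killedP. Qed.

Lemma killed_leq i j v : (i <= j)%N -> killed T i v -> killed T j v.
Proof.
elim: i j v => [|i IH] [|j] v //=; first by move=> _ -> m _; rewrite mul0mx; exact: killed0.
by rewrite ltnS => ij kv m Tm; apply: IH ij _; apply: kv.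
Qed.

(** A degree of [a] for the flag, shifted by [k] so that an arbitrary matrix has degree 0 when the
    flag is complete at step [k]; degree [k + k] then forces [a = 0]. *)
Definition lowers k d (a : M) :=
  forall i v, killed T i v -> killed T (i + k - d) (v *m a).

Lemma lowers0 k a : flag_nilpotent T k -> lowers k 0 a.
Proof. by move=> Tk i v _; apply: (@killed_leq k); rewrite ?subn0 ?leq_addl. Qed.

(** Right multiplication by [m] goes down one step of the flag, so both terms of the bracket gain
    one step over [a]. *)
Lemma lowers_br k d m a : T m -> lowers k d a -> lowers k d.+1 (br m a).
Proof.
move=> Tm la i v kv; rewrite /mxbr mulmxBr !mulmxA; apply: killedB.
  case: i kv => [->|i kv]; first by rewrite !mul0mx; exact: killed0.
  by rewrite addSn subSS; apply: la; apply: kv.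
have := la _ _ kv; rewrite subnS; case: (i + k - d)%N => [->|j kj] /=.
  by rewrite mul0mx.
exact: kj.
Qed.

Lemma lowers_eq0 k a : flag_nilpotent T k -> lowers k (k + k) a -> a = 0.
Proof. by move=> Tk /(_ k 1%:M (Tk _)); rewrite subnn mul1mx. Qed.

Lemma lowers_subspace k d : subspace (lowers k d).
Proof.
split=> [i v _|a u w lu lw i v kv]; first by rewrite mulmx0; exact: killed0.
by rewrite mulmxDr -scalemxAr; apply: killedP; [apply: lu|apply: lw].
Qed.

(** Each bracket with an element of [T] gains one degree, so the [d]-th derived algebra has degree
    [d] in the sense of [lowers], and the one of index [k + k] is zero. *)
Lemma flag_nilpotent_solvable k : lie_subalgebra br T -> flag_nilpotent T k ->
  lie_solvable br T.
Proof.
move=> LT Tk; exists (k + k)%N; rewrite eqEsubset; split=> [x|_ ->]; last first.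
  by have [[]] := iter_derived_subalgebra (k + k) LT.
move=> Dx; apply: (lowers_eq0 Tk); move: Dx.
have sub j : iter j (derived_algebra br) T `<=` T.
  elim: j => //= j IH; apply: subset_trans (derived_algebra_sub _) IH.
  exact: iter_derived_subalgebra.
suff : forall d, iter d (derived_algebra br) T `<=` lowers k d by apply.
elim=> [|d IH] /=; first by move=> y _; exact: lowers0.
apply: derived_algebra_min; first exact: lowers_subspace.
by move=> u v Du Dv; apply: lowers_br; [exact: (sub d)|exact: IH].
Qed.

Lemma killed_normalizer x : (forall m, T m -> T (br m x)) ->
  forall k v, killed T k v -> killed T k (v *m x).
Proof.
move=> nx; elim=> [|k IH] v /=; first by move=> ->; rewrite mul0mx.
move=> kv m Tm; have -> : v *m x *m m = v *m m *m x - v *m br m x.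
  by rewrite /mxbr mulmxBr !mulmxA opprB addrCA subrr addr0.
by apply: killedB; [apply: IH; apply: kv|apply: kv; exact: nx].
Qed.
End Killed.

(** Since [x] normalizes [T], it preserves the flag of [T]; each of the [k] steps is refined by the
    powers of [x], at most [N] of them, whence [k * N]. *)
Lemma flag_nilpotent_extend (T T' : set M) x k N :
  (forall m, T m -> T (br m x)) -> x ^+ N = 0 ->
  (forall y, T' y -> exists m c, T m /\ y = m + c *: x) ->
  flag_nilpotent T k -> flag_nilpotent T' (k * N).
Proof.
move=> nx xN T'E Tk v; have := Tk v; elim: k v {Tk} => [|k IH] v.
  by move=> ->; exact: killed0.
(* A second induction, on the power of [x] that carries [w] into the next step of the flag: elements
   of [T] lower [w] in the flag, and [x] lowers this power. *)
move=> kv; suff H : forall j w, (j <= N)%N -> killed T k.+1 w ->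
    killed T k (w *m x ^+ j) -> killed T' (k * N + j) w.
  by rewrite mulSn addnC; apply: H => //; rewrite xN mulmx0; exact: killed0.
elim=> [|j IHj] w jN kw; first by rewrite expr0 mulmx1 addn0; exact: IH.
rewrite exprS -[_ * _]/(_ *m _) mulmxA addnS => kwx y /T'E[m [c [Tm ->]]].
rewrite mulmxDr -scalemxAr addrC; apply: killedP; last first.
  by apply: (@killed_leq _ (k * N)%N); rewrite ?leq_addr //; apply: IH; exact: kw.
by apply: IHj => //; [exact: ltnW|exact: killed_normalizer].
Qed.

(* Jacobson's argument: a maximal subalgebra acting nilpotently has a
   normalizing element outside it, which can be adjoined. *)
Lemma engel (T : set M) N : lie_subalgebra br T -> (forall x, T x -> x ^+ N = 0) ->
  exists k, flag_nilpotent T k.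
Proof.
move=> [sT brT] nilT.
pose Q d := `[< exists U : {vspace M}, [/\ \dim U = d, forall u, u \in U -> T u,
  (forall u v, u \in U -> v \in U -> br u v \in U) &
  exists k, flag_nilpotent [set u | u \in U] k] >].
have Q0 : exists d, Q d.
  exists 0%N; apply/asboolP; exists 0%VS; split; first exact: dimv0.
  - by move=> v; rewrite memv0 => /eqP->; exact: subspace0.
  - by move=> u v; rewrite !memv0 => /eqP-> _; rewrite /mxbr mul0mx mulmx0 subr0.
  - by exists 1%N => v m /=; rewrite memv0 => /eqP->; rewrite mulmx0.
have Qm d : Q d -> (d <= \dim {:M})%N.
  by move=> /asboolP[U [<- _ _ _]]; exact/dimvS/subvf.
case: (ex_maxnP Q0 Qm) => d /asboolP[U [dU UT brU [k Uk]]] maxd.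
have [UeqT|] := pselect (forall x, T x -> x \in U).
  exists k; have -> // : T = [set u | u \in U].
  by apply/seteqP; split=> x /=; [exact: UeqT|exact: UT].
move=> /existsNP[t /not_implyP[Tt tU]].
have [x [Tx xU nx]] : exists x, [/\ T x, x \notin U & forall m, m \in U -> br m x \in U].
  (* Otherwise brackets with elements of [U], starting from [t], can be repeated for ever outside
     [U], each gaining one degree; after [k + k] of them the result is 0, which lies in [U]. *)
  apply: contrapT => noX.
  have step j : exists a, [/\ T a, a \notin U & lowers [set u | u \in U] k j a].
    elim: j => [|j [a [Ta aU la]]]; first by exists t; split=> //; [exact/negP|exact: lowers0].
    have [m [mU maU]] : exists m, m \in U /\ br m a \notin U.
      apply: contrapT => noM; apply: noX; exists a; split=> // m mU.
      by apply/negPn/negP => maU; apply: noM; exists m.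
    exists (br m a); split=> //; first by apply: brT => //; exact: UT.
    exact: lowers_br.
  have [a [_ /negP aU /(lowers_eq0 Uk) a0]] := step (k + k)%N.
  by apply: aU; rewrite a0 mem0v.
have /maxd : Q (\dim (U + <[x]>)%VS).
  apply/asboolP; exists (U + <[x]>)%VS; split=> //.
  - move=> _ /memv_addP[u uU [_ /vlineP[c ->] ->]].
    by apply: subspaceD => //; [exact: UT|exact: subspaceZ].
  - move=> _ _ /memv_addP[u uU [_ /vlineP[a ->] ->]] /memv_addP[v vU [_ /vlineP[b ->] ->]].
    apply: (subvP (addvSl _ _)).
    have brl w : br (u + a *: x) w = br u w + a *: br x w.
      rewrite /mxbr mulmxDl mulmxDr -scalemxAl -scalemxAr scalerBr.
      by rewrite opprD addrACA.
    rewrite linearD linearZ /= !brl mxbrxx scaler0 addr0.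
    apply: memvD; last by apply: memvZ; exact: nx.
    apply: memvD; first exact: brU.
    by apply: memvZ; rewrite mxbrC memvN nx.
  - exists (k * N)%N; apply: (flag_nilpotent_extend _ (nilT _ Tx) _ Uk) => // y.
    by move=> /memv_addP[u uU [_ /vlineP[c ->] ->]]; exists u, c.
rewrite -dU => dle; have : (U + <[x]> <= U)%VS.
  by rewrite -(geq_leqif (dimv_leqif_sup (addvSl U <[x]>))).
move/subvP/(_ x) => H; move/negP: xU; case; apply: H.
by apply: (subvP (addvSr _ _)); exact: memv_line.
Qed.

End Engel.

Lemma iter_mxbr (F : pzRingType) n (J : set 'M[F]_n) A B k :
  lie_subalgebra (@mxbr F n) J -> J A -> J B -> J (iter k (mxbr A) B).
Proof. by move=> [_ brJ] JA JB; elim: k => //= k; exact: brJ. Qed.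

Section Cartan.
Variables (R : rcfType) (n : nat).
Local Notation br := (@mxbr R n).
Implicit Types J L : set 'M[R]_n.

Lemma derived_algebra_sum J x : subspace J -> derived_algebra br J x ->
  exists N (u v : 'I_N -> 'M[R]_n),
    [/\ forall i, J (u i), forall i, J (v i) & x = \sum_i br (u i) (v i)].
Proof.
move=> sJ; apply: (derived_algebra_min (A := [set x | exists N (u v : 'I_N -> 'M[R]_n),
    [/\ forall i, J (u i), forall i, J (v i) & x = \sum_i br (u i) (v i)]])); last first.
  move=> u v Ju Jv; exists 1%N, (fun _ => u), (fun _ => v).
  by split=> //; rewrite big_ord1.
split.
  by exists 0%N, (fun _ => 0), (fun _ => 0); split=> [[]|[]|] //; rewrite big_ord0.
move=> a _ _ [N [u [v [Ju Jv ->]]]] [N' [u' [v' [Ju' Jv' ->]]]].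
exists (N + N')%N, (fun i => match fintype.split i with inl j => u j | inr j => u' j end),
  (fun i => match fintype.split i with inl j => a *: v j | inr j => v' j end).
split=> [i|i|]; [by case: fintype.split| |].
  by case: fintype.split => // j; exact: subspaceZ.
rewrite big_split_ord /= scaler_sumr; congr (_ + _); apply: eq_bigr => i _.
  by rewrite (unsplitK (inl i)) linearZ.
by rewrite (unsplitK (inr i)).
Qed.

(** [nilpotent_of_mxtrace] is applied over [R[i]], and nilpotency descends. Its trace condition
    holds because the iterates of [ad x] on [J] stay in [J]. The exponent [n] is the same for all
    [x], as [engel] demands. *)
Lemma cartan_nilpotent J x : lie_subalgebra br J ->
  (forall u v, J u -> J v -> \tr (u *m v) = 0) ->
  derived_algebra br J x -> x ^+ n = 0.
Proof.
move=> LJ tr0 Dx; have Jx : J x by apply: derived_algebra_sub Dx.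
have [N [u [v [Ju Jv xE]]]] := derived_algebra_sum LJ.1 Dx.
case: n J x LJ tr0 Dx Jx u v Ju Jv xE => [|m] J x LJ tr0 Dx Jx u v Ju Jv xE.
  by apply/matrixP => -[].
pose f := real_complex R.
have mapbr A B : map_mx f (mxbr A B) = mxbr (map_mx f A) (map_mx f B).
  by rewrite /mxbr map_mxB !map_mxM.
have : map_mx f x ^+ m.+1 = 0.
  apply: (@nilpotent_of_mxtrace _ _ _ N (map_mx f \o u) (map_mx f \o v)).
    by rewrite {1}xE raddf_sum; apply: eq_bigr => i _; exact: mapbr.
  move=> i k /=; have -> : iter k (mxbr (map_mx f x)) (map_mx f (v i)) =
      map_mx f (iter k (mxbr x) (v i)).
    by elim: k => //= k ->; rewrite mapbr.
  by rewrite -map_mxM trace_map_mx tr0 ?rmorph0 //; exact: (iter_mxbr k LJ).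
rewrite -rmorphXn => /eqP; rewrite map_mx_eq0 => /eqP //.
Qed.

(** The derived algebra consists of nilpotent matrices, hence is solvable by Engel's theorem; the
    derived series of [J] is one step longer. *)
Lemma cartan_solvable J : lie_subalgebra br J ->
  (forall u v, J u -> J v -> \tr (u *m v) = 0) -> lie_solvable br J.
Proof.
move=> LJ tr0; have LD := derived_algebra_subalgebra LJ.
have [k Dk] := engel LD (fun x => cartan_nilpotent LJ tr0).
have [j Dj] := flag_nilpotent_solvable LD Dk.
by exists j.+1; rewrite iterSr.
Qed.

End Cartan.

(** * Whitehead's first lemma *)

Lemma lie_solvable_inj {R : pzRingType} {V W : lmodType R}
    (brV : V -> V -> V) (brW : W -> W -> W) (f : V -> W) (J : set V) (J' : set W) :
  lie_subalgebra brV J -> lie_subalgebra brW J' ->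
  (forall a u v, J u -> J v -> f (a *: u + v) = a *: f u + f v) ->
  (forall u v, J u -> J v -> f (brV u v) = brW (f u) (f v)) ->
  (forall u, J u -> J' (f u)) -> (forall u, J u -> f u = 0 -> u = 0) ->
  lie_solvable brW J' -> lie_solvable brV J.
Proof.
move=> LJ LJ' flin fbr fJ finj [k Dk]; exists k.
have f0 : f 0 = 0.
  have J0 := subspace0 LJ.1.
  by have := flin (-1) 0 0 J0 J0; rewrite !scaleN1r oppr0 addr0 addNr.
have sub j : iter j (derived_algebra brV) J `<=`
    [set x | J x /\ iter j (derived_algebra brW) J' (f x)].
  elim: j => [|j IH] /=; first by move=> x Jx; split=> //; exact: fJ.
  apply: derived_algebra_min => [|u v /IH[Ju Du] /IH[Jv Dv]].
    split; first by rewrite /= f0; split; [exact: subspace0 LJ.1|exact: subspace0 (derived_algebra_subspace _ _)].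
    move=> a u v [Ju Du] [Jv Dv]; split; first exact: LJ.1.2.
    by rewrite flin //; apply: (derived_algebra_subspace _ _).2.
  split; first exact: LJ.2.
  by rewrite fbr //; exact: derived_algebra_br.
rewrite eqEsubset; split=> [x /sub[Jx]|_ ->].
  by rewrite Dk => /(finj _ Jx).
exact: subspace0 (iter_derived_subalgebra k LJ).1.
Qed.

Lemma lie_subalgebra_image {R : pzRingType} {V W : lmodType R}
    (brV : V -> V -> V) (brW : W -> W -> W) (f : V -> W) (J : set V) :
  lie_subalgebra brV J ->
  (forall a u v, J u -> J v -> f (a *: u + v) = a *: f u + f v) ->
  (forall u v, J u -> J v -> f (brV u v) = brW (f u) (f v)) ->
  lie_subalgebra brW (f @` J).
Proof.
move=> LJ flin fbr; have J0 := subspace0 LJ.1; split; [split|].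
- exists 0 => //.
  by have := flin (-1) 0 0 J0 J0; rewrite !scaleN1r oppr0 addr0 addNr.
- move=> a _ _ [u Ju <-] [v Jv <-]; exists (a *: u + v); last exact: flin.
  exact: LJ.1.2.
- move=> _ _ [u Ju <-] [v Jv <-]; exists (brV u v); last exact: fbr.
  exact: LJ.2.
Qed.

Section TraceForm.
Variables (F : fieldType) (n N : nat) (rho : {linear 'M[F]_n -> 'M[F]_N}).
Implicit Types (G U W : {vspace 'M[F]_n}).

Definition trform x y : F := \tr (rho x *m rho y).
Local Notation B := trform.

Lemma trformC x y : B x y = B y x. Proof. exact: mxtrace_mulC. Qed.
Lemma trform_is_linear x : linear (B x : _ -> F^o).
Proof. by move=> a u v; rewrite /B linearP mulmxDr -scalemxAr !linearD linearZ. Qed.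
HB.instance Definition _ x := GRing.isLinear.Build F _ F^o _ (B x) (trform_is_linear x).
Lemma trform_suml I (r : seq I) (P : pred I) (u : I -> 'M[F]_n) y :
  B (\sum_(i <- r | P i) u i) y = \sum_(i <- r | P i) B (u i) y.
Proof. by rewrite trformC linear_sum; apply: eq_bigr => i _; rewrite /= trformC. Qed.
Lemma trformZl a u y : B (a *: u) y = a * B u y.
Proof. by rewrite trformC linearZ /= trformC. Qed.
Lemma trformBl u v y : B (u - v) y = B u y - B v y.
Proof. by rewrite trformC linearB /= !(trformC y). Qed.

Lemma trform_invariant u x v : rho (mxbr u x) = mxbr (rho u) (rho x) ->
   rho (mxbr x v) = mxbr (rho x) (rho v) -> B (mxbr u x) v = B u (mxbr x v).
Proof.
rewrite /B => -> ->; rewrite /mxbr mulmxBl mulmxBr !linearB /= !mulmxA; congr (_ - _).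
by rewrite -mulmxA mxtrace_mulC.
Qed.

(** [W] is the kernel on [G] of the pairing with a basis of [U], so rank-nullity gives the bound. It
    will show that [U] is everything when [W] is zero. *)
Lemma orthogonal_vspace G U : exists W : {vspace 'M[F]_n},
    (forall x, x \in W <-> x \in G /\ forall u, u \in U -> B x u = 0) /\
    (\dim G <= \dim W + \dim U)%N.
Proof.
pose b := vbasis U.
pose f x : 'rV[F]_(\dim U) := \row_i B x b`_i.
have flin : linear f.
  by move=> a u v; apply/rowP => i; rewrite !mxE !(trformC _ b`_i) linearP.
pose fl := linfun (HB.pack_for {linear 'M[F]_n -> 'rV[F]_(\dim U)} f
  (GRing.isLinear.Build _ _ _ _ f flin)).
have flE x : fl x = f x by rewrite lfunE.
exists (G :&: lker fl)%VS; split=> [x|].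
  rewrite memv_cap memv_ker flE; split.
    move=> /andP[xG /eqP/rowP fx]; split=> // u /coord_vbasis ->.
    rewrite linear_sum big1 // => i _; rewrite linearZ /=.
    by have := fx i; rewrite !mxE => ->; rewrite scaler0.
  move=> [-> xU]; apply/eqP/rowP => i; rewrite !mxE; apply: xU.
  by apply: vbasis_mem; rewrite mem_nth // size_tuple.
rewrite -(limg_ker_dim fl G) leq_add2l (leq_trans (dimvS (subvf _))) //.
by rewrite dimvf /dim /= mul1n.
Qed.

(** Nondegeneracy on [W] makes the Gram matrix of a basis invertible, and its inverse produces the
    dual basis. *)
Lemma trform_dual_basis W :
  (forall x, x \in W -> (forall y, y \in W -> B x y = 0) -> x = 0) ->
  exists b b' : 'I_(\dim W) -> 'M[F]_n,
  [/\ forall i, b i \in W, forall i, b' i \in W,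
     forall i, B (b i) (b' i) = 1,
     forall y, y \in W -> y = \sum_i B y (b' i) *: b i &
     forall y, y \in W -> y = \sum_i B y (b i) *: b' i].
Proof.
move=> nd; pose b (i : 'I_(\dim W)) := (vbasis W)`_i.
have bW i : b i \in W by apply: vbasis_mem; rewrite mem_nth // size_tuple.
have coordW y : y \in W -> exists c, y = \sum_i c i *: b i.
  by move=> /coord_vbasis yE; exists (fun i => coord (vbasis W) i y).
have nd' x : x \in W -> (forall i, B x (b i) = 0) -> x = 0.
  move=> xW xb; apply: nd => // y /coordW[c ->].
  by rewrite linear_sum big1 // => i _; rewrite linearZ /= xb scaler0.
pose Gram : 'M[F]_(\dim W) := \matrix_(i, j) B (b i) (b j).
have uG : Gram \in unitmx.
  rewrite -row_free_unit; apply: inj_row_free => v vG.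
  have /freeP vf := basis_free (vbasisP W).
  have v0 : \sum_i v 0 i *: b i = 0.
    apply: nd' => [|j]; first by apply: memv_suml => i _; apply: memvZ.
    rewrite trform_suml; move/rowP: vG => /(_ j); rewrite !mxE => vG; rewrite -[RHS]vG.
    by apply: eq_bigr => i _; rewrite trformZl mxE.
  by apply/rowP => i; rewrite mxE; exact: (vf _ v0).
pose b' i := \sum_j invmx Gram i j *: b j.
have b'W i : b' i \in W by apply: memv_suml => j _; apply: memvZ.
have b'b i k : B (b' i) (b k) = (i == k)%:R.
  have /matrixP/(_ i k) := mulVmx uG; rewrite !mxE => <-.
  by rewrite trform_suml; apply: eq_bigr => j _; rewrite trformZl mxE.
exists b, b'; split=> //; first by move=> i; rewrite trformC b'b eqxx.
  move=> y /coordW[c yE]; rewrite {1}yE; apply: eq_bigr => i _; congr (_ *: _).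
  rewrite yE trform_suml (bigD1 i) //= trformZl trformC b'b eqxx mulr1 big1 ?addr0 //.
  by move=> j ji; rewrite trformZl trformC b'b eq_sym (negPf ji) mulr0.
move=> y yW; apply/eqP; rewrite -subr_eq0; apply/eqP; apply: nd' => [|k].
  by apply: memvB => //; apply: memv_suml => i _; apply: memvZ.
rewrite trformBl trform_suml (bigD1 k) //= trformZl b'b eqxx mulr1 big1 ?addr0 ?subrr //.
by move=> j ji; rewrite trformZl b'b (negPf ji) mulr0.
Qed.

(* Invariance of the Casimir tensor [sum_i b_i (x) b'_i], where Phi stands for a
   bilinear map out of the tensor product. *)
Lemma casimir_invariant W (b b' : 'I_(\dim W) -> 'M[F]_n) x
    (V : lmodType F) (Phi : 'M[F]_n -> 'M[F]_n -> V) :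
  (forall i, b i \in W) -> (forall i, b' i \in W) ->
  (forall y, y \in W -> y = \sum_i B y (b' i) *: b i) ->
  (forall y, y \in W -> y = \sum_i B y (b i) *: b' i) ->
  (forall y, y \in W -> mxbr y x \in W) ->
  (forall u v, u \in W -> v \in W -> B (mxbr u x) v = - B (mxbr v x) u) ->
  (forall u, linear (Phi u)) -> (forall u, linear (Phi^~ u)) ->
  \sum_i Phi (mxbr (b i) x) (b' i) + \sum_i Phi (b i) (mxbr (b' i) x) = 0.
Proof.
move=> bW b'W Eb Eb' Wx inv Pr Pl.
have Psr u (I : finType) (w : I -> 'M[F]_n) c :
    Phi u (\sum_j c j *: w j) = \sum_j c j *: Phi u (w j).
  pose L := HB.pack_for {linear 'M[F]_n -> V} (Phi u) (GRing.isLinear.Build _ _ _ _ _ (Pr u)).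
  rewrite -[Phi u]/(L : _ -> _) linear_sum; apply: eq_bigr => j _; rewrite linearZ; reflexivity.
have Psl u (I : finType) (w : I -> 'M[F]_n) c :
    Phi (\sum_j c j *: w j) u = \sum_j c j *: Phi (w j) u.
  pose L := HB.pack_for {linear 'M[F]_n -> V} (Phi^~ u) (GRing.isLinear.Build _ _ _ _ _ (Pl u)).
  rewrite -[LHS]/(L _) linear_sum; apply: eq_bigr => j _; rewrite linearZ; reflexivity.
under eq_bigr => i _ do rewrite (Eb _ (Wx _ (bW i))) Psl.
under [X in _ + X]eq_bigr => i _ do rewrite (Eb' _ (Wx _ (b'W i))) Psr.
rewrite exchange_big -big_split /= big1 // => i _.
rewrite -big_split /= big1 // => j _; rewrite inv //.
by rewrite scaleNr addNr.
Qed.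
End TraceForm.

Section Whitehead.
Variables (R : rcfType) (n : nat) (g : set 'M[R]_n).
Local Notation br := (@mxbr R n).
Hypothesis Lg : lie_subalgebra br g.
Hypothesis ssg : lie_semisimple br g.

Let gB u v : g u -> g v -> g (br u v). Proof. exact: Lg.2. Qed.

Lemma semisimple_ideal_tr0 (J : set 'M[R]_n) : lie_ideal br g J ->
  (forall u v, J u -> J v -> \tr (u *m v) = 0) -> forall x, J x -> x = 0.
Proof.
move=> idJ tr0 x Jx; have J0 := ssg idJ (cartan_solvable (ideal_subalgebra idJ) tr0).
by move: Jx; rewrite J0.
Qed.

Let mxtrace_br (u x v : 'M[R]_n) : \tr (br u x *m v) = \tr (u *m br x v).
Proof. exact: (@trform_invariant R n n idfun). Qed.

Let ideal_brC L J u v : lie_ideal br L J -> L u -> J v -> J (br v u).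
Proof.
by move=> [sJ _ H] Lu Jv; rewrite mxbrC -scaleN1r; apply: subspaceZ => //; exact: H.
Qed.

(** By invariance the radical of the trace form is an ideal, and the form vanishes on it, so
    Cartan's criterion makes it solvable. *)
Lemma semisimple_tr_nondegenerate x :
  g x -> (forall y, g y -> \tr (x *m y) = 0) -> x = 0.
Proof.
move=> gx xy; have := @semisimple_ideal_tr0 [set x | g x /\ forall y, g y -> \tr (x *m y) = 0].
apply; [split|by move=> u v [_ H] [gv _]; exact: H|by split].
- split=> [|a u v [gu Hu] [gv Hv]].
    by split=> [|y _]; [exact: subspace0 Lg.1|rewrite mul0mx mxtrace0].
  split=> [|y gy]; first exact: Lg.1.2.
  by rewrite mulmxDl -scalemxAl !linearD linearZ /= Hu // Hv // mulr0 addr0.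
- by move=> u [].
- move=> u v gu [gv Hv]; split=> [|y gy]; first exact: gB.
  by rewrite mxbrC mulNmx raddfN /= mxtrace_br Hv ?oppr0 //; exact: gB.
Qed.

Lemma semisimple_center x : g x -> (forall y, g y -> br x y = 0) -> x = 0.
Proof.
move=> gx xc; pose Z := [set x | g x /\ forall y, g y -> br x y = 0].
have idZ : lie_ideal br g Z.
  split.
  - split=> [|a u v [gu Hu] [gv Hv]].
      by split=> [|y _]; [exact: subspace0 Lg.1|rewrite mxbrC linear0 oppr0].
    split=> [|y gy]; first exact: Lg.1.2.
    by rewrite mxbrC linearP /= ![br y _]mxbrC Hu // Hv // oppr0 scaler0 addr0 oppr0.
  - by move=> u [].
  - move=> u v gu [gv Hv]; rewrite mxbrC Hv // oppr0; split; first exact: subspace0 Lg.1.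
    by move=> y _; rewrite mxbrC linear0 oppr0.
have Z0 : Z = [set 0].
  apply: (ssg idZ); exists 1%N => /=.
  rewrite eqEsubset; split; last first.
    by move=> _ ->; exact: subspace0 (derived_algebra_subspace _ _).
  apply: derived_algebra_min => [|u v [gu Hu] [gv _]]; last exact: Hu.
  by split=> // a u v -> ->; rewrite scaler0 addr0.
have : Z x by [].
by rewrite Z0.
Qed.

(** An element [z] orthogonal to all brackets is central, because [tr ([z, y] u) = tr (z [y, u])]
    and the form is nondegenerate; so [z = 0], and the dimension bound leaves no room between the
    derived algebra and [g]. *)
Lemma semisimple_perfect x : g x -> derived_algebra br g x.
Proof.
have [G GE] := subspace_vspace Lg.1.
have [D DE] := subspace_vspace (derived_algebra_subspace br g).
have [W [WE dW]] := orthogonal_vspace idfun G D.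
have W0 : W = 0%VS.
  apply/eqP; rewrite -subv0; apply/subvP => z /WE[/GE gz zD]; rewrite memv0; apply/eqP.
  apply: semisimple_center => // y gy; apply: semisimple_tr_nondegenerate => [|u gu].
    exact: gB.
  by rewrite mxtrace_br; apply: zD; apply/DE; exact: derived_algebra_br.
have DG : (D <= G)%VS.
  by apply/subvP => z /DE/(derived_algebra_sub Lg)/GE.
move: dW; rewrite W0 dimv0 add0n => dGD.
have : D == G by rewrite eqEdim DG.
by move/eqP => eDG /GE; rewrite -eDG => /DE.
Qed.

End Whitehead.

Section WhiteheadLemma.
Variables (R : rcfType) (n : nat) (g : set 'M[R]_n).
Local Notation br := (@mxbr R n).
Hypothesis Lg : lie_subalgebra br g.
Hypothesis ssg : lie_semisimple br g.

(* The Casimir element of the trace form of rho, restricted to the complement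
   of its kernel. *)
Lemma casimir_element N (rho : {linear 'M[R]_n -> 'M[R]_N}) :
  (forall x y, g x -> g y -> rho (br x y) = mxbr (rho x) (rho y)) ->
  (forall x, g x -> rho x = 0) \/
  exists C : 'M[R]_N, [/\ \tr C != 0,
    forall x, g x -> C *m rho x = rho x *m C &
    forall f : {linear 'M[R]_n -> 'rV[R]_N},
      (forall x y, g x -> g y -> f (br x y) = f x *m rho y - f y *m rho x) ->
      exists w, forall x, g x -> f x *m C = w *m rho x].
Proof.
move=> rhoM; have gB := Lg.2; have g0 := subspace0 Lg.1.
have [G GE] := subspace_vspace Lg.1.
have [K KE] : exists K : {vspace 'M[R]_n}, forall x, x \in K <-> g x /\ rho x = 0.
  apply: (@subspace_vspace _ _ [set x | g x /\ rho x = 0]).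
  split=> [|a u v [gu Hu] [gv Hv]]; first by split=> //; exact: linear0.
  split; first exact: Lg.1.2.
  by rewrite linearP Hu Hv scaler0 addr0.
(* The complement of the kernel is orthogonal for the trace form of [g] itself: [K] meets it in an
   ideal on which that form vanishes, hence in 0. *)
have [W [WE dW]] := orthogonal_vspace idfun G K.
have Wg x : x \in W -> g x by move=> /WE[/GE].
have trB u x v : \tr (br u x *m v) = \tr (u *m br x v).
  exact: (@trform_invariant R n n idfun).
have KW x : x \in K -> x \in W -> x = 0.
  move=> xK xW; have Kx : [set x | x \in K /\ x \in W] x by [].
  apply: (semisimple_ideal_tr0 ssg (J := [set x | x \in K /\ x \in W])) Kx; last first.
    by move=> u v [uK _] [_ /WE[_ vK]]; rewrite mxtrace_mulC; exact: vK.
  split.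
  - split=> [|a u v [uK uW] [vK vW]]; first by rewrite /= !mem0v.
    by rewrite /= !memvD ?memvZ.
  - by move=> u [/KE[gu _] _].
  - move=> u v gu [/KE[gv rv] /WE[_ vK]]; split.
      by apply/KE; rewrite rhoM // rv /mxbr mulmx0 mul0mx subr0; split=> //; exact: gB.
    apply/WE; split; first by apply/GE; exact: gB.
    move=> k /KE[gk rk]; rewrite /trform /= mxbrC mulNmx raddfN /= trB.
    rewrite [X in - X](_ : _ = 0) ?oppr0 //; apply: vK; apply/KE.
    by rewrite rhoM // rk /mxbr mulmx0 mul0mx subr0; split=> //; exact: gB.
have WI x y : g x -> y \in W -> br y x \in W.
  move=> gx yW; have [_ yK] := (WE y).1 yW; apply/WE; split; first by apply/GE/gB => //; exact: Wg.
  move=> k /KE[gk rk]; rewrite /trform /= trB; apply: yK; apply/KE.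
  by rewrite rhoM // rk /mxbr mulmx0 mul0mx subr0; split=> //; exact: gB.
have nd x : x \in W -> (forall y, y \in W -> trform rho x y = 0) -> x = 0.
  pose J := [set x | x \in W /\ forall y, y \in W -> trform rho x y = 0].
  have idJ : lie_ideal br g J.
    split.
    - split=> [|a u v [uW Hu] [vW Hv]].
        split=> [|y _]; first exact: mem0v.
        by rewrite trformC linear0.
      split=> [|y yW]; first by rewrite memvD ?memvZ.
      by rewrite trformC linearP /= !(trformC _ y) Hu // Hv // scaler0 addr0.
    - by move=> u [/Wg gu _].
    - move=> u v gu [vW Hv]; rewrite mxbrC; split=> [|y yW]; first by rewrite memvN WI.
      rewrite -scaleN1r trformZl trform_invariant ?rhoM ?Hv ?mulr0 //; try exact: Wg.
      by rewrite mxbrC memvN WI.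
  move=> xW xy; suff J0 : J = [set 0] by have : J x by []; rewrite J0.
  apply: (ssg idJ).
  (* [rho] is injective on [J] by [KW], and its image is solvable by Cartan's criterion since the
     trace form of [rho] vanishes on [J]. *)
  have LJ := ideal_subalgebra idJ; have Jg u : J u -> g u by move=> [/Wg gu _].
  have lin a u v : J u -> J v -> rho (a *: u + v) = a *: rho u + rho v.
    by move=> _ _; exact: linearP.
  have hom u v : J u -> J v -> rho (br u v) = mxbr (rho u) (rho v).
    by move=> /Jg gu /Jg gv; exact: rhoM.
  apply: (lie_solvable_inj LJ (lie_subalgebra_image LJ lin hom) lin hom).
  - by move=> u Ju; exists u.
  - by move=> u Ju ru0; apply: KW (proj1 Ju); apply/KE; split; first exact: Jg.
  - apply: cartan_solvable; first exact: lie_subalgebra_image LJ lin hom.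
    by move=> _ _ [u [uW Hu] <-] [v [vW _] <-]; exact: Hu.
have [b [b' [bW b'W bb' Eb Eb']]] := trform_dual_basis nd.
have inv u v x : g x -> u \in W -> v \in W ->
    trform rho (br u x) v = - trform rho (br v x) u.
  move=> gx /Wg gu /Wg gv; rewrite trform_invariant ?rhoM // mxbrC linearN /=.
  by rewrite trformC.
have [d0|dpos] := posnP (\dim W).
  left=> x gx; have : (K == G)%VS.
    rewrite eqEdim; apply/andP; split; last by rewrite (leq_trans dW) // d0.
    by apply/subvP => k /KE[/GE].
  by move=> /eqP KG; have /GE := gx; rewrite -KG => /KE[].
right; pose C := \sum_i rho (b i) *m rho (b' i).
have Phi x (V : lmodType R) (P : 'M[R]_n -> 'M[R]_n -> V) (gx : g x) := @casimir_invariant R n N rho W b b' x V P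
   bW b'W Eb Eb' (fun y => @WI x y gx) (fun u v => @inv u v x gx).
exists C; split.
(* Each pair of dual basis vectors contributes 1, so the trace is [\dim W], nonzero in
   characteristic 0. *)
- rewrite /C raddf_sum (eq_bigr (fun _ => 1)) => [|i _]; last exact: bb'.
  by rewrite sumr_const card_ord pnatr_eq0 -lt0n.
- move=> x gx; have := Phi x _ (fun u v => rho u *m rho v) gx.
  have -> : \sum_i rho (br (b i) x) *m rho (b' i) + \sum_i rho (b i) *m rho (br (b' i) x)
     = C *m rho x - rho x *m C.
    rewrite /C mulmx_suml mulmx_sumr -sumrB -big_split /=; apply: eq_bigr => i _.
    rewrite !rhoM //; try exact: Wg.
    by rewrite /mxbr mulmxBl mulmxBr !mulmxA addrC addrA subrK.
  move=> H; apply/eqP; rewrite -subr_eq0; apply/eqP; apply: H.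
    by move=> u a v w; rewrite linearP mulmxDr -scalemxAr.
  by move=> u a v w; rewrite linearP mulmxDl -scalemxAl.
(* Invariance is applied to [f u *m rho v]: after expanding the cocycle identity, only [w *m rho x]
   and [f x *m C] survive. *)
- move=> f fM; exists (\sum_i f (b i) *m rho (b' i)) => x gx.
  have := Phi x _ (fun u v => f u *m rho v) gx.
  have -> : \sum_i f (br (b i) x) *m rho (b' i) + \sum_i f (b i) *m rho (br (b' i) x)
     = (\sum_i f (b i) *m rho (b' i)) *m rho x - f x *m C.
    rewrite /C mulmx_suml mulmx_sumr -sumrB -big_split /=; apply: eq_bigr => i _.
    rewrite rhoM ?fM //; try exact: Wg.
    by rewrite /mxbr mulmxBl mulmxBr !mulmxA addrC addrA subrK.
  move=> H; apply/esym/eqP; rewrite -subr_eq0; apply/eqP; apply: H.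
    by move=> u a v w; rewrite linearP mulmxDr -scalemxAr.
  by move=> u a v w; rewrite linearP mulmxDl -scalemxAl.
Qed.

(* Fitting decomposition: E = C q(C) is the projector onto the part where C is
   invertible. *)
Lemma fitting_projector N (C : 'M[R]_N) : \tr C != 0 ->
  exists (q : 'M[R]_N), (\rank (1%:M - C *m q)%R < N)%N /\
    forall B : 'M[R]_N, C *m B = B *m C -> q *m B = B *m q.
Proof.
case: N C => [|N] C; first by rewrite /mxtrace big_ord0 eqxx.
move=> trC; have [m [q]] := multiplicity_XsubC (char_poly C) 0.
rewrite monic_neq0 ?char_poly_monic //= => q0 pq.
(* The power is [m.+1] instead of [m] so that a factor ['X], that is [C], can be split off even when
   [m = 0]. *)
have : coprimep (('X - 0%:P) ^+ m.+1) q.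
  by rewrite coprimep_expl // coprimep_sym coprimep_XsubC.
move=> /Bezout_eq1_coprimepP[[u v] /= uv].
exists (horner_mx C (u * 'X ^+ m)); split; last first.
  by move=> B CB; exact: comm_horner_mx.
have -> : 1%:M - C *m horner_mx C (u * 'X ^+ m) = horner_mx C (v * q).
  apply/eqP; rewrite subr_eq -[X in X *m _]horner_mx_X -[_ *m _]/(_ * _) -rmorphM -rmorphD /=.
  rewrite -[X in X == _](rmorph1 (horner_mx C)) -uv subr0 exprS; apply/eqP; congr (horner_mx C _).
  by rewrite addrC mulrCA.
(* At full rank [1 - C q] would be invertible while annihilating [C ^+ m], so [C] would be
   nilpotent, of trace zero. *)
rewrite ltn_neqAle rank_leq_row andbT; apply: contra trC => fullr.
have Cm : horner_mx C (v * q) * C ^+ m = 0.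
  rewrite -{2}[C]horner_mx_X -rmorphXn -rmorphM /= -mulrA.
  have -> : q * 'X^m = char_poly C by rewrite pq subr0.
  by rewrite rmorphM /= Cayley_Hamilton mulr0.
have uF : horner_mx C (v * q) \in unitmx by rewrite -row_free_unit.
apply/eqP; apply: (@mxtrace_nilpotent _ _ m).
by rewrite -[LHS]mul1mx -(mulVmx uF) -mulmxA [X in _ *m X]Cm mulmx0.
Qed.

(** Induction on [N]. If [rho] vanishes on [g], then [f] kills brackets, hence all of [g] by
    perfectness. Otherwise [f x = f x C q + f x E]: the first term is [w q rho x] by the Casimir
    element, and the second is a cocycle with values in the row space of [E], which is stable under
    [rho] and of smaller dimension. *)
Lemma whitehead N (rho : {linear 'M[R]_n -> 'M[R]_N}) (f : {linear 'M[R]_n -> 'rV[R]_N}) :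
  (forall x y, g x -> g y -> rho (br x y) = mxbr (rho x) (rho y)) ->
  (forall x y, g x -> g y -> f (br x y) = f x *m rho y - f y *m rho x) ->
  exists w, forall x, g x -> f x = w *m rho x.
Proof.
elim/ltn_ind: N rho f => N IH rho f rhoM fM.
have [rho0|[C [trC Crho /(_ f fM)[w fC]]]] := casimir_element rhoM.
  exists 0 => x /(semisimple_perfect Lg ssg) Dx; rewrite mul0mx; move: Dx.
  apply: (derived_algebra_min (A := [set x | f x = 0])) => [|u v gu gv /=].
    by split=> [|a u v /= fu fv]; rewrite /= ?linear0 // linearP fu fv scaler0 addr0.
  by rewrite fM // !rho0 // !mulmx0 subr0.
have [q [rk qC]] := fitting_projector trC.
pose E := 1%:M - C *m q; 
have [B freeB eqB] : exists2 B : 'M[R]_(\rank E, N), row_free B & (B :=: E)%MS.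
  by exists (row_base E); [exact: row_base_free|exact: eq_row_base].
have Erho x : g x -> E *m rho x = rho x *m E.
  move=> gx; rewrite /E mulmxBl mulmxBr mul1mx mulmx1; congr (_ - _).
  by rewrite -mulmxA qC ?Crho // mulmxA Crho // mulmxA.
have subB m (A : 'M[R]_(m, N)) : A *m E *m pinvmx B *m B = A *m E.
  by rewrite mulmxKpV // eqB submxMl.
have [rho' Brho] : exists rho' : {linear 'M[R]_n -> 'M[R]_(\rank E)},
    forall x, g x -> rho' x *m B = B *m rho x.
  exists (mulmxr (pinvmx B) \o (mulmx B \o rho)) => x gx /=.
  have /submxP[D BD] : (B <= E)%MS by rewrite eqB.
  have -> : B *m rho x = D *m rho x *m E by rewrite {1}BD -!mulmxA Erho.
  exact: subB.
have [f' f'B] : exists f' : {linear 'M[R]_n -> 'rV[R]_(\rank E)},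
    forall x, f' x *m B = f x *m E.
  by exists (mulmxr (pinvmx B) \o (mulmxr E \o f)) => x /=; rewrite subB.
have cancelB m (X Y : 'M[R]_(m, _)) : X *m B = Y *m B -> X = Y.
  exact: (row_free_inj freeB).
have [] := IH _ rk rho' f'.
- move=> x y gx gy; apply: cancelB; rewrite Brho ?rhoM //; last exact: Lg.2.
  rewrite [in RHS]/mxbr mulmxBl.
  rewrite -!mulmxA !Brho // !mulmxA !Brho //.
  by rewrite /mxbr mulmxBr !mulmxA.
- move=> x y gx gy; apply: cancelB; rewrite f'B fM // !mulmxBl -!mulmxA -!Erho //.
  by rewrite !Brho // !mulmxA !f'B.
move=> w' fw'; exists (w *m q + w' *m B) => x gx.
rewrite mulmxDl -[w' *m B *m _]mulmxA -Brho // mulmxA -fw' // f'B.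
rewrite -(mulmxA w) qC; last exact: Crho.
by rewrite mulmxA -fC // -mulmxA -mulmxDr addrC /E subrK mulmx1.
Qed.

End WhiteheadLemma.

(** * Formal power series and formal vector fields *)

Section Derivations.
Variables (R : comNzRingType) (A : comAlgType R) (n : nat) (d : 'I_n -> A -> A).

(** Formulated over an arbitrary algebra so as to serve both formal series and germs. *)
Definition vapply (X : {ffun 'I_n -> A}) (f : A) : A := \sum_(j < n) X j * d j f.

Lemma vfield_bracketE X Y i :
  vfield_bracket d X Y i = vapply X (Y i) - vapply Y (X i).
Proof. by rewrite ffunE sumrB. Qed.

Lemma vapplyDl a X Y f : vapply (a *: X + Y) f = a *: vapply X f + vapply Y f.
Proof.
rewrite /vapply scaler_sumr -big_split /=; apply: eq_bigr => j _.
by rewrite !ffunE mulrDl scalerAl.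
Qed.

Hypotheses (dlin : forall i, linear (d i))
  (dM : forall i a b, d i (a * b) = d i a * b + a * d i b)
  (dC : forall i j a, d i (d j a) = d j (d i a)).

Lemma derivation0 i : d i 0 = 0.
Proof. by have := dlin i (-1) 0 0; rewrite !scaleN1r oppr0 addr0 addNr. Qed.

Lemma derivationD i a b : d i (a + b) = d i a + d i b.
Proof. by rewrite -[a]scale1r dlin !scale1r. Qed.

Lemma derivation_sum i I (r : seq I) (P : pred I) (F : I -> A) :
  d i (\sum_(k <- r | P k) F k) = \sum_(k <- r | P k) d i (F k).
Proof. by apply: (big_morph (d i)) => [a b|]; [exact: derivationD|exact: derivation0]. Qed.

Lemma vapply_linear X : linear (vapply X).
Proof.
move=> a f g; rewrite /vapply scaler_sumr -big_split /=; apply: eq_bigr => j _.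
by rewrite dlin mulrDr scalerAr.
Qed.

(** [X (Y f)] splits into a first-order part and a second-order part; the latter is symmetric in [X]
    and [Y] because the derivations commute, and cancels in the commutator. *)
Lemma vapply_bracket X Y f :
  vapply (vfield_bracket d X Y) f = vapply X (vapply Y f) - vapply Y (vapply X f).
Proof.
have E U V : vapply U (vapply V f) =
    \sum_j vapply U (V j) * d j f + \sum_k \sum_j U k * V j * d k (d j f).
  rewrite {1}/vapply; under eq_bigr => k _.
    rewrite derivation_sum mulr_sumr.
    under eq_bigr => j _ do rewrite dM mulrDr !mulrA.
    rewrite big_split /=; over.
  rewrite big_split /=; congr (_ + _); rewrite exchange_big /=.
  by apply: eq_bigr => j _; rewrite mulr_suml.
rewrite !E [X in _ - (_ + X)]exchange_big /=.
rewrite [X in _ - (_ + X)](_ : _ = \sum_k \sum_j X k * Y j * d k (d j f)); last first.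
  by apply: eq_bigr => k _; apply: eq_bigr => j _; rewrite dC [Y j * _]mulrC.
rewrite opprD addrACA subrr addr0 -sumrB /vapply; apply: eq_bigr => j _.
by rewrite vfield_bracketE mulrBl.
Qed.
End Derivations.

Section FpsAlgebra.
Context {R : comNzRingType} {n : nat}.
Implicit Types (f g h : fps R n) (m k l : multi_index n).

Definition mbox m := [seq [ffun i => nat_of_ord (k i)]
              | k : {dffun forall i : 'I_n, 'I_(m i).+1}].
Definition msub m k : multi_index n := [ffun i => (m i - k i)%N].
Definition munit (i : 'I_n) : multi_index n := [ffun j => (i == j) : nat].
Definition madd m k : multi_index n := [ffun i => (m i + k i)%N].
Definition mdeg m : nat := \sum_i m i.

Lemma mem_mbox m k : (k \in mbox m) = [forall i, (k i <= m i)%N].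
Proof.
apply/idP/forallP => [/mapP[k' _ ->] i|lekm]; first by rewrite ffunE -ltnS.
have ltkm i : (k i < (m i).+1)%N by rewrite ltnS.
apply/mapP; exists [ffun i => Ordinal (ltkm i)]; first by rewrite mem_enum.
by apply/ffunP => i; rewrite !ffunE.
Qed.

Lemma mbox_uniq m : uniq (mbox m).
Proof.
rewrite map_inj_uniq ?enum_uniq // => k k' /ffunP kk'.
by apply/ffunP => i; apply: val_inj; have := kk' i; rewrite !ffunE.
Qed.

Lemma fps_mulE f g m : (f * g) m = \sum_(k <- mbox m) f k * g (msub m k).
Proof.
rewrite big_image; apply: eq_bigr => k _; congr (_ * g _).
by apply/ffunP => i; rewrite !ffunE.
Qed.

Lemma fps_addE f g m : (f + g) m = f m + g m. Proof. by []. Qed.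
Lemma fps_scaleE a f m : (a *: f) m = a * f m. Proof. by []. Qed.
Lemma fps_oppE f m : (- f) m = - f m. Proof. by []. Qed.
Lemma fps_1E m : (1 : fps R n) m = (m == [ffun=> 0%N])%:R. Proof. by []. Qed.
Lemma fps_sumE I (r : seq I) (P : pred I) (F : I -> fps R n) m :
  (\sum_(i <- r | P i) F i) m = \sum_(i <- r | P i) F i m.
Proof. by apply: (big_morph (fun f : fps R n => f m)). Qed.

Lemma fps_scaleAl a f g : a *: (f * g) = (a *: f) * g.
Proof.
apply/funext => m; rewrite fps_scaleE !fps_mulE mulr_sumr.
by apply: eq_bigr => k _; rewrite fps_scaleE mulrA.
Qed.
HB.instance Definition _ := GRing.Lmodule_isLalgebra.Build R (fps R n) fps_scaleAl.

Lemma fps_scaleAr a f g : a *: (f * g) = f * (a *: g).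
Proof. by rewrite mulrC fps_scaleAl mulrC. Qed.
HB.instance Definition _ := GRing.Lalgebra_isAlgebra.Build R (fps R n) fps_scaleAr.

Lemma mdeg_madd m k : mdeg (madd m k) = (mdeg m + mdeg k)%N.
Proof. by rewrite /mdeg -big_split; apply: eq_bigr => i _; rewrite ffunE. Qed.

Lemma mdeg_munit i : mdeg (munit i) = 1%N.
Proof.
rewrite /mdeg (bigD1 i) //= ffunE eqxx big1 ?addn0 // => j ji.
by rewrite ffunE eq_sym (negPf ji).
Qed.

Lemma msubK m k : k \in mbox m -> madd k (msub m k) = m.
Proof.
by rewrite mem_mbox => /forallP km; apply/ffunP => i; rewrite !ffunE subnKC.
Qed.

Lemma fps_partialE i f m : fps_partial i f m = f (madd m (munit i)) *+ (m i).+1.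
Proof.
rewrite /fps_partial; congr (f _ *+ _); by apply/ffunP => j; rewrite !ffunE.
Qed.

Lemma fps_partial_linear i : linear (@fps_partial R n i).
Proof.
move=> a f g; apply/funext => m; rewrite !(fps_addE, fps_scaleE, fps_partialE).
by rewrite mulrnDl mulrnAr.
Qed.

Lemma fps_partialC i j f : fps_partial i (fps_partial j f) = fps_partial j (fps_partial i f).
Proof.
apply/funext => m; rewrite !fps_partialE.
have -> : madd (madd m (munit i)) (munit j) = madd (madd m (munit j)) (munit i).
  by apply/ffunP => k; rewrite !ffunE addnAC.
have [->//|ij] := eqVneq i j; rewrite -!mulrnA !ffunE (eq_sym j) (negPf ij).
by rewrite !addn0 mulnC.
Qed.

(* Reindexing k = k' + e_i: the terms with k_i = 0 do not contribute. *)
Lemma fps_partial_mull i f g m :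
  \sum_(k <- mbox (madd m (munit i))) (f k * g (msub (madd m (munit i)) k)) *+ k i =
  (fps_partial i f * g) m.
Proof.
rewrite fps_mulE (bigID (fun k : multi_index n => k i == 0%N)) /=.
rewrite big1 ?add0r => [|k /eqP->]; last by rewrite mulr0n.
rewrite -big_filter.
have pm : perm_eq [seq k : multi_index n <- mbox (madd m (munit i)) | k i != 0%N]
    [seq madd k (munit i) | k <- mbox m].
  apply: uniq_perm; first by rewrite filter_uniq ?mbox_uniq.
    rewrite map_inj_uniq ?mbox_uniq // => k l /ffunP e; apply/ffunP => j.
    by have := e j; rewrite !ffunE => /addIn.
  move=> k; rewrite mem_filter mem_mbox; apply/andP/mapP => [[ki /forallP km]|[l]].
    exists (msub k (munit i)).
      rewrite mem_mbox; apply/forallP => j; have := km j; rewrite !ffunE.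
      by rewrite leq_subLR addnC.
    apply/ffunP => j; rewrite !ffunE subnK //.
    by case: eqP => // <-; rewrite lt0n.
  rewrite mem_mbox => /forallP lm ->; rewrite !ffunE eqxx addn1; split=> //.
  by apply/forallP => j; rewrite !ffunE leq_add2r.
rewrite (perm_big _ pm) big_map; apply: eq_bigr => k _.
rewrite fps_partialE !ffunE eqxx addn1 mulrnAl; congr (_ * g _ *+ _).
by apply/ffunP => j; rewrite !ffunE subnDr.
Qed.

(** At [M = m + e_i] the weight [m i + 1] is [k i + (M i - k i)] for every [k] in the box;
    [fps_partial_mull] evaluates both halves, the second after the substitution of [M - k] for
    [k]. *)
Lemma fps_partialM i f g :
  fps_partial i (f * g) = fps_partial i f * g + f * fps_partial i g.
Proof.
apply/funext => m; rewrite fps_addE [f * fps_partial _ _]mulrC -!fps_partial_mull fps_partialE fps_mulE.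
set M := madd m (munit i); rewrite -sumrMnl.
have pm : perm_eq (mbox M) [seq msub M k | k <- mbox M].
  have msubI k : k \in mbox M -> msub M (msub M k) = k.
    by rewrite mem_mbox => /forallP kM; apply/ffunP => j; rewrite ![msub _ _ _]ffunE subKn.
  have msubB k : msub M k \in mbox M.
    by rewrite mem_mbox; apply/forallP => j; rewrite ffunE leq_subr.
  apply: uniq_perm; first exact: mbox_uniq.
    rewrite map_inj_in_uniq ?mbox_uniq // => k l kM lM e.
    by rewrite -(msubI k) // e msubI.
  move=> k; apply/idP/mapP => [kM|[l _ ->]]; last exact: msubB.
  by exists (msub M k); rewrite ?msubI.
rewrite [X in _ = _ + X](perm_big _ pm) [X in _ = _ + X]big_map -big_split /=.
rewrite big_seq [RHS]big_seq; apply: eq_bigr => k kM.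
have -> : msub M (msub M k) = k.
  by move: kM; rewrite mem_mbox => /forallP kM; apply/ffunP => j; rewrite ![msub _ _ _]ffunE subKn.
rewrite [g _ * _]mulrC -mulrnDr; congr (_ *+ _).
move: kM; rewrite mem_mbox => /forallP/(_ i) kM.
by rewrite [msub _ _ _]ffunE subnKC // !ffunE eqxx addn1.
Qed.

(** The filtration by powers of the ideal of the variables, as a predicate so that 0 lies in every
    step. *)
Definition ord_ge (d : nat) f := forall m, (mdeg m < d)%N -> f m = 0.

Lemma ord_ge0 f : ord_ge 0 f. Proof. by []. Qed.
Lemma ord_ge_leq (j k : nat) f : (j <= k)%N -> ord_ge k f -> ord_ge j f.
Proof. by move=> jk fk m mj; apply: fk; exact: leq_trans jk. Qed.
Lemma ord_geD (k : nat) f g : ord_ge k f -> ord_ge k g -> ord_ge k (f + g).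
Proof. by move=> fk gk m mk; rewrite fps_addE fk // gk // addr0. Qed.
Lemma ord_geZ (k : nat) a f : ord_ge k f -> ord_ge k (a *: f).
Proof. by move=> fk m mk; rewrite fps_scaleE fk // mulr0. Qed.
Lemma ord_geN (k : nat) f : ord_ge k f -> ord_ge k (- f).
Proof. by move=> fk m mk; rewrite fps_oppE fk // oppr0. Qed.
Lemma ord_geB (k : nat) f g : ord_ge k f -> ord_ge k g -> ord_ge k (f - g).
Proof. by move=> fk gk; apply: ord_geD => //; exact: ord_geN. Qed.
Lemma ord_ge_sum (k : nat) I (r : seq I) (P : pred I) (F : I -> fps R n) :
  (forall i, P i -> ord_ge k (F i)) -> ord_ge k (\sum_(i <- r | P i) F i).
Proof. by move=> Fk; apply: big_ind => //; exact: ord_geD. Qed.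

Lemma ord_geM (j k : nat) f g : ord_ge j f -> ord_ge k g -> ord_ge (j + k) (f * g).
Proof.
move=> fj gk m mjk; rewrite fps_mulE big1_seq // => l /= lm.
have [lj|lj] := ltnP (mdeg l) j; first by rewrite fj // mul0r.
rewrite gk ?mulr0 // -(ltn_add2l (mdeg l)) -mdeg_madd msubK //.
by rewrite (leq_trans mjk) // leq_add2r.
Qed.

Lemma ord_ge_partial (k : nat) i f : ord_ge k.+1 f -> ord_ge k (fps_partial i f).
Proof.
move=> fk m mk; rewrite fps_partialE fk ?mul0rn //.
by rewrite mdeg_madd mdeg_munit addn1 ltnS.
Qed.

Lemma ord_geP f : (forall k : nat, ord_ge k f) -> f = 0.
Proof. by move=> fk; apply/funext => m; exact: (fk (mdeg m).+1). Qed.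

Lemma mdeg_eq0 m : (mdeg m == 0%N) = (m == [ffun=> 0%N]).
Proof.
rewrite /mdeg sum_nat_eq0; apply/forallP/eqP => [m0|-> i]; last by rewrite ffunE.
by apply/ffunP => i; rewrite ffunE; apply/eqP; exact: m0.
Qed.

Lemma ord_ge1 f : f [ffun=> 0%N] = 0 <-> ord_ge 1 f.
Proof.
split=> [f0 m|]; first by rewrite ltnS leqn0 mdeg_eq0 => /eqP->.
by apply; rewrite ltnS leqn0 mdeg_eq0.
Qed.

Lemma fps_mul0E f g : (f * g) [ffun=> 0%N] = f [ffun=> 0%N] * g [ffun=> 0%N].
Proof.
have E h : exists h', h = (h [ffun=> 0%N]) *: 1 + h' /\ h' [ffun=> 0%N] = 0.
  exists (h - h [ffun=> 0%N] *: 1); split; first by rewrite addrC subrK.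
  by rewrite fps_addE fps_oppE fps_scaleE fps_1E eqxx mulr1 subrr.
have [f' [fE f'0]] := E f; have [g' [gE g'0]] := E g.
rewrite {1}fE mulrDl fps_addE -scalerAl mul1r fps_scaleE -[RHS]addr0; congr (_ + _).
by apply/ord_ge1; rewrite -[1%N]addn0; apply: ord_geM => //; exact/ord_ge1.
Qed.

Definition fps_var (i : 'I_n) : fps R n := fun m => (m == munit i)%:R.

Lemma ord_ge_var i : ord_ge 1 (fps_var i).
Proof.
apply/ord_ge1; rewrite /fps_var; case: eqP => // /(congr1 mdeg).
rewrite mdeg_munit => e; have := mdeg_eq0 [ffun=> 0%N]; by rewrite e eqxx.
Qed.

Lemma fps_partial_var i j : fps_partial i (fps_var j) = (i == j)%:R.
Proof.
apply/funext => m; rewrite fps_partialE /fps_var.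
have [->|ij] := eqVneq i j.
  rewrite -[RHS]/((_ == _)%:R); have [->|m0] := eqVneq m [ffun=> 0%N].
    rewrite ffunE; case: eqP => // []; case.
    by apply/ffunP => k; rewrite !ffunE.
  case: eqP => [e|_]; last by rewrite mul0rn.
  case/eqP: m0; apply/ffunP => k; move/ffunP/(_ k): e; rewrite !ffunE.
  by move/eqP; rewrite -[X in _ == X]add0n eqn_add2r => /eqP.
rewrite -[RHS]/(0 : R); case: eqP => [e|_]; last by rewrite mul0rn.
move/ffunP/(_ i): e; rewrite !ffunE eqxx (eq_sym j) (negPf ij).
by rewrite addn1.
Qed.
End FpsAlgebra.

Section FormalFields.
Variables (R : comNzRingType) (n : nat).
Local Notation d := (@fps_partial R n).
Local Notation fvf := (formal_vfield R n).
Implicit Types (X Y phi : fvf) (f : fps R n).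

Definition vord (k : nat) X := forall i, ord_ge k (X i).
(** Rows belong to variables and columns to components, the transpose of the usual Jacobian matrix;
    with this choice linear parts preserve brackets without a change of sign. *)
Definition linpart X : 'M[R]_n := \matrix_(i, j) X j (munit i).

Lemma vordP k a X Y : vord k X -> vord k Y -> vord k (a *: X + Y).
Proof. by move=> kX kY i; rewrite !ffunE; apply: ord_geD => //; exact: ord_geZ. Qed.

Lemma vord_leq j k X : (j <= k)%N -> vord k X -> vord j X.
Proof. by move=> jk kX i; exact: ord_ge_leq (kX i). Qed.

Lemma vord0 k : vord k 0. Proof. by move=> i; rewrite ffunE. Qed.

Lemma vordD k X Y : vord k X -> vord k Y -> vord k (X + Y).
Proof. by move=> kX kY; rewrite -[X]scale1r; exact: vordP. Qed.

Lemma vord_eq0 X : (forall k, vord k X) -> X = 0.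
Proof. by move=> kX; apply/ffunP => i; rewrite ffunE; apply: ord_geP => k; exact: kX. Qed.

Lemma vanishes_at0P X : vanishes_at0 X <-> vord 1 X.
Proof. by split=> H i; have := H i; rewrite ord_ge1. Qed.

Lemma ord_ge_vapply j k X f : vord j X -> ord_ge k.+1 f -> ord_ge (j + k) (vapply d X f).
Proof.
move=> jX kf; apply: ord_ge_sum => i _; apply: ord_geM; first exact: jX.
exact: ord_ge_partial.
Qed.

Lemma ord_ge_vapply1 k X f : vord 1 X -> ord_ge k f -> ord_ge k (vapply d X f).
Proof. by case: k => // k X1 fk; rewrite -add1n; exact: ord_ge_vapply. Qed.

Lemma vord_bracket j k X Y :
  vord j.+1 X -> vord k.+1 Y -> vord (j + k).+1 (formal_bracket X Y).
Proof.
move=> jX kY i; rewrite vfield_bracketE; apply: ord_geB.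
  by rewrite -addSn; exact: ord_ge_vapply.
by rewrite addnC -addSn; exact: ord_ge_vapply.
Qed.

Lemma mdeg_eq1 (m : multi_index n) : mdeg m = 1%N -> exists i, m = munit i.
Proof.
move=> m1; have /existsP[i mi] : [exists i, m i != 0%N].
  rewrite -negb_forall; apply/negP => /forallP m0; move: m1.
  by rewrite /mdeg big1 // => i _; apply/eqP.
exists i; apply/ffunP => j; rewrite ffunE; move: m1; rewrite /mdeg (bigD1 i) //=.
case mi1: (m i) mi => [//|[|//]] _; rewrite add1n => -[] /eqP.
rewrite sum_nat_eq0 => /forallP/(_ j)/implyP H.
have [<-|ij] := eqVneq i j; first by rewrite mi1.
by apply/eqP/H; rewrite eq_sym.
Qed.

Lemma ord_ge2_linear f : ord_ge 1 f -> ord_ge 2 (f - \sum_i f (munit i) *: fps_var i).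
Proof.
move=> f1 m; rewrite ltnS leq_eqVlt => /orP[/eqP/mdeg_eq1[i ->]|m0]; last first.
  by apply: ord_geB (m0) => //; apply: ord_ge_sum => i _; apply: ord_geZ; exact: ord_ge_var.
rewrite fps_addE fps_oppE fps_sumE (bigD1 i) //= fps_scaleE /fps_var eqxx mulr1.
rewrite big1 ?addr0 ?subrr // => j ji; rewrite fps_scaleE.
case: eqP => [/ffunP/(_ j)|]; last by rewrite mulr0.
by rewrite !ffunE eqxx eq_sym (negPf ji).
Qed.

Lemma vapply_var X j : vapply d X (fps_var j) = X j.
Proof.
rewrite /vapply (bigD1 j) //= fps_partial_var eqxx mulr1 big1 ?addr0 // => i ij.
by rewrite fps_partial_var (negPf ij) mulr0.
Qed.

HB.instance Definition _ X := GRing.isLinear.Build R _ _ _ (vapply d X)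
  (vapply_linear (@fps_partial_linear R n) X).

Lemma vapply_lin_coef X f i : vord 1 X -> ord_ge 1 f ->
  vapply d X f (munit i) = \sum_k linpart X i k * f (munit k).
Proof.
move=> X1 f1; pose l := \sum_k f (munit k) *: fps_var k.
have -> : vapply d X f = vapply d X (f - l) + vapply d X l.
  by rewrite -linearD subrK.
have := ord_ge_vapply (k := 1) X1 (ord_ge2_linear f1).
rewrite fps_addE => ->; rewrite ?mdeg_munit // add0r.
rewrite linear_sum fps_sumE; apply: eq_bigr => k _.
by rewrite linearZ /= vapply_var fps_scaleE mxE mulrC.
Qed.

Lemma linpart_linear a X Y : linpart (a *: X + Y) = a *: linpart X + linpart Y.
Proof. by apply/matrixP => i j; rewrite !mxE !ffunE. Qed.

Lemma linpart0 : linpart 0 = 0.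
Proof. by apply/matrixP => i j; rewrite !mxE ffunE. Qed.

Lemma linpartB X Y : linpart (X - Y) = linpart X - linpart Y.
Proof. by apply/matrixP => i j; rewrite !mxE !ffunE. Qed.

Lemma linpart_sum I (r : seq I) (c : I -> R) (F : I -> fvf) :
  linpart (\sum_(i <- r) c i *: F i) = \sum_(i <- r) c i *: linpart (F i).
Proof.
elim: r => [|i r IH]; first by rewrite !big_nil linpart0.
by rewrite !big_cons linpart_linear IH.
Qed.

Lemma linpart_bracket X Y : vord 1 X -> vord 1 Y ->
  linpart (formal_bracket X Y) = mxbr (linpart X) (linpart Y).
Proof.
move=> X1 Y1; apply/matrixP => i j; rewrite mxE vfield_bracketE fps_addE fps_oppE.
by rewrite !vapply_lin_coef // !mxE; congr (_ - _); apply: eq_bigr => k _; rewrite [_ k j]mxE.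
Qed.

Lemma linpart_eq0 X : vord 1 X -> linpart X = 0 -> vord 2 X.
Proof.
move=> X1 /matrixP X0 j m; rewrite ltnS leq_eqVlt => /orP[/eqP/mdeg_eq1[i ->]|].
  by have := X0 i j; rewrite !mxE.
exact: X1.
Qed.

Lemma formal_bracketE X Y f : vapply d (formal_bracket X Y) f =
  vapply d X (vapply d Y f) - vapply d Y (vapply d X f).
Proof.
apply: vapply_bracket; [exact: fps_partial_linear|exact: fps_partialM|].
by move=> i j g; exact: fps_partialC.
Qed.

(** If [X] has order at least [k], then [X_j = - X (phi_j - x_j)] has order at least [k + 1], as
    [phi_j - x_j] has order 2; iterating gives 0. This is the formal analogue of the invertibility
    of a Jacobian matrix. *)
Lemma vapply_inj X phi : (forall j, ord_ge 2 (phi j - fps_var j)) ->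
  (forall j, vapply d X (phi j) = 0) -> X = 0.
Proof.
move=> phi2 Xphi; apply: vord_eq0; elim=> [|k IH] j; first exact: ord_ge0.
have -> : X j = - vapply d X (phi j - fps_var j).
  by rewrite linearB /= Xphi vapply_var sub0r opprK.
by apply: ord_geN; rewrite -addn1; apply: ord_ge_vapply.
Qed.

(* defect X phi = 0 says that the phi j span an X-invariant space, on which X
   acts by its linear part; X |-> defect X is a representation on n-tuples. *)
Definition defect X phi : fvf :=
  [ffun j => vapply d X (phi j) - \sum_i linpart X i j *: phi i].

Lemma defect_linear X a phi psi :
  defect X (a *: phi + psi) = a *: defect X phi + defect X psi.
Proof.
apply/ffunP => j; rewrite !ffunE.
rewrite linearP scalerBr addrACA -opprD.
congr (_ - _); rewrite scaler_sumr -big_split; apply: eq_bigr => i _ /=.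
by rewrite !ffunE scalerDr !scalerA mulrC.
Qed.
Lemma defectD X phi psi : defect X (phi + psi) = defect X phi + defect X psi.
Proof. by rewrite -[phi]scale1r defect_linear !scale1r. Qed.

Lemma defectB X phi psi : defect X (phi - psi) = defect X phi - defect X psi.
Proof. by rewrite addrC -scaleN1r defect_linear scaleN1r addrC. Qed.

Lemma defectDl a X Y phi : defect (a *: X + Y) phi = a *: defect X phi + defect Y phi.
Proof.
apply/ffunP => j; rewrite !ffunE vapplyDl scalerBr addrACA -opprD; congr (_ - _).
rewrite scaler_sumr -big_split; apply: eq_bigr => i _ /=.
by rewrite linpart_linear !mxE scalerDl scalerA.
Qed.

Lemma vord_defect k X phi : vord 1 X -> vord k phi -> vord k (defect X phi).
Proof.
move=> X1 kphi j; rewrite ffunE; apply: ord_geB; first exact: ord_ge_vapply1.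
by apply: ord_ge_sum => i _; exact: ord_geZ.
Qed.

(** With [phi] as a row, [defect X phi] is [X phi - phi (linpart X)]. Derivations commute with
    constant matrices, so the mixed terms are symmetric in [X] and [Y]; matrices acting on the right
    compose in reverse order, which the minus sign compensates. *)
Lemma defect_bracket X Y phi : vord 1 X -> vord 1 Y ->
  defect (formal_bracket X Y) phi = defect X (defect Y phi) - defect Y (defect X phi).
Proof.
move=> X1 Y1; apply/ffunP => j.
have DE U psi : defect U psi j = vapply d U (psi j) - \sum_i linpart U i j *: psi i.
  by rewrite ffunE.
have E U V : vapply d U (defect V phi j) - \sum_i linpart U i j *: defect V phi i =
   vapply d U (vapply d V (phi j)) + \sum_k (linpart V *m linpart U) k j *: phi k -
   (\sum_i linpart V i j *: vapply d U (phi i) + \sum_i linpart U i j *: vapply d V (phi i)).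
  rewrite ffunE linearB /=.
  under [X in _ - X]eq_bigr => i _ do rewrite ffunE scalerBr.
  rewrite sumrB opprB addrACA -opprD.
  congr (_ + _ - (_ + _)); last first.
    by rewrite linear_sum; apply: eq_bigr => i _; rewrite linearZ.
  transitivity (\sum_i \sum_k (linpart U i j * linpart V k i) *: phi k).
    by apply: eq_bigr => i _; rewrite scaler_sumr; apply: eq_bigr => k _; rewrite scalerA.
  rewrite exchange_big /=; apply: eq_bigr => k _; rewrite mxE scaler_suml.
  by apply: eq_bigr => i _; rewrite mulrC.
transitivity (defect X (defect Y phi) j - defect Y (defect X phi) j); last first.
  by rewrite [RHS]ffunE [X in _ = _ + X]ffunE.
rewrite (DE (formal_bracket X Y)) (DE X (defect Y phi)) (DE Y (defect X phi)) formal_bracketE linpart_bracket // !E [X in _ - (_ - X)]addrC opprB addrA subrK opprD addrACA; congr (_ + _).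
rewrite -sumrN -sumrN -big_split; apply: eq_bigr => i _ /=.
by rewrite !mxE -scalerBl -scaleNr opprB.
Qed.
End FormalFields.

(** * Linearization of formal semisimple Lie algebras *)

Lemma linear_pack (R : pzRingType) (U V : lmodType R) (f : U -> V) : linear f ->
  exists F : {linear U -> V}, forall x, F x = f x.
Proof.
move=> fl; by exists (HB.pack_for {linear U -> V} f (GRing.isLinear.Build _ _ _ _ f fl)).
Qed.

Section HomogeneousPart.
Variables (R : comNzRingType) (n k : nat).
Local Notation fvf := (formal_vfield R n).
(** Exponents in degree [k.+1] are at most [k.+1], whence the ordinals. The index set also contains
    other degrees, whose coordinates are set to 0, so that Whitehead's lemma can work on a full
    space of rows. *)
Let T : finType := ({ffun 'I_n -> 'I_k.+2} * 'I_n)%type.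
Let mon (t : T) : multi_index n := [ffun i => t.1 i : nat].

Definition hom_coord (z : fvf) : 'rV[R]_#|T| :=
  \row_t (if mdeg (mon (enum_val t)) == k.+1 then z (enum_val t).2 (mon (enum_val t)) else 0).

Definition hom_field (w : 'rV[R]_#|T|) : fvf :=
  [ffun j => fun m => if mdeg m == k.+1
    then w 0 (enum_rank ([ffun i => inord (m i)] : {ffun 'I_n -> 'I_k.+2}, j)) else 0].

Lemma hom_coord_linear a z w : hom_coord (a *: z + w) = a *: hom_coord z + hom_coord w.
Proof.
apply/rowP => t; rewrite !mxE !ffunE.
by case: ifP => _; rewrite ?fps_addE // mulr0 addr0.
Qed.

Lemma hom_coordD z w : hom_coord (z + w) = hom_coord z + hom_coord w.
Proof. by rewrite -[z]scale1r hom_coord_linear !scale1r. Qed.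

Lemma hom_coordB z w : hom_coord (z - w) = hom_coord z - hom_coord w.
Proof. by rewrite addrC -scaleN1r hom_coord_linear scaleN1r addrC. Qed.

Lemma hom_field_linear a z w : hom_field (a *: z + w) = a *: hom_field z + hom_field w.
Proof.
apply/ffunP => j; rewrite !ffunE; apply/funext => m.
rewrite fps_addE fps_scaleE; case: ifP => _; first by rewrite !mxE.
by rewrite mulr0 addr0.
Qed.

Lemma hom_field0 : hom_field 0 = 0.
Proof. by apply/ffunP => j; rewrite !ffunE; apply/funext => m; rewrite mxE if_same. Qed.

Lemma vord_hom_field w : vord k.+1 (hom_field w).
Proof. by move=> j m mk; rewrite ffunE ltn_eqF. Qed.

Lemma hom_coord_vord z : vord k.+2 z -> hom_coord z = 0.
Proof.
move=> zk; apply/rowP => t; rewrite !mxE; case: eqP => // e.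
by rewrite zk // e.
Qed.

Lemma hom_coordK z : vord k.+1 z -> vord k.+2 (z - hom_field (hom_coord z)).
Proof.
move=> zk j m; rewrite ltnS leq_eqVlt !ffunE => /orP[/eqP mk|mk]; last first.
  by rewrite fps_addE fps_oppE zk // ltn_eqF // subrr.
rewrite fps_addE fps_oppE mk eqxx mxE enum_rankK /=.
set m' := mon _; suff -> : m' = m by rewrite mk eqxx subrr.
apply/ffunP => i; rewrite !ffunE inordK // ltnS -mk.
by rewrite /mdeg (bigD1 i) //= leq_addr.
Qed.

Lemma vord_hom_coord z : vord k.+1 z -> hom_coord z = 0 -> vord k.+2 z.
Proof. by move=> /hom_coordK + e; rewrite e hom_field0 subr0. Qed.
End HomogeneousPart.

Section FormalLinearization.
Variables (R : rcfType) (n : nat).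
Local Notation fvf := (formal_vfield R n).
Local Notation fbr := (@formal_bracket R n).
Local Notation br := (@mxbr R n).
Variable Lh : set fvf.
Hypothesis LLh : lie_subalgebra fbr Lh.
Hypothesis fLh : fin_dim Lh.
Hypothesis sLh : lie_semisimple fbr Lh.
Hypothesis Lh1 : forall X, Lh X -> vord 1 X.

(* A decreasing chain of finite-dimensional spaces stabilizes. *)
Lemma fin_dim_vord : exists k, forall X, Lh X -> vord k X -> X = 0.
Proof.
have [N [e [_ eL]]] := fLh.
pose comb (a : 'rV[R]_N) := \sum_i a 0 i *: e i.
have combP c a b : comb (c *: a + b) = c *: comb a + comb b.
  rewrite /comb scaler_sumr -big_split; apply: eq_bigr => i _ /=.
  by rewrite !mxE scalerDl scalerA.
have /boolp.choice[U UE] : forall k, exists U : {vspace 'rV[R]_N}, forall a, a \in U <-> vord k (comb a).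
  move=> k; apply: (subspace_vspace (P := [set a | vord k (comb a)])); split.
    by rewrite /= /comb big1 => [|i _]; [exact: vord0|rewrite mxE scale0r].
  by move=> c a b /= ka kb; rewrite combP; exact: vordP.
have [k kmin] : exists k, forall j, (\dim (U k) <= \dim (U j))%N.
  have exd : exists d, `[< exists k, \dim (U k) = d >] by exists (\dim (U 0%N)); apply/asboolP; exists 0%N.
  case: (ex_minnP exd) => d /asboolP[k <-] dmin; exists k => j; apply: dmin.
  by apply/asboolP; exists j.
exists k => X LX kX; have [a XE] := eL _ LX.
have XE' : X = comb (\row_i a i) by rewrite XE; apply: eq_bigr => i _; rewrite mxE.
rewrite XE'; apply: vord_eq0 => j; apply/UE.
have [jk|kj] := leqP j k; first by apply/UE; rewrite -XE'; exact: vord_leq kX.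
have : (U j == U k)%VS.
  rewrite eqEdim kmin andbT; apply/subvP => b /UE jb; apply/UE.
  by apply: vord_leq jb; exact: ltnW.
by move=> /eqP->; apply/UE; rewrite -XE'.
Qed.

(** The [j]-th derived algebra of the ideal [K] has order at least [j.+2], and by finite dimension a
    high order forces zero; so [K] is solvable. *)
Lemma linpart_faithful X : Lh X -> linpart X = 0 -> X = 0.
Proof.
move=> LX X0; pose K := [set X | Lh X /\ vord 2 X].
have idK : lie_ideal fbr Lh K.
  split.
  - split=> [|a u v [Lu u2] [Lv v2]].
      by split; [exact: subspace0 LLh.1|exact: vord0].
    by split; [exact: LLh.1.2|exact: vordP].
  - by move=> u [].
  - move=> u v Lu [Lv v2]; split; first exact: LLh.2.
    by apply: (@vord_bracket _ _ 0 1) => //; exact: Lh1.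
have LK := ideal_subalgebra idK.
have K0 : K = [set 0].
  apply: (sLh idK); have [k Lk] := fin_dim_vord; exists k.
  rewrite eqEsubset; split=> [Y KY|_ ->]; last exact: subspace0 (iter_derived_subalgebra k LK).1.
  have sub j : iter j (derived_algebra fbr) K `<=` [set Y | Lh Y /\ vord j.+2 Y].
    elim: j => //= j IH; apply: derived_algebra_min => [|u v /IH[Lu u2] /IH[Lv v2]].
      split=> [|a u v [Lu u2] [Lv v2]].
        by split; [exact: subspace0 LLh.1|exact: vord0].
      by split; [exact: LLh.1.2|exact: vordP].
    split; first exact: LLh.2.
    by apply: vord_leq (vord_bracket u2 v2); rewrite addnS !ltnS leq_addr.
  have [LY kY] := sub _ _ KY; apply: Lk => //.
  by apply: vord_leq kY; rewrite ltnW // ltnW.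
have : K X by split=> //; apply: linpart_eq0 => //; exact: Lh1.
by rewrite K0.
Qed.

Lemma linpart_inj X Y : Lh X -> Lh Y -> linpart X = linpart Y -> X = Y.
Proof.
move=> LX LY XY; apply/eqP; rewrite -subr_eq0; apply/eqP; apply: linpart_faithful.
  exact: (subspaceB LLh.1).
by rewrite linpartB XY subrr.
Qed.

Let g : set 'M[R]_n := (@linpart R n) @` Lh.

Let linpartP a X Y : Lh X -> Lh Y -> linpart (a *: X + Y) = a *: linpart X + linpart Y.
Proof. by move=> _ _; exact: linpart_linear. Qed.
Let linpartM X Y : Lh X -> Lh Y -> linpart (fbr X Y) = br (linpart X) (linpart Y).
Proof. by move=> LX LY; apply: linpart_bracket; exact: Lh1. Qed.

Let Lg : lie_subalgebra br g.
Proof. exact: lie_subalgebra_image LLh linpartP linpartM. Qed.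

Lemma linpart_semisimple : lie_semisimple br g.
Proof.
move=> J idJ sJ; have LJ := ideal_subalgebra idJ; have [subJ Jg Jbr] := idJ.
pose J' := [set X | Lh X /\ J (linpart X)].
have idJ' : lie_ideal fbr Lh J'.
  split.
  - split=> [|a u v [Lu u2] [Lv v2]].
      by split; [exact: subspace0 LLh.1|rewrite linpart0; exact: subspace0].
    by split; [exact: LLh.1.2|rewrite linpart_linear; exact: subJ.2].
  - by move=> u [].
  - move=> u v Lu [Lv Jv]; split; first exact: LLh.2.
    by rewrite linpartM //; apply: Jbr => //; exists u.
have J'0 : J' = [set 0].
  apply: (sLh idJ').
  apply: (lie_solvable_inj (ideal_subalgebra idJ') LJ _ _ _ _ sJ (f := @linpart R n)).
  - by move=> a u v [Lu _] [Lv _]; exact: linpartP.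
  - by move=> u v [Lu _] [Lv _]; exact: linpartM.
  - by move=> u [].
  - by move=> u [Lu _]; exact: linpart_faithful.
rewrite eqEsubset; split=> [x Jx|_ ->]; last exact: subspace0.
have [X LX XE] := Jg _ Jx.
have : J' X by split=> //; rewrite XE.
by rewrite J'0 => X0; rewrite -XE X0 linpart0.
Qed.

(** The inverse of [linpart] on [g], extended to all matrices by the coordinates in a basis, since
    [whitehead] takes maps that are linear on the whole matrix space. *)
Lemma linpart_section : exists sigma : 'M[R]_n -> fvf,
  (forall a M N, sigma (a *: M + N) = a *: sigma M + sigma N) /\
  forall M, g M -> Lh (sigma M) /\ linpart (sigma M) = M.
Proof.
have [G GE] := subspace_vspace Lg.1.
have /boolp.choice[e eP] : forall i : 'I_(\dim G), exists X, Lh X /\ linpart X = (vbasis G)`_i.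
  move=> i; have : g (vbasis G)`_i by apply/GE/vbasis_mem; rewrite mem_nth // size_tuple.
  by case=> X LX XE; exists X.
pose s M := \sum_i coord (vbasis G) i M *: e i.
exists s; split.
  move=> a u v; rewrite /s scaler_sumr -big_split; apply: eq_bigr => i _ /=.
  by rewrite linearP scalerDl scalerA.
move=> M gM; split.
  rewrite /s; refine (@subspace_sum _ _ Lh _ _ _ _ LLh.1 _) => i _; apply: (subspaceZ _ LLh.1); exact: (eP i).1.
rewrite /s linpart_sum [RHS](coord_vbasis ((GE _).2 gM)); apply: eq_bigr => i _.
by rewrite (eP i).2.
Qed.

Lemma linearization_step k phi :
  (forall X, Lh X -> vord k.+1 (defect X phi)) ->
  exists psi, vord k.+1 psi /\ forall X, Lh X -> vord k.+2 (defect X (phi + psi)).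
Proof.
move=> phik; have [sigma [sigmaP sP]] := linpart_section.
pose N := #|{: {ffun 'I_n -> 'I_k.+2} * 'I_n}|.
have sLin M : g M -> vord 1 (sigma M) by move=> /sP[/Lh1].
have sbr M M' : g M -> g M' -> sigma (br M M') = fbr (sigma M) (sigma M').
  move=> gM gM'; have [LM lM] := sP _ gM; have [LM' lM'] := sP _ gM'.
  have [LB lB] := sP _ (Lg.2 _ _ gM gM').
  apply: linpart_inj => //; first exact: LLh.2.
  by rewrite lB linpartM // lM lM'.
(* The sign turns the left action of fields into a right action on rows: operators compose in the
   order opposite to the product of the matrices [r M]. *)
pose r M : 'M[R]_N := lin1_mx (fun w : 'rV[R]_N => - hom_coord k (defect (sigma M) (hom_field (w : 'rV[R]_N)))).
have rE M w : w *m r M = - hom_coord k (defect (sigma M) (hom_field (w : 'rV[R]_N))).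
  pose h (u : 'rV[R]_N) := - hom_coord k (defect (sigma M) (hom_field u)).
  have hlin : linear h.
    move=> a u v; rewrite /h hom_field_linear defect_linear hom_coord_linear.
    by rewrite opprD scalerN.
  have [L LE] := linear_pack hlin.
  have -> : r M = lin1_mx L by congr lin1_mx; apply/funext => u; rewrite LE.
  by rewrite mul_rV_lin1 LE.
have rlin : linear r.
  move=> a M M'; apply/row_matrixP => i; rewrite !rowE mulmxDr -scalemxAr !rE.
  by rewrite sigmaP defectDl hom_coord_linear opprD scalerN.
(* The obstruction in degree [k.+1]. Once it is written [w *m r M], the correction is [hom_field w],
   whose defect has the opposite leading part by the sign in [r]. *)
pose f M : 'rV[R]_N := hom_coord k (defect (sigma M) phi).
have flin : linear f by move=> a M M'; rewrite /f sigmaP defectDl hom_coord_linear.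
have [rho rhoE] := linear_pack rlin; have [F FE] := linear_pack flin.
(* defect modulo order k+2 only sees the degree k+1 part of z *)
have key M z : g M -> vord k.+1 z -> hom_coord k (defect (sigma M) z) = - (hom_coord k z *m r M).
  move=> gM zk; rewrite rE opprK; apply/eqP; rewrite -subr_eq0 -hom_coordB -defectB; apply/eqP.
  by apply: hom_coord_vord; apply: vord_defect; [exact: sLin|exact: hom_coordK].
have rhoM M M' : g M -> g M' -> rho (br M M') = mxbr (rho M) (rho M').
  move=> gM gM'; rewrite !rhoE; apply/row_matrixP => i; rewrite !rowE; set w := delta_mx 0 i.
  have e A B : g A -> g B ->
      w *m r A *m r B = hom_coord k (defect (sigma B) (defect (sigma A) (hom_field (w : 'rV[R]_N)))).
    move=> gA gB; rewrite (rE A) mulNmx -key //.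
    by apply: vord_defect; [exact: sLin|exact: vord_hom_field].
  rewrite /mxbr mulmxBr !mulmxA !e // rE sbr // defect_bracket; try exact: sLin.
  by rewrite hom_coordB opprB.
have fM M M' : g M -> g M' -> F (br M M') = F M *m rho M' - F M' *m rho M.
  have vk A : g A -> vord k.+1 (defect (sigma A) phi).
    by move=> gA; apply: phik; exact: (sP _ gA).1.
  move=> gM gM'; rewrite !rhoE !FE /f sbr // defect_bracket; try exact: sLin.
  rewrite hom_coordB (key M (defect (sigma M') phi)) ?(key M' (defect (sigma M) phi)) //; try exact: vk.
  by rewrite opprK addrC.
have [w wP] := whitehead Lg linpart_semisimple rhoM fM.
exists (hom_field (w : 'rV[R]_N)); split; first exact: vord_hom_field.
move=> X LX; have gX : g (linpart X) by exists X.
have XE : X = sigma (linpart X).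
  by have [LS lS] := sP _ gX; exact: linpart_inj.
apply: vord_hom_coord; rewrite defectD.
  apply: vordD; first exact: phik.
  by apply: vord_defect; [exact: Lh1|exact: vord_hom_field].
by rewrite hom_coordD {1 2}XE; have := wP _ gX; rewrite rhoE rE FE /f => ->; rewrite addNr.
Qed.

Lemma formal_linearization : exists phi : fvf,
  (forall X, Lh X -> defect X phi = 0) /\ forall j, ord_ge 2 (phi j - fps_var j).
Proof.
have /boolp.choice[psi psiP] : forall kp : nat * fvf, exists psi,
    (forall X, Lh X -> vord kp.1.+2 (defect X kp.2)) ->
    vord kp.1.+2 psi /\ forall X, Lh X -> vord kp.1.+3 (defect X (kp.2 + psi)).
  move=> [k phi] /=; have [H|H] := pselect (forall X, Lh X -> vord k.+2 (defect X phi)).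
    by have [psi psiP] := linearization_step H; exists psi.
  by exists 0.
(* The start is the tuple of the variables, whose defect is [X] minus its linear part, of order at
   least 2. *)
pose seq := fix seq k := if k is k'.+1 then seq k' + psi (k', seq k') else [ffun j => fps_var j] : fvf.
have seqD k : forall X, Lh X -> vord k.+2 (defect X (seq k)).
  elim: k => [|k IH] X LX; last exact: (psiP (k, seq k) IH).2.
  move=> j; rewrite ffunE [seq 0%N j]ffunE vapply_var.
  have -> : \sum_i linpart X i j *: seq 0%N i = \sum_i X j (munit i) *: fps_var i.
    by apply: eq_bigr => i _; rewrite mxE ffunE.
  by apply: ord_ge2_linear; exact: Lh1.
have seqB k j : vord k.+2 (seq (k + j)%N - seq k).
  elim: j => [|j IH]; first by rewrite addn0 subrr; exact: vord0.
  rewrite addnS /= addrAC; apply: vordD => //.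
  by apply: vord_leq (psiP (_, _) (seqD (k + j)%N)).1; rewrite !ltnS leq_addr.
(* Stage [k] already has the final coefficients up to degree [k.+1], so a coefficient of degree [d]
   may be read off at stage [d]. *)
pose phi : fvf := [ffun j => fun m => seq (mdeg m) j m].
have phiB k : vord k.+2 (phi - seq k).
  move=> j m mk; rewrite !ffunE fps_addE fps_oppE.
  have [le_mk|le_km] := leqP (mdeg m) k.
    have := seqB (mdeg m) (k - mdeg m)%N; rewrite subnKC // => /(_ j m).
    rewrite !ffunE fps_addE fps_oppE ltnW // => /(_ isT) /eqP; rewrite subr_eq0 => /eqP->.
    by rewrite subrr.
  have := seqB k (mdeg m - k)%N; rewrite subnKC; last exact: ltnW.
  by move=> /(_ j m mk); rewrite !ffunE fps_addE fps_oppE.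
exists phi; split=> [X LX|j]; last first.
  by have := phiB 0%N j; rewrite !ffunE.
apply: vord_eq0 => k; apply: (@vord_leq _ _ _ k.+2); first by rewrite ltnW.
rewrite -[phi](subrK (seq k)) defectD; apply: vordD; last exact: seqD.
by apply: vord_defect; [exact: Lh1|exact: phiB].
Qed.
End FormalLinearization.

(** * Taylor expansions of smooth functions *)

Section LineDerivative.
Variables (R : realType) (V : normedModType R).
Implicit Types (f g : V -> R) (x v : V).

Lemma line_is_derive f x v (u : R) : derivable f (u *: v + x) v ->
  is_derive u 1 (fun t => f (t *: v + x)) ('D_v f (u *: v + x)).
Proof.
move=> df; have E : (fun h : R => h^-1 *: (((fun t => f (t *: v + x)) \o shift u) (h *: 1) -
     f (u *: v + x))) =
   (fun h : R => h^-1 *: ((f \o shift (u *: v + x)) (h *: v) - f (u *: v + x))).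
  by apply/funext => h /=; rewrite [h *: 1]mulr1 scalerDl addrA.
by apply: DeriveDef; rewrite /derivable /derive E.
Qed.

Lemma line_MVT f x v (h : R) :
  (forall u : R, `|u| <= `|h| -> derivable f (u *: v + x) v) ->
  exists c, `|c| <= `|h| /\ f (h *: v + x) - f x = h * 'D_v f (c *: v + x).
Proof.
move=> df; pose p t := f (t *: v + x).
have dp (u : R) : `|u| <= `|h| -> is_derive u 1 p ('D_v f (u *: v + x)).
  by move=> uh; apply: line_is_derive; exact: df.
have p0 : p 0 = f x by rewrite /p scale0r add0r.
have cp (a b : R) : `|a| <= `|h| -> `|b| <= `|h| -> {within `[a, b], continuous p}.
  move=> ah bh; apply: derivable_within_continuous => u; rewrite in_itv /= => /andP[au ub].
  apply: (@ex_derive _ _ _ _ _ _ _ (dp u _)).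
  apply/ler_normlP; split.
    by apply: le_trans ah; rewrite -(normrN a); apply: le_trans (ler_norm _); rewrite lerN2.
  by apply: le_trans bh; apply: le_trans (ler_norm b).
have [h0|h0] := leP 0 h.
  have [u||c] := @MVT_segment _ p (fun u => 'D_v f (u *: v + x)) 0 h h0.
  - rewrite in_itv /= => /andP[u0 uh]; apply: dp.
    by rewrite !ger0_norm // ltW.
  - by apply: cp; rewrite ?normr0.
  rewrite in_itv /= => /andP[c0 ch] e; exists c; split; first by rewrite !ger0_norm.
  by rewrite -p0 -/(p h) e subr0 mulrC.
have [u||c] := @MVT_segment _ p (fun u => 'D_v f (u *: v + x)) h 0 (ltW h0).
- rewrite in_itv /= => /andP[hu u0]; apply: dp.
  by rewrite !ltr0_norm // lerN2 ltW.
- by apply: cp; rewrite ?normr0.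
rewrite in_itv /= => /andP[hc c0] e; exists c; split.
  by rewrite (ltr0_norm h0) ler0_norm // lerN2.
by apply/eqP; rewrite -p0 -/(p h) -opprB e sub0r mulrN opprK mulrC.
Qed.
End LineDerivative.

Section Schwarz.
Variables (R : realType) (n : nat).
Implicit Types (f g : 'rV[R]_n -> R) (U : set 'rV[R]_n).
Local Notation E i := (delta_mx 0 i : 'rV[R]_n).

Lemma smooth_onD U f g : open U -> smooth_on U f -> smooth_on U g -> smooth_on U (f + g).
Proof. by move=> oU /smooth_onP sf /smooth_onP sg; apply/smooth_onP => k; exact: CkD. Qed.

Lemma smooth_onM U f g : open U -> smooth_on U f -> smooth_on U g -> smooth_on U (f * g).
Proof. by move=> oU /smooth_onP sf /smooth_onP sg; apply/smooth_onP => k; exact: CkM. Qed.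

Lemma smooth_on_cst U (a : R) : open U -> smooth_on U (cst a).
Proof. by move=> oU; apply/smooth_onP => k; exact: Ck_cst. Qed.

Lemma smooth_on_partial U f s : smooth_on U f -> smooth_on U (foldr partial f s).
Proof. by move=> sf t; have := sf (t ++ s); rewrite foldr_cat. Qed.

Lemma smooth_on_sub U W f : W `<=` U -> smooth_on U f -> smooth_on W f.
Proof. by move=> WU sf s x Wx; apply: sf; exact: WU. Qed.

Lemma smooth_on_derivable U f x i : smooth_on U f -> U x -> derivable f x (E i).
Proof. by move=> /(_ [::]) /= H /H[_]; apply. Qed.

Lemma smooth_on_continuous U f x : smooth_on U f -> U x -> {for x, continuous f}.
Proof. by move=> /(_ [::]) /= H /H[]. Qed.

(* Both mixed derivatives are limits of the same second difference quotient. *)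
Lemma second_difference f U x i j (h : R) : smooth_on U f ->
  (forall u v : R, `|u| <= `|h| -> `|v| <= `|h| -> U (v *: E j + (u *: E i + x))) ->
  exists a b, [/\ `|a| <= `|h|, `|b| <= `|h| &
    f (h *: E j + (h *: E i + x)) - f (h *: E i + x) - (f (h *: E j + x) - f x) =
    h * (h * partial j (partial i f) (b *: E j + (a *: E i + x)))].
Proof.
move=> sf hU.
have U0 u : `|u| <= `|h| -> U (u *: E i + x).
  by move=> uh; have := hU u 0 uh; rewrite normr0 scale0r add0r; apply.
pose F y := f (h *: E j + y) - f y.
have dsh y : U (h *: E j + y) -> derivable (fun z => f (h *: E j + z)) y (E i) /\
    'D_(E i) (fun z => f (h *: E j + z)) y = partial i f (h *: E j + y).
  move=> Uy; have := smooth_on_derivable (i := i) sf Uy; rewrite /partial /derivable /derive.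
  have -> : (fun h0 : R => h0^-1 *: ((f \o shift (h *: E j + y)) (h0 *: E i) - f (h *: E j + y))) =
     (fun h0 => h0^-1 *: (((fun z => f (h *: E j + z)) \o shift y) (h0 *: E i) - f (h *: E j + y))).
    by apply/funext => t /=; rewrite addrCA.
  by move=> dy; split.
have dF u : `|u| <= `|h| -> derivable F (u *: E i + x) (E i) /\
    'D_(E i) F (u *: E i + x) = partial i f (h *: E j + (u *: E i + x)) - partial i f (u *: E i + x).
  move=> uh; have [d1 e1] := dsh _ (hU u h uh (lexx _)).
  have d2 := smooth_on_derivable (i := i) sf (U0 _ uh).
  have FE : F = (fun z => f (h *: E j + z)) - f by apply/funext.
  rewrite FE; split; first exact: (derivableB d1 d2).
  by rewrite (deriveB d1 d2) e1.
have [a [ah Fa]] := line_MVT (fun u uh => (dF u uh).1).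
move: Fa; rewrite (dF a ah).2 => Fa.
have [|b [bh Fb]] := @line_MVT _ _ (partial i f) (a *: E i + x) (E j) h.
  move=> u uh; apply: (smooth_on_derivable (smooth_on_partial [:: i] sf)).
  exact: hU.
by exists a, b; split=> //; rewrite -Fb -Fa.
Qed.

Lemma partialC U f i j x : open U -> smooth_on U f -> U x ->
  partial i (partial j f) x = partial j (partial i f) x.
Proof.
move=> oU sf Ux.
have C1 : {for x, continuous (partial i (partial j f))}.
  exact: (smooth_on_continuous (smooth_on_partial [:: i; j] sf) Ux).
have C2 : {for x, continuous (partial j (partial i f))}.
  exact: (smooth_on_continuous (smooth_on_partial [:: j; i] sf) Ux).
apply/eqP; rewrite -subr_eq0 -normr_le0; apply/ler_addgt0Pl => e e0; rewrite addr0.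
have e20 : 0 < e / 2 by rewrite divr_gt0.
have N0 : \forall y \near x, U y by apply: open_nbhs_nbhs.
have N1 : \forall y \near x,
    `|partial i (partial j f) x - partial i (partial j f) y| < e / 2.
  by move/cvgrPdist_lt: C1; apply.
have N2 : \forall y \near x,
    `|partial j (partial i f) x - partial j (partial i f) y| < e / 2.
  by move/cvgrPdist_lt: C2; apply.
have [r /= r0 rP] := (nbhs_ballP _ _).1 (filterI N0 (filterI N1 N2)).
(* With [h = r / 2 / M], two displacements of at most [h] along basis vectors stay in the ball of
   radius [r]; the summand 1 makes [M] positive and the inclusion strict. *)
pose M := `|E i| + `|E j| + 1.
have M0 : 0 < M by rewrite ltr_wpDl // addr_ge0.
pose h := r / 2 / M; have h0 : 0 < h by rewrite !divr_gt0.
have hP k l u v : `|E k| + `|E l| < M -> `|u| <= `|h| -> `|v| <= `|h| ->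
    ball x r (v *: E l + (u *: E k + x)).
  move=> kl uh vh; rewrite -ball_normE /= distrC addrA addrK.
  rewrite (le_lt_trans (ler_normD _ _)) // !normrZ.
  have -> : r = h * M + h * M by rewrite -mulrDr -mulr2n -[M *+ 2]mulr_natr mulrA /h divfK ?gt_eqF // divfK ?pnatr_eq0.
  rewrite (gtr0_norm h0) in uh vh.
  apply: (@le_lt_trans _ _ (h * `|E l| + h * `|E k|)).
    by apply: lerD; apply: ler_wpM2r.
  rewrite -!mulrDr; apply: (@lt_le_trans _ _ (h * M)); first by rewrite ltr_pM2l // addrC.
  by rewrite mulrDr lerDl mulr_ge0 // ltW.
clearbody h.
have ij : `|E i| + `|E j| < M by rewrite /M ltrDl.
have ji : `|E j| + `|E i| < M by rewrite addrC.
have [|a [b [ah bh e1]]] := @second_difference f U x i j h sf.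
  by move=> u v uh vh; apply: (rP _ (hP _ _ _ _ ij uh vh)).1.
have [|a' [b' [ah' bh' e2]]] := @second_difference f U x j i h sf.
  by move=> u v uh vh; apply: (rP _ (hP _ _ _ _ ji uh vh)).1.
have [_ [_ H2]] := rP _ (hP _ _ _ _ ij ah bh).
have [_ [H1 _]] := rP _ (hP _ _ _ _ ji ah' bh').
have eq : partial j (partial i f) (b *: E j + (a *: E i + x)) =
          partial i (partial j f) (b' *: E i + (a' *: E j + x)).
  have hn0 : h != 0 by rewrite gt_eqF.
  have sw : h *: E i + (h *: E j + x) = h *: E j + (h *: E i + x) by exact: addrCA.
  have d4 (A B C D : R) : A - B - (C - D) = A - C - (B - D).
    by ring.
  apply: (mulfI hn0); apply: (mulfI hn0); apply: etrans (esym e1) _.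
  by apply: etrans e2; rewrite d4; congr (f _ - _ - _).
rewrite distrC in H2; have := ltrD H1 H2.
rewrite -eq -splitr => H; apply/ltW; apply: le_lt_trans H.
exact: ler_distD.
Qed.
End Schwarz.

Section IteratedPartials.
Variables (R : realType) (n : nat).
Implicit Types (f g : 'rV[R]_n -> R) (U : set 'rV[R]_n) (s t : seq 'I_n).

Lemma foldr_partial_eq_on U f g s : open U -> (forall y, U y -> f y = g y) ->
  forall y, U y -> foldr partial f s y = foldr partial g s y.
Proof.
by move=> oU fg; elim: s => //= i s IH y Uy; exact: partial_eq_on Uy.
Qed.

Lemma foldr_partial_move U f s i t x : open U -> smooth_on U f -> U x ->
  foldr partial f (s ++ i :: t) x = foldr partial f (i :: s ++ t) x.
Proof.
move=> oU sf; elim: s x => //= j s IH x Ux.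
rewrite (partial_eq_on (U := U) oU _ IH Ux) /=.
exact: (@partialC _ _ U (foldr partial f (s ++ t)) j i x oU (smooth_on_partial _ sf) Ux).
Qed.

Lemma foldr_partial_perm U f s t x : open U -> smooth_on U f -> perm_eq s t -> U x ->
  foldr partial f s x = foldr partial f t x.
Proof.
move=> oU sf; elim: s t x => [|i s IH] t x st Ux.
  by have := perm_size st; case: t {st}.
have it : i \in t by rewrite -(perm_mem st) mem_head.
have [t1 [t2 tE]] : exists t1 t2, t = t1 ++ i :: t2.
  exists (take (index i t) t), (drop (index i t).+1 t).
  by rewrite -{1}(cat_take_drop (index i t) t) (drop_nth i) ?index_mem // nth_index.
move: st; rewrite {}tE.
rewrite -[i :: t2]cat1s perm_sym perm_catCA perm_sym perm_cons => st.
rewrite cat1s (foldr_partial_move _ _ _ oU sf Ux) /=.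
by apply: (partial_eq_on oU i _ Ux) => y Uy; exact: IH.
Qed.

(** Words replace multi-indices so that derivatives can be added one at a time; by symmetry of the
    derivatives, any word with the same counts will do. *)
Definition mword (m : multi_index n) : seq 'I_n := flatten [seq nseq (m i) i | i <- enum 'I_n].

Lemma mpartialE m f : mpartial m f = foldr partial f (mword m).
Proof.
rewrite /mpartial /mword; elim: (enum _) => //= i s ->; rewrite foldr_cat.
by elim: (m i) => //= k ->.
Qed.

Lemma count_mem_mword m i : count_mem i (mword m) = m i.
Proof.
rewrite count_flatten -map_comp sumnE big_map big_enum /= (bigD1 i) //= count_nseq /= eqxx mul1n.
by rewrite big1 ?addn0 // => j ji; rewrite count_nseq /= (negPf ji).
Qed.

Definition mcount s : multi_index n := [ffun i => count_mem i s].

Lemma mcount_mword m : mcount (mword m) = m.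
Proof. by apply/ffunP => i; rewrite ffunE count_mem_mword. Qed.

Lemma size_mcount s : mdeg (mcount s) = size s.
Proof.
elim: s => [|i s IH]; first by rewrite /mdeg big1 // => i _; rewrite ffunE.
rewrite /= -IH -add1n -[1%N](mdeg_munit i) -mdeg_madd; congr mdeg.
by apply/ffunP => j; rewrite !ffunE.
Qed.

Lemma size_mword m : size (mword m) = mdeg m.
Proof. by rewrite -size_mcount mcount_mword. Qed.

Lemma perm_mword m s : mcount s = m -> perm_eq (mword m) s.
Proof.
move=> <-; apply/allP => i _ /=; rewrite count_mem_mword ffunE eqxx //.
Qed.

Lemma smooth_on_at0 U f : open_nbhs (0 : 'rV[R]_n) U -> smooth_on U f -> smooth_at0 f.
Proof. by exists U. Qed.

Lemma smooth_at0_foldr f s : smooth_at0 f -> smooth_at0 (foldr partial f s).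
Proof. by move=> [U U0 sf]; exists U; [exact: U0|exact: smooth_on_partial]. Qed.

Lemma taylorE f m : smooth_at0 f -> forall s, mcount s = m ->
  taylor f m = foldr partial f s 0 / (\prod_i (m i)`!)%:R.
Proof.
move=> [U [oU U0] sf] s /perm_mword sm; congr (_ / _); rewrite mpartialE.
exact: foldr_partial_perm sm U0.
Qed.

Lemma taylor_partial f i : smooth_at0 f -> taylor (partial i f) = fps_partial i (taylor f).
Proof.
move=> sf; apply/funext => m; rewrite fps_partialE.
rewrite (@taylorE f _ sf (rcons (mword m) i)); last first.
  by apply/ffunP => j; rewrite !ffunE -cats1 count_cat count_mem_mword /= addn0.
rewrite foldr_rcons /taylor mpartialE -[RHS]mulr_natr -mulrA; congr (_ * _).
have -> : (\prod_j ((madd m (munit i)) j)`! = (m i).+1 * \prod_j (m j)`!)%N.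
  rewrite (bigD1 i) //= [in RHS](bigD1 i) //= mulnA !ffunE eqxx addn1 factS.
  congr (_ * _)%N; apply: eq_bigr => j ji; rewrite !ffunE eq_sym (negPf ji).
  by rewrite addn0.
rewrite natrM invfM mulrAC mulVf ?mul1r // pnatr_eq0.
Qed.

Lemma taylor0 f : taylor f [ffun=> 0%N] = f 0.
Proof.
rewrite /taylor mpartialE.
have -> : mword [ffun=> 0%N] = [::].
  by apply/nilP; rewrite /nilp size_mword mdeg_eq0.
by rewrite big1 ?divr1 // => i _; rewrite ffunE.
Qed.

Lemma taylor_ext f g : {near (0 : 'rV[R]_n), f =1 g} -> taylor f = taylor g.
Proof.
move=> fg; apply/funext => m; rewrite /taylor !mpartialE; congr (_ / _).
suff : {near (0 : 'rV[R]_n), foldr partial f (mword m) =1 foldr partial g (mword m)}.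
  exact: nbhs_singleton.
elim: (mword m) => //= i s; exact: partial_near_eq.
Qed.

Lemma partialD_at0 f g i : smooth_at0 f -> smooth_at0 g ->
  {near (0 : 'rV[R]_n), partial i (f + g) =1 partial i f + partial i g}.
Proof.
move=> [U oU sf] [W oW sg].
have H : nbhs (0 : 'rV[R]_n) (U `&` W).
  by apply: filterI; exact: open_nbhs_nbhs.
apply: filterS H => x [Ux Wx]; rewrite /partial deriveD //.
  exact: smooth_on_derivable sf Ux.
exact: smooth_on_derivable sg Wx.
Qed.

Lemma partialM_at0 f g i : smooth_at0 f -> smooth_at0 g ->
  {near (0 : 'rV[R]_n), partial i (f * g) =1 partial i f * g + f * partial i g}.
Proof.
move=> [U oU sf] [W oW sg].
have H : nbhs (0 : 'rV[R]_n) (U `&` W).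
  by apply: filterI; exact: open_nbhs_nbhs.
apply: filterS H => x [Ux Wx]; rewrite /partial deriveM; last first.
- exact: smooth_on_derivable sg Wx.
- exact: smooth_on_derivable sf Ux.
by rewrite addrC; congr (_ + _); exact: mulrC.
Qed.

(** A coefficient is recovered from those of a derivative because multiplication by a positive
    integer is injective in [R]. Identities between Taylor series are thereby reduced to values at
    0. *)
Lemma fps_eq_foldr (F G : fps R n) :
  (forall s, foldr (@fps_partial R n) F s [ffun=> 0%N] =
             foldr (@fps_partial R n) G s [ffun=> 0%N]) -> F = G.
Proof.
move=> FG; apply/funext => m; move Ek : (mdeg m) => k.
elim: k m F G Ek FG => [|k IH] m F G.
  by move/eqP; rewrite mdeg_eq0 => /eqP -> /(_ [::]).
move=> mk FG; have /existsP[i mi] : [exists i, m i != 0%N].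
  rewrite -negb_forall; apply/negP => /forallP m0; move: mk.
  by rewrite /mdeg big1 // => i _; apply/eqP.
have mE : m = madd (msub m (munit i)) (munit i).
  apply/ffunP => j; rewrite !ffunE subnK //.
  by case: eqP => // <-; rewrite lt0n.
have mk' : mdeg (msub m (munit i)) = k.
  by move: mk; rewrite {1}mE mdeg_madd mdeg_munit addn1 => -[].
have H : fps_partial i F (msub m (munit i)) = fps_partial i G (msub m (munit i)).
  by apply: IH mk' _ => s; rewrite -!foldr_rcons; exact: FG.
move: H; rewrite !fps_partialE -mE => /eqP.
by rewrite -subr_eq0 -mulrnBl mulrn_eq0 /= subr_eq0 => /eqP.
Qed.

Lemma foldr_taylor f s : smooth_at0 f ->
  foldr (@fps_partial R n) (taylor f) s = taylor (foldr partial f s).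
Proof.
move=> sf; elim: s => //= i s ->.
exact: esym (taylor_partial i (smooth_at0_foldr s sf)).
Qed.

Lemma taylorD f g : smooth_at0 f -> smooth_at0 g -> taylor (f + g) = taylor f + taylor g.
Proof.
move=> sf sg; apply: fps_eq_foldr => s.
have D F G : foldr (@fps_partial R n) (F + G) s =
    foldr (@fps_partial R n) F s + foldr (@fps_partial R n) G s.
  by elim: s => //= i s ->; rewrite (derivationD (@fps_partial_linear R n)).
rewrite D fps_addE !foldr_taylor ?taylor0; try exact: smooth_at0D; try by [].
have := smooth_at0D sf sg.
elim/last_ind: s f g sf sg {D} => [|s i IH] f g sf sg sfg; first by [].
rewrite !foldr_rcons -(IH _ _ (smooth_at0_partial i sf) (smooth_at0_partial i sg)); last first.
  by apply: smooth_at0D; exact: smooth_at0_partial.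
apply: (@nbhs_singleton _ (0 : 'rV[R]_n)
  (fun x => foldr partial _ s x = foldr partial _ s x)).
elim: s {IH} => [|j s IH] /=; first exact: partialD_at0.
exact: partial_near_eq.
Qed.

Lemma taylorM f g : smooth_at0 f -> smooth_at0 g -> taylor (f * g) = taylor f * taylor g.
Proof.
move=> sf sg; apply: fps_eq_foldr => s.
(* The word is peeled from its innermost derivative: the Leibniz rule holds for functions and for
   series, and leaves products covered by the induction, whence the generalization over [f] and
   [g]. *)
elim/last_ind: s f g sf sg => [|s i IH] f g sf sg.
  by rewrite /= fps_mul0E !taylor0.
have D F G : foldr (@fps_partial R n) (F + G) s =
    foldr (@fps_partial R n) F s + foldr (@fps_partial R n) G s.
  by elim: s {IH} => //= j s ->; rewrite (derivationD (@fps_partial_linear R n)).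
have sfi := smooth_at0_partial i sf; have sgi := smooth_at0_partial i sg.
rewrite !foldr_rcons -taylor_partial; last exact: smooth_at0M.
rewrite (taylor_ext (partialM_at0 i sf sg)) taylorD; try exact: smooth_at0M.
by rewrite fps_partialM -!taylor_partial // !D !fps_addE !IH.
Qed.

End IteratedPartials.

(** * Borel's theorem *)

Section UniformLimits.
Variables (R : realType) (V : normedModType R) (U : set V) (P : nat -> V -> R).
Variables (delta : nat -> R) (N0 : nat).
Hypothesis oU : open U.
Hypothesis delta0 : forall e, 0 < e -> exists N, (N0 <= N)%N /\ forall M, (N <= M)%N -> delta M <= e.

Lemma uniform_limit_continuous_at (F : V -> R) x : U x ->
  (forall N, (N0 <= N)%N -> {for x, continuous (P N)}) ->
  (forall N y, (N0 <= N)%N -> U y -> `|F y - P N y| <= delta N) ->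
  {for x, continuous F}.
Proof.
move=> Ux cP FP; apply/cvgrPdist_le => e e0.
have e3 : 0 < e / 3 by rewrite divr_gt0.
have [N [N0N dN]] := delta0 e3.
have dNN := dN N (leqnn N).
have HU : \forall y \near x, U y by apply: open_nbhs_nbhs.
have HP : \forall y \near x, `|P N x - P N y| <= e / 3.
  by move/cvgrPdist_le: (cP N N0N); apply.
apply: filterS (filterI HU HP) => y [Uy Py].
have H1 := le_trans (FP _ _ N0N Ux) dNN; have H2 := le_trans (FP _ _ N0N Uy) dNN.
rewrite distrC in H2.
have := lerD (lerD H1 Py) H2.
have -> : e / 3 + e / 3 + e / 3 = e by field.
apply: le_trans; apply: le_trans (ler_distD (P N y) _ _) _.
by rewrite lerD2r; exact: ler_distD.
Qed.

(* The mean value theorem applied to P M - P N bounds the difference quotients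
   of P M - P N uniformly in M. *)
Lemma uniform_limit_derivable (F G : V -> R) x v : U x ->
  (forall N y, (N0 <= N)%N -> U y -> derivable (P N) y v) ->
  (forall N y, (N0 <= N)%N -> U y -> `|F y - P N y| <= delta N) ->
  (forall N y, (N0 <= N)%N -> U y -> `|G y - 'D_v (P N) y| <= delta N) ->
  is_derive x v F (G x).
Proof.
move=> Ux dP FP GP.
suff H : (fun h : R => h^-1 *: ((F \o shift x) (h *: v) - F x)) @ 0^' --> G x.
  by apply: DeriveDef; [apply/cvg_ex; exists (G x)|exact: cvg_lim H].
apply/cvgrPdist_le => e e0.
have e8 : 0 < e / 8 by rewrite divr_gt0.
have [N [N0N dN]] := delta0 e8.
have [r /= r0 rU] := (nbhs_ballP _ _).1 (open_nbhs_nbhs (conj oU Ux)).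
have HP : \forall h \near 0^', `|'D_v (P N) x - h^-1 *: ((P N \o shift x) (h *: v) - P N x)| <= e / 8.
  by have /cvgrPdist_le := dP N x N0N Ux; apply.
have Hr : \forall h \near (0 : R)^', forall u : R, `|u| <= `|h| -> U (u *: v + x).
  have v1 : 0 < `|v| + 1 by rewrite ltr_wpDl.
  have s0 : 0 < r / (`|v| + 1) by rewrite divr_gt0.
  have near0 : \forall h \near (0 : R)^', `|h| < r / (`|v| + 1) by exact: dnbhs0_lt.
  apply: filterS near0 => h hr u uh; apply: rU.
  rewrite -ball_normE /= distrC addrK normrZ.
  apply: (@le_lt_trans _ _ (`|h| * (`|v| + 1))); last by rewrite -ltr_pdivlMr.
  by apply: ler_pM => //; rewrite lerDl.
have Hne : \forall h \near (0 : R)^', h != 0 by exact: nbhs_dnbhs_neq.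
apply: filterS (filterI Hne (filterI HP Hr)) => h [h0 [HPh HU]].
set y := h *: v + x; have Uy : U y by exact: HU.
change (is_true (`|G x - h^-1 *: (F y - F x)| <= e)).
have {}HPh : `|'D_v (P N) x - h^-1 *: (P N y - P N x)| <= e / 8 by exact: HPh.
have hp : 0 < `|h| by rewrite normr_gt0.
have PMN M : (N <= M)%N -> `|(P M y - P M x) - (P N y - P N x)| <= `|h| * (e / 4).
  move=> NM; have N0M := leq_trans N0N NM.
  have dMN u : `|u| <= `|h| -> derivable (P M - P N) (u *: v + x) v.
    by move=> uh; apply: derivableB; apply: dP => //; exact: HU.
  have [c [ch]] := line_MVT dMN.
  have Uc := HU c ch.
  rewrite (deriveB (dP _ _ N0M Uc) (dP _ _ N0N Uc)) => E.
  have -> : P M y - P M x - (P N y - P N x) = (P M - P N) y - (P M - P N) x.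
    by transitivity ((P M y - P N y) - (P M x - P N x)); [ring|].
  rewrite E normrM ler_wpM2l // -[X in X - _](subrK (G (c *: v + x))) -addrA.
  have -> : e / 4 = e / 8 + e / 8 by field.
  apply: le_trans (ler_normD _ _) _; apply: lerD.
    by rewrite distrC; apply: le_trans (GP _ _ N0M Uc) (dN _ NM).
  exact: le_trans (GP _ _ N0N Uc) (dN _ (leqnn _)).
(* [PMN] passes to the limit in [M]: the slack [e'] absorbs the distances from [P M] to [F] at the
   two points. *)
have FPN : `|(F y - F x) - (P N y - P N x)| <= `|h| * (e / 4).
  apply/ler_addgt0Pl => e' e'0.
  have [M1 [_ dM1]] : exists N1, (N0 <= N1)%N /\ forall M, (N1 <= M)%N -> delta M <= e' / 2.
    by apply: delta0; rewrite divr_gt0.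
  pose M := maxn N M1; have NM : (N <= M)%N by exact: leq_maxl.
  have N0M := leq_trans N0N NM; have dM := dM1 M (leq_maxr _ _).
  have H1 := le_trans (FP _ _ N0M Uy) dM; have H2 := le_trans (FP _ _ N0M Ux) dM.
  have -> : F y - F x - (P N y - P N x) =
     ((F y - P M y) - (F x - P M x)) + (P M y - P M x - (P N y - P N x)) by ring.
  apply: le_trans (ler_normD _ _) _; apply: lerD; last exact: PMN.
  apply: le_trans (ler_normB _ _) _.
  by rewrite [e']splitr; exact: lerD.
have -> : G x - h^-1 *: (F y - F x) = (G x - 'D_v (P N) x) +
    (('D_v (P N) x - h^-1 *: (P N y - P N x)) - h^-1 * ((F y - F x) - (P N y - P N x))).
  by rewrite /GRing.scale /=; ring.
have -> : e = e / 8 + (e / 8 + e * 3 / 4) by field.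
apply: le_trans (ler_normD _ _) _; apply: lerD.
  exact: le_trans (GP _ _ N0N Ux) (dN _ (leqnn _)).
apply: le_trans (ler_normB _ _) _; apply: lerD; first exact: HPh.
rewrite normrM normfV mulrC ler_pdivrMr //; apply: le_trans FPN _.
rewrite mulrC ler_wpM2r //; lra.
Qed.
End UniformLimits.

Section SmoothFamilies.
Variables (R : realType) (n : nat).
Implicit Types (f g : 'rV[R]_n -> R) (U : set 'rV[R]_n) (s xs : seq 'I_n).

Lemma Ck_inv U k f : open U -> (forall x, U x -> f x != 0) -> Ck_on U k f ->
  Ck_on U k (fun x => (f x)^-1).
Proof.
move=> oU f0; elim: k f f0 => [|k IH] f f0 Cf.
  split=> // x Ux; have [cf df] := C0_le Cf Ux.
  split=> [|i]; last exact: (derivableV (f0 _ Ux) (df i)).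
  exact: (cvgV (f0 _ Ux) cf).
have CV := IH f f0 (Ck_S Cf).
split=> [x Ux|i].
  have [cf df] := C0_le Cf Ux.
  split=> [|i]; last exact: (derivableV (f0 _ Ux) (df i)).
  exact: (cvgV (f0 _ Ux) cf).
have C1 := CkM oU (Ck_cst oU k (-1)) (CkM oU (CkM oU CV CV) (proj2 Cf i)).
apply: (Ck_ext oU _ C1) => x Ux.
rewrite /partial (deriveV (f0 _ Ux)); last by case: (C0_le Cf Ux).
change (-1 * (((f x)^-1 * (f x)^-1) * 'D_(delta_mx 0 i) f x) =
   - (f x)^- 2 * 'D_(delta_mx 0 i) f x).
by rewrite mulN1r mulNr -invfM expr2.
Qed.

Lemma smooth_on_inv U f : open U -> (forall x, U x -> f x != 0) -> smooth_on U f ->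
  smooth_on U (fun x => (f x)^-1).
Proof. by move=> oU f0 /smooth_onP sf; apply/smooth_onP => k; exact: Ck_inv. Qed.

Definition coordf (i : 'I_n) : 'rV[R]_n -> R := fun x => x 0 i.

Lemma coordf_is_derive i (x : 'rV[R]_n) (j : 'I_n) :
  is_derive x (delta_mx 0 j) (coordf i) (j == i)%:R.
Proof.
have -> : (j == i)%:R = (delta_mx 0 j : 'rV[R]_n) 0 i by rewrite mxE eqxx eq_sym.
have H : (fun h : R => h^-1 *: ((coordf i \o shift x) (h *: delta_mx 0 j) - coordf i x)) @ 0^' -->
   (delta_mx 0 j : 'rV[R]_n) 0 i.
  apply: cvg_near_cst; apply: filterS (nbhs_dnbhs_neq (0 : R)) => h h0.
  by rewrite /coordf /= !mxE addrK; exact: mulKf.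
by apply: DeriveDef; [apply/cvg_ex; exists ((delta_mx 0 j : 'rV[R]_n) 0 i)|exact: cvg_lim H].
Qed.

Lemma smooth_on_coordf U i : open U -> smooth_on U (coordf i).
Proof.
move=> oU; apply/smooth_onP => k.
have C0 : C0_partials U (coordf i).
  move=> x _; split=> [|j]; first exact: coord_continuous.
  exact: (@ex_derive _ _ _ _ _ _ _ (coordf_is_derive i x j)).
case: k => [|k]; split=> // j.
apply: (Ck_ext oU _ (Ck_cst oU k ((j == i)%:R))) => x _.
by rewrite /partial (@derive_val _ _ _ _ _ _ _ (coordf_is_derive i x j)).
Qed.

Lemma smooth_on_sum U (I : Type) (r : seq I) (F : I -> 'rV[R]_n -> R) : open U ->
  (forall i, smooth_on U (F i)) -> smooth_on U (\sum_(i <- r) F i).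
Proof.
move=> oU sF; elim: r => [|i r IH]; first by rewrite big_nil; exact: smooth_on_cst.
by rewrite big_cons; exact: (smooth_onD oU (sF i) IH).
Qed.

Lemma foldr_partialD U f g s x : open U -> smooth_on U f -> smooth_on U g -> U x ->
  foldr partial (f + g) s x = foldr partial f s x + foldr partial g s x.
Proof.
move=> oU sf sg; elim: s x => //= i s IH x Ux.
rewrite (partial_eq_on (g := foldr partial f s + foldr partial g s) oU i _ Ux) //.
rewrite /partial deriveD //.
  exact: (smooth_on_derivable (smooth_on_partial s sf) Ux).
exact: (smooth_on_derivable (smooth_on_partial s sg) Ux).
Qed.

Lemma foldr_partial_sum U (I : Type) (r : seq I) (F : I -> 'rV[R]_n -> R) s x : open U ->
  (forall i, smooth_on U (F i)) -> U x ->
  foldr partial (\sum_(i <- r) F i) s x = \sum_(i <- r) foldr partial (F i) s x.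
Proof.
move=> oU sF Ux; elim: r => [|i r IH].
  rewrite !big_nil; elim: s x Ux => //= i s IH x Ux.
  have -> : partial i (foldr partial 0 s) x = partial i (cst 0) x.
    exact: (partial_eq_on oU i IH Ux).
  by rewrite /partial derive_cst.
by rewrite !big_cons (foldr_partialD _ oU) ?IH //; exact: smooth_on_sum.
Qed.

Fixpoint monf xs : 'rV[R]_n -> R :=
  if xs is i :: xs' then coordf i * monf xs' else cst 1.

Lemma smooth_on_monf U xs : open U -> smooth_on U (monf xs).
Proof.
move=> oU; elim: xs => [|i xs IH] /=; first exact: smooth_on_cst.
exact: (smooth_onM oU (smooth_on_coordf i oU) IH).
Qed.

Definition quad (t : R) : 'rV[R]_n -> R := fun x => 1 + \sum_i (t * x 0 i) ^+ 2.
Definition qinv t : 'rV[R]_n -> R := fun x => (quad t x)^-1.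

Lemma quadE t : quad t = cst 1 + \sum_i cst (t ^+ 2) * (coordf i * coordf i).
Proof.
apply/funext => x.
have -> : (cst 1 + \sum_i cst (t ^+ 2) * (coordf i * coordf i)) x =
   1 + (\sum_i cst (t ^+ 2) * (coordf i * coordf i)) x by [].
rewrite fct_sumE /quad; congr (_ + _); apply: eq_bigr => i _.
by rewrite exprMn.
Qed.

Lemma quad_ge1 t x : 1 <= quad t x.
Proof. by rewrite lerDl; apply: sumr_ge0 => i _; exact: sqr_ge0. Qed.

Lemma quad_gt0 t x : 0 < quad t x.
Proof. exact: lt_le_trans (quad_ge1 t x). Qed.

Lemma smooth_on_quad U t : open U -> smooth_on U (quad t).
Proof.
move=> oU; rewrite quadE; apply: (smooth_onD oU (smooth_on_cst 1 oU)).
apply: (smooth_on_sum _ oU) => i; apply: (smooth_onM oU (smooth_on_cst _ oU)).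
exact: (smooth_onM oU (smooth_on_coordf i oU) (smooth_on_coordf i oU)).
Qed.

Lemma smooth_on_qinv U t : open U -> smooth_on U (qinv t).
Proof.
move=> oU; apply: (smooth_on_inv oU _ (smooth_on_quad t oU)) => x _.
by rewrite gt_eqF ?quad_gt0.
Qed.

Lemma smooth_on_exp U f l : open U -> smooth_on U f -> smooth_on U (f ^+ l).
Proof.
move=> oU sf; elim: l => [|l IH]; first exact: smooth_on_cst.
by rewrite exprS; exact: (smooth_onM oU sf IH).
Qed.

Lemma fct_expE f l x : (f ^+ l) x = f x ^+ l.
Proof. by elim: l => // l IH; rewrite !exprS -IH. Qed.

Lemma quad_is_derive t i (x : 'rV[R]_n) :
  is_derive x (delta_mx 0 i) (quad t) (2 * t ^+ 2 * x 0 i).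
Proof.
rewrite quadE.
have D := is_deriveD (is_derive_cst (1 : R) x (delta_mx 0 i)) (is_derive_sum
  (fun j => is_deriveM (is_derive_cst (t ^+ 2) x (delta_mx 0 i))
    (is_deriveM (coordf_is_derive j x i) (coordf_is_derive j x i)))).
apply: (is_derive_eq D).
rewrite add0r (bigD1 i) //= big1 => [|j ji].
  by rewrite eqxx /coordf /cst /GRing.scale /=; ring.
by rewrite eq_sym (negPf ji) /GRing.scale /=; ring.
Qed.

Lemma qinv_is_derive t i (x : 'rV[R]_n) :
  is_derive x (delta_mx 0 i) (qinv t) (- (2 * t ^+ 2 * x 0 i * qinv t x ^+ 2)).
Proof.
have q0 : quad t x != 0 by rewrite gt_eqF ?quad_gt0.
have dq := quad_is_derive t i x.
apply: DeriveDef; first exact: (derivableV q0 (@ex_derive _ _ _ _ _ _ _ dq)).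
rewrite (deriveV q0 (@ex_derive _ _ _ _ _ _ _ dq)) (@derive_val _ _ _ _ _ _ _ dq).
by rewrite /qinv /GRing.scale /= exprVn mulNr mulrC.
Qed.

Lemma qinvX_is_derive t l i (x : 'rV[R]_n) :
  is_derive x (delta_mx 0 i) (qinv t ^+ l)
    (- (2 * l%:R * t ^+ 2 * x 0 i * qinv t x ^+ l.+1)).
Proof.
have D := is_deriveX l (qinv_is_derive t i x).
apply: (is_derive_eq D).
rewrite /GRing.scale /=; case: l {D} => [|l]; first by rewrite !mulr0 !mul0r oppr0.
by rewrite /= (exprS _ l.+1) (exprS _ l) expr2; ring.
Qed.

(* The words, with multiplicity, left by differentiating the monomial xs along i. *)
Fixpoint dmon i xs : seq (seq 'I_n) :=
  if xs is j :: xs' then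
    (if i == j then [:: xs'] else [::]) ++ [seq j :: y | y <- dmon i xs']
  else [::].

Lemma size_dmon i xs y : y \in dmon i xs -> size xs = (size y).+1.
Proof.
elim: xs y => //= j xs IH y; rewrite mem_cat => /orP[|/mapP[z /IH -> ->] //].
by case: eqP => // _; rewrite inE => /eqP->.
Qed.

Lemma monf_is_derive xs i (x : 'rV[R]_n) :
  is_derive x (delta_mx 0 i) (monf xs) (\sum_(y <- dmon i xs) monf y x).
Proof.
elim: xs => [|j xs IH] /=; first by rewrite big_nil; exact: is_derive_cst.
have D := is_deriveM (coordf_is_derive j x i) IH.
apply: (is_derive_eq D).
rewrite big_cat big_map /= addrC; congr (_ + _).
  by rewrite scaler_sumr.
case: (i == j); first by rewrite big_seq1 /GRing.scale /= mulr1.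
by rewrite big_nil scaler0.
Qed.

(** Differentiating [1 / (1 + t^2 |x|^2)^l] produces a factor [t^2 x_i] and one more power of the
    denominator, so finite sums of these functions are stable under partial derivatives; [j] counts
    the factors [t^2]. *)
Definition qmon c xs j l t : 'rV[R]_n -> R :=
  cst (c * t ^+ (2 * j)) * (qinv t ^+ l * monf xs).

Lemma smooth_on_qmon U c xs j l t : open U -> smooth_on U (qmon c xs j l t).
Proof.
move=> oU; apply: (smooth_onM oU (smooth_on_cst _ oU)).
exact: (smooth_onM oU (smooth_on_exp l oU (smooth_on_qinv t oU)) (smooth_on_monf xs oU)).
Qed.

Lemma qmonE c xs j l t x :
  qmon c xs j l t x = c * t ^+ (2 * j) * (qinv t x ^+ l * monf xs x).
Proof. by rewrite -fct_expE. Qed.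

Lemma partial_qmon c xs j l t i x : partial i (qmon c xs j l t) x =
  (\sum_(y <- dmon i xs) qmon c y j l t + qmon (- (2 * l%:R * c)) (i :: xs) j.+1 l.+1 t) x.
Proof.
have D := is_deriveM (is_derive_cst (c * t ^+ (2 * j)) x (delta_mx 0 i))
  (is_deriveM (qinvX_is_derive t l i x) (monf_is_derive xs i x)).
rewrite /partial (@derive_val _ _ _ _ _ _ _ D) scaler0 addr0.
have -> : (\sum_(y <- dmon i xs) qmon c y j l t + qmon (- (2 * l%:R * c)) (i :: xs) j.+1 l.+1 t) x =
   \sum_(y <- dmon i xs) qmon c y j l t x + qmon (- (2 * l%:R * c)) (i :: xs) j.+1 l.+1 t x.
  by rewrite -[LHS]/((\sum_(y <- dmon i xs) qmon c y j l t) x + _) fct_sumE.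
rewrite !qmonE fct_expE.
under [in RHS]eq_bigr do rewrite qmonE.
rewrite -!mulr_sumr scalerDr; congr (_ + _).
rewrite /GRing.scale /= mulnS exprD -[(coordf i * monf xs) x]/(x 0 i * monf xs x).
by ring.
Qed.

(** Put [rho = |x|], [u = t rho] and [q = 1 / (1 + u^2)]. As [|x_i| <= 1] and [q <= 1], surplus
    factors may be dropped, leaving [t^(2j) q^(j+1) rho^(2j+1) = (u^2 q)^j (u q) / t], where [u^2 q]
    and [u q] are at most 1. *)
Lemma qmon_bound c xs j l t (x : 'rV[R]_n) : 1 <= t -> (j < l)%N -> (2 * j < size xs)%N ->
  (forall i, `|x 0 i| <= 1) -> `|qmon c xs j l t x| <= `|c| / t.
Proof.
move=> t1 jl jxs x1; have t0 : 0 < t by exact: lt_le_trans t1.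
pose rho := Num.sqrt (\sum_i x 0 i ^+ 2).
have S0 : 0 <= \sum_i x 0 i ^+ 2 by apply: sumr_ge0 => i _; exact: sqr_ge0.
have rho0 : 0 <= rho by exact: sqrtr_ge0.
have xrho i : `|x 0 i| <= rho.
  rewrite -sqrtr_sqr ler_wsqrtr // (bigD1 i) //= lerDl.
  by apply: sumr_ge0 => k _; exact: sqr_ge0.
have mon_le a ys : (a <= size ys)%N -> `|monf ys x| <= rho ^+ a.
  elim: ys a => [|i ys IH] [|a] //=.
  - by rewrite /cst normr1.
  - move=> _; rewrite -[(coordf i * monf ys) x]/(x 0 i * monf ys x) normrM expr0.
    by rewrite mulr_ile1 // (IH 0%N).
  - rewrite ltnS -[(coordf i * monf ys) x]/(x 0 i * monf ys x) normrM exprS => ale.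
    by apply: ler_pM => //; exact: IH.
pose u := t * rho; have u0 : 0 <= u by rewrite mulr_ge0 // ltW.
have qE : quad t x = 1 + u ^+ 2.
  rewrite /quad /u exprMn sqr_sqrtr // mulr_sumr; congr (_ + _).
  by apply: eq_bigr => i _; rewrite exprMn.
pose q := qinv t x; have q0 : 0 < q by rewrite invr_gt0 quad_gt0.
have q1 : q <= 1 by rewrite invf_le1 ?quad_gt0 ?quad_ge1.
have uq : u * q <= 1.
  by rewrite ler_pdivrMr ?quad_gt0 // mul1r qE; nra.
have u2q : u ^+ 2 * q <= 1.
  by rewrite ler_pdivrMr ?quad_gt0 // mul1r qE lerDr.
rewrite qmonE !normrM -mulrA ler_wpM2l //.
rewrite !normrX (gtr0_norm t0) -/q (gtr0_norm q0).
apply: (@le_trans _ _ (t ^+ (2 * j) * (q ^+ j.+1 * rho ^+ (2 * j).+1))).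
  apply: ler_wpM2l; first by rewrite exprn_ge0 // ltW.
  apply: ler_pM; rewrite ?exprn_ge0 // ?(ltW q0) //; last exact: mon_le.
  by apply: ler_wiXn2l => //; rewrite ltW.
have -> : t ^+ (2 * j) * (q ^+ j.+1 * rho ^+ (2 * j).+1) = (u ^+ 2 * q) ^+ j * (u * q) / t.
  rewrite /u [(_ * q) ^+ j]exprMn [(t * rho) ^+ 2]exprMn exprMn -!exprM !exprS.
  have tn0 : t != 0 by rewrite gt_eqF.
  clearbody q; move: (t ^+ (2 * j)) (rho ^+ (2 * j)) (q ^+ j) => a b d.
  by field.
rewrite ler_pdivrMr // mulVf ?gt_eqF //.
have A0 : 0 <= u ^+ 2 * q by rewrite mulr_ge0 ?exprn_ge0 // ltW.
have B0 : 0 <= u * q by rewrite mulr_ge0 // ltW.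
by apply: mulr_ile1 => //; [exact: exprn_ge0|exact: exprn_ile1].
Qed.

(** Intended for derivatives of order [d]: they are [O(1/t)] as [t] grows, uniformly on a cube. *)
Definition decays d (G : seq 'I_n -> R -> 'rV[R]_n -> R) :=
  exists2 C, 0 <= C & forall (s : seq 'I_n) (t : R) (x : 'rV[R]_n), size s = d -> 1 <= t ->
    (forall i, `|x 0 i| <= 1) -> `|G s t x| <= C / t.

Lemma decays0 d : decays d (fun _ _ _ => 0).
Proof. by exists 0 => // s t x _ _ _; rewrite normr0 mul0r. Qed.

Lemma decaysD d G H : decays d G -> decays d H ->
  decays d (fun s t x => G s t x + H s t x).
Proof.
move=> [C C0 GC] [D D0 HD]; exists (C + D) => [|s t x sd t1 x1]; first exact: addr_ge0.
rewrite mulrDl; apply: le_trans (ler_normD _ _) _.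
by apply: lerD; [exact: GC|exact: HD].
Qed.

Lemma decays_sum d (I : eqType) (r : seq I) (G : I -> seq 'I_n -> R -> 'rV[R]_n -> R) :
  (forall i, i \in r -> decays d (G i)) ->
  decays d (fun s t x => \sum_(i <- r) G i s t x).
Proof.
elim: r => [|i r IH] dG.
  have -> : (fun s t x => \sum_(i <- [::]) G i s t x) = fun _ _ _ => 0.
    by do 3!apply/funext => ?; rewrite big_nil.
  exact: decays0.
have -> : (fun s t x => \sum_(j <- i :: r) G j s t x) =
    fun s t x => G i s t x + \sum_(j <- r) G j s t x.
  by do 3!apply/funext => ?; rewrite big_cons.
apply: decaysD; first by apply: dG; exact: mem_head.
by apply: IH => j jr; apply: dG; rewrite inE jr orbT.
Qed.

(* Differentiating d times lowers (number of x) - 2 (power of t^2) by d and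
   keeps j < l. *)
Lemma decays_qmon d c xs j l : (j < l)%N -> (2 * j + d < size xs)%N ->
  decays d (fun s t x => foldr partial (qmon c xs j l t) s x).
Proof.
elim: d c xs j l => [|d IH] c xs j l jl dxs.
  exists `|c| => // s t x /size0nil -> t1 x1; apply: qmon_bound => //.
  by rewrite addn0 in dxs.
have step i : decays d (fun s t x => foldr partial (partial i (qmon c xs j l t)) s x).
  have H1 : decays d (fun s t x => \sum_(y <- dmon i xs) foldr partial (qmon c y j l t) s x).
    by apply: decays_sum => y /size_dmon e; apply: IH => //; move: dxs; rewrite e addnS ltnS.
  have H2 : decays d (fun s t x =>
     foldr partial (qmon (- (2 * l%:R * c)) (i :: xs) j.+1 l.+1 t) s x).
    by apply: IH => //; move: dxs; rewrite mulnS addnS /= ltnS.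
  have [C C0 H] := decaysD H1 H2; exists C => // s t x sd t1 x1.
  have oT : open [set: 'rV[R]_n] by exact: openT.
  have -> : foldr partial (partial i (qmon c xs j l t)) s x =
      foldr partial (\sum_(y <- dmon i xs) qmon c y j l t +
         qmon (- (2 * l%:R * c)) (i :: xs) j.+1 l.+1 t) s x.
    exact: (foldr_partial_eq_on s oT (fun y _ => partial_qmon c xs j l t i y)).
  have sm y : smooth_on setT (qmon c y j l t) by exact: smooth_on_qmon.
  have sm2 := smooth_on_qmon (- (2 * l%:R * c)) (i :: xs) j.+1 l.+1 t oT.
  rewrite (foldr_partialD s oT (smooth_on_sum (dmon i xs) oT sm) sm2) //.
  by rewrite (foldr_partial_sum _ s oT sm) //; exact: H.
have /boolp.choice[C CP] : forall i, exists C, 0 <= C /\ forall (s : seq 'I_n) (t : R) (x : 'rV[R]_n), size s = d -> 1 <= t ->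
    (forall i, `|x 0 i| <= 1) ->
    `|foldr partial (partial i (qmon c xs j l t)) s x| <= C / t.
  by move=> i; have [C C0 H] := step i; exists C.
exists (\sum_i C i) => [|s t x sd t1 x1]; first by apply: sumr_ge0 => i _; case: (CP i).
case/lastP: s sd => // s i; rewrite size_rcons foldr_rcons => -[sd].
apply: le_trans ((CP i).2 s t x sd t1 x1) _; rewrite ler_pM2r ?invr_gt0 ?(lt_le_trans _ t1) //.
by rewrite (bigD1 i) //= lerDl; apply: sumr_ge0 => k _; case: (CP k).
Qed.
End SmoothFamilies.

Section SmoothSeries.
Variable R : realType.
Local Notation h N := ((2^-1 : R) ^+ N).

Lemma half_pow_small (e : R) (N0 : nat) : 0 < e ->
  exists N, (N0 <= N)%N /\ forall M, (N <= M)%N -> 2 * h M <= e.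
Proof.
move=> e0; have e2 : 0 < e / 2 by rewrite divr_gt0.
have H : (fun N => h N) @ \oo --> (0 : R).
  by apply: cvg_expr; rewrite gtr0_norm ?invf_lt1 ?ltr1n.
have /cvgrPdist_le/(_ _ e2)[N _ HN] := H.
exists (maxn N0 N); split; first exact: leq_maxl.
move=> M NM; have /HN /= : (N <= M)%N by exact: leq_trans (leq_maxr _ _) NM.
rewrite sub0r normrN ger0_norm ?exprn_ge0 // => hM.
by rewrite mulrC -ler_pdivlMr.
Qed.

Lemma half_powS N : h N = 2 * h N.+1.
Proof. by rewrite exprS mulrA divff ?mul1r ?pnatr_eq0. Qed.

(** The intervals of centre [a N] and radius [2 * h N] are nested because [h N = 2 * h N.+1]; the
    limit is the supremum of their left ends. *)
Lemma geometric_limit (a : nat -> R) N0 :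
  (forall N, (N0 <= N)%N -> `|a N.+1 - a N| <= h N) ->
  exists l, forall N, (N0 <= N)%N -> `|l - a N| <= 2 * h N.
Proof.
move=> ah; pose b N := a N - 2 * h N; pose c N := a N + 2 * h N.
have bS N k : (N0 <= N)%N -> b N <= b (N + k)%N /\ c (N + k)%N <= c N.
  move=> NN; elim: k => [|k [IH1 IH2]]; first by rewrite addn0.
  have := ah (N + k)%N (leq_trans NN (leq_addr _ _)); rewrite ler_norml => /andP[H1 H2].
  have hS := half_powS (N + k).
  rewrite addnS; split; [apply: le_trans IH1 _|apply: le_trans _ IH2]; rewrite /b /c; lra.
have bc N : b N <= c N.
  by rewrite /b /c; have : 0 <= h N by []; move: (h N) => y y0; lra.
have bcM N M : (N0 <= N)%N -> (N0 <= M)%N -> b N <= c M.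
  move=> NN NM; have [NM'|MN] := leqP N M.
    by rewrite -(subnKC NM'); apply: le_trans (bS N _ NN).1 _; exact: bc.
  by rewrite -(subnKC (ltnW MN)); apply: le_trans (bc _) (bS M _ NM).2.
pose B := [set b N | N in [set N | (N0 <= N)%N]].
have ubc M : (N0 <= M)%N -> ubound B (c M) by move=> NM _ [N /= NN <-]; exact: bcM.
exists (sup B) => N NN; rewrite ler_distl; apply/andP; split.
  by apply: ub_le_sup; [exists (c N); exact: ubc|exists N].
by apply: ge_sup; [exists (b N), N|exact: ubc].
Qed.

Variable n : nat.
Implicit Types (U : set 'rV[R]_n) (s : seq 'I_n).

Fixpoint psum (g : nat -> 'rV[R]_n -> R) N : 'rV[R]_n -> R :=
  if N is N'.+1 then psum g N' + g N' else cst 0.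

Lemma smooth_on_psum U g N : open U -> (forall k, smooth_on U (g k)) -> smooth_on U (psum g N).
Proof.
move=> oU sg; elim: N => [|N IH] /=; first exact: smooth_on_cst.
exact: (smooth_onD oU IH (sg N)).
Qed.

(** For each word [s] only the terms with [k <= size s] escape the bound, so the derivatives of the
    partial sums converge uniformly. Limits are chosen for all words at once, and the limit for
    [i :: s] turns out to be the [i]-th partial derivative of the limit for [s]. *)
Lemma smooth_series U (g : nat -> 'rV[R]_n -> R) : open U ->
  (forall k, smooth_on U (g k)) ->
  (forall k s x, (size s < k)%N -> U x -> `|foldr partial (g k) s x| <= h k) ->
  exists F, smooth_on U F /\ forall s x N, (size s < N)%N -> U x ->
    `|foldr partial F s x - foldr partial (psum g N) s x| <= 2 * h N.
Proof.
move=> oU sg gh.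
have /boolp.choice[F FP] : forall sx : seq 'I_n * 'rV[R]_n, exists l, U sx.2 ->
    forall N, (size sx.1 < N)%N -> `|l - foldr partial (psum g N) sx.1 sx.2| <= 2 * h N.
  move=> [s x] /=; have [Ux|] := pselect (U x); last by exists 0.
  have [|l lP] := @geometric_limit (fun N => foldr partial (psum g N) s x) (size s).+1.
    move=> N sN; rewrite /= (foldr_partialD s oU (smooth_on_psum N oU sg) (sg N) Ux).
    by rewrite addrC addKr; exact: gh.
  by exists l => _ N sN; exact: lP.
pose Fs s x := F (s, x).
have FsP s x N : (size s < N)%N -> U x -> `|Fs s x - foldr partial (psum g N) s x| <= 2 * h N.
  by move=> sN Ux; exact: (FP (s, x) Ux N sN).
have sP N s := smooth_on_partial s (smooth_on_psum N oU sg).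
have dF s i x : U x -> is_derive x (delta_mx 0 i) (Fs s) (Fs (i :: s) x).
  (* The threshold is [(size s).+2] because the longer word [i :: s] must be controlled too. *)
  move=> Ux; apply: (@uniform_limit_derivable R _ U (fun N => foldr partial (psum g N) s)
     (fun N => 2 * h N) (size s).+2 oU _ (Fs s) (Fs (i :: s)) x (delta_mx 0 i) Ux).
  - by move=> e e0; exact: half_pow_small.
  - by move=> N y _ Uy; exact: (smooth_on_derivable (sP N s) Uy).
  - by move=> N y sN Uy; apply: FsP => //; exact: ltnW.
  - by move=> N y sN Uy; exact: (FsP (i :: s) y N sN Uy).
have cF s x : U x -> {for x, continuous (Fs s)}.
  move=> Ux; apply: (@uniform_limit_continuous_at R _ U (fun N => foldr partial (psum g N) s)
     (fun N => 2 * h N) (size s).+1 oU _ (Fs s) x Ux).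
  - by move=> e e0; exact: half_pow_small.
  - by move=> N _; exact: (smooth_on_continuous (sP N s) Ux).
  - by move=> N y sN Uy; exact: FsP.
have FE s : forall x, U x -> foldr partial (Fs [::]) s x = Fs s x.
  elim: s => //= i s IH x Ux; rewrite (partial_eq_on oU i IH Ux).
  exact: (@derive_val _ _ _ _ _ _ _ (dF s i x Ux)).
exists (Fs [::]); split=> [s|s x N sN Ux]; last by rewrite FE //; exact: FsP.
apply: (C0_partials_ext oU (fun y Uy => esym (FE s y Uy))) => x Ux; split; first exact: cF.
by move=> i; exact: (@ex_derive _ _ _ _ _ _ _ (dF s i x Ux)).
Qed.
End SmoothSeries.

Section Borel.
Variables (R : realType) (n : nat).
Implicit Types (f g : 'rV[R]_n -> R) (F G : fps R n) (m : multi_index n).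

Lemma fps_eq_partial F G : F [ffun=> 0%N] = G [ffun=> 0%N] ->
  (forall i, fps_partial i F = fps_partial i G) -> F = G.
Proof.
move=> FG0 FG; apply: fps_eq_foldr => s; case/lastP: s => // s i.
by rewrite !foldr_rcons FG.
Qed.

Lemma partial_cst (i : 'I_n) (a : R) : partial i (cst a) = cst 0 :> ('rV[R]_n -> R).
Proof. by apply/funext => x; rewrite /partial derive_cst. Qed.

Lemma taylor_cst0 : taylor (cst 0 : 'rV[R]_n -> R) = 0.
Proof.
apply/funext => m; rewrite /taylor mpartialE.
have -> : foldr partial (cst 0 : 'rV[R]_n -> R) (mword m) = cst 0.
  by elim: (mword m) => //= i s ->; exact: partial_cst.
by rewrite mul0r.
Qed.

Lemma fps_partial1 (i : 'I_n) : fps_partial i (1 : fps R n) = 0.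
Proof.
have := fps_partialM i (1 : fps R n) 1; rewrite !mulr1 mul1r => /eqP.
by rewrite -subr_eq0 opprD addrA subrr sub0r oppr_eq0 => /eqP.
Qed.

Lemma fps_partialZ (i : 'I_n) a F : fps_partial i (a *: F) = a *: fps_partial i F.
Proof.
by rewrite -[a *: F]addr0 fps_partial_linear (derivation0 (@fps_partial_linear R n)) addr0.
Qed.

Lemma taylor_cst a : taylor (cst a : 'rV[R]_n -> R) = a *: 1.
Proof.
apply: fps_eq_partial; first by rewrite taylor0 fps_scaleE fps_1E eqxx mulr1.
move=> i; rewrite -taylor_partial; last exact: smooth_at0_cst.
by rewrite partial_cst taylor_cst0 fps_partialZ fps_partial1 scaler0.
Qed.

Lemma smooth_at0_setT f : smooth_on setT f -> smooth_at0 f.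
Proof. by move=> sf; exists setT => //; split; [exact: openT|]. Qed.

Lemma taylor_coordf i : taylor (coordf i : 'rV[R]_n -> R) = fps_var i.
Proof.
have sc : smooth_at0 (coordf i : 'rV[R]_n -> R).
  by apply: smooth_at0_setT; exact: smooth_on_coordf openT.
apply: fps_eq_partial.
  rewrite taylor0 /coordf mxE.
  by have /ord_ge1 -> := @ord_ge_var R n i.
move=> j; rewrite -taylor_partial // fps_partial_var.
have -> : partial j (coordf i) = cst (j == i)%:R :> ('rV[R]_n -> R).
  by apply/funext => x; rewrite /partial (@derive_val _ _ _ _ _ _ _ (coordf_is_derive i x j)).
by rewrite taylor_cst; case: (j == i); rewrite ?scale1r ?scale0r.
Qed.

Definition fps_mon m : fps R n := fun m' => (m' == m)%:R.

Lemma ord_ge_mon m : ord_ge (mdeg m) (fps_mon m).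
Proof. by move=> m' mm'; rewrite /fps_mon; case: eqP mm' => // ->; rewrite ltnn. Qed.

Lemma fps_var_mon i m : fps_var i * fps_mon m = fps_mon (madd m (munit i)) :> fps R n.
Proof.
apply/funext => m'; rewrite fps_mulE.
have [mi|mi] := boolP (munit i \in mbox m'); last first.
  rewrite big1_seq => [|k /= km].
    rewrite /fps_mon; case: eqP => // e; case/negP: mi; rewrite e mem_mbox.
    by apply/forallP => j; rewrite [madd _ _ _]ffunE leq_addl.
  rewrite /fps_var; case: eqP => [e|]; last by rewrite mul0r.
  by rewrite -e km in mi.
rewrite (big_rem _ mi) /= /fps_var eqxx mul1r big1_seq ?addr0 => [|k /=]; last first.
  by rewrite mem_rem_uniq ?mbox_uniq // inE => /andP[/negPf-> _]; rewrite mul0r.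
rewrite /fps_mon; congr (nat_of_bool _)%:R; have e := msubK mi.
apply/eqP/eqP => [<-|->].
  by rewrite -[LHS]e; apply/ffunP => j; rewrite ![madd _ _ _]ffunE addnC.
by apply/ffunP => j; rewrite !ffunE addnK.
Qed.

Lemma taylor_monf xs : taylor (monf xs : 'rV[R]_n -> R) = fps_mon (mcount xs).
Proof.
elim: xs => [|i xs IH].
  rewrite /= taylor_cst scale1r; apply/funext => m; rewrite fps_1E /fps_mon.
  by congr (nat_of_bool (_ == _))%:R; apply/ffunP => i; rewrite !ffunE.
rewrite /= taylorM; first 1 last.
- by apply: smooth_at0_setT; exact: smooth_on_coordf openT.
- by apply: smooth_at0_setT; exact: smooth_on_monf openT.
rewrite IH taylor_coordf fps_var_mon; congr fps_mon.
by apply/ffunP => j; rewrite !ffunE /= addnC.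
Qed.

Lemma quad0 t : quad t (0 : 'rV[R]_n) = 1.
Proof. by rewrite /quad big1 ?addr0 // => i _; rewrite mxE mulr0 expr0n. Qed.

(** The factor [1 / (1 + t^2 |x|^2)] is 1 at 0, so it alters the monomial only in higher degrees,
    whatever [t] is; [t] stays free for the estimates. *)
Lemma taylor_qmon c xs t :
  ord_ge (size xs).+1 (taylor (qmon c xs 0 1 t : 'rV[R]_n -> R) - c *: fps_mon (mcount xs)).
Proof.
have s1 : smooth_at0 (qinv t ^+ 1 : 'rV[R]_n -> R).
  by apply: smooth_at0_setT; apply: smooth_on_exp openT _; exact: smooth_on_qinv openT.
have s2 : smooth_at0 (monf xs : 'rV[R]_n -> R).
  by apply: smooth_at0_setT; exact: smooth_on_monf openT.
have s3 := smooth_at0_cst (n := n) (c * t ^+ (2 * 0)).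
rewrite /qmon (taylorM s3 (smooth_at0M s1 s2)) (taylorM s1 s2) taylor_cst taylor_monf.
rewrite muln0 expr0 mulr1 -scalerAl mul1r -scalerBr; apply: ord_geZ.
rewrite -{2}[fps_mon _]mul1r -mulrBl -add1n -(size_mcount xs).
apply: ord_geM; last exact: ord_ge_mon.
apply/ord_ge1; rewrite fps_addE fps_oppE taylor0 fps_1E eqxx fct_expE expr1.
by rewrite /qinv quad0 invr1 subrr.
Qed.

Lemma mdeg_list k : exists r : seq (multi_index n), uniq r /\ forall m, (m \in r) = (mdeg m == k).
Proof.
pose f (e : {ffun 'I_n -> 'I_k.+1}) : multi_index n := [ffun i => e i : nat].
exists [seq m <- undup [seq f e | e <- enum {ffun 'I_n -> 'I_k.+1}] | mdeg m == k].
split=> [|m]; first by rewrite filter_uniq ?undup_uniq.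
rewrite mem_filter mem_undup andb_idr // => /eqP mk; apply/mapP.
exists [ffun i => inord (m i)]; first by rewrite mem_enum.
apply/ffunP => i; rewrite !ffunE inordK // ltnS -mk /mdeg (bigD1 i) //= leq_addr //.
Qed.

Lemma taylor_sum (I : Type) (r : seq I) (f : I -> 'rV[R]_n -> R) :
  (forall i, smooth_on setT (f i)) -> taylor (\sum_(i <- r) f i) = \sum_(i <- r) taylor (f i).
Proof.
move=> sf; elim: r => [|i r IH].
  by rewrite !big_nil; exact: taylor_cst0.
rewrite !big_cons taylorD ?IH //; first exact: smooth_at0_setT.
by apply: smooth_at0_setT; exact: (smooth_on_sum r openT sf).
Qed.

Local Notation h N := ((2^-1 : R) ^+ N).

(* The correction g is P / (1 + t^2 |x|^2), where P is the homogeneous part of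
   degree k of the error and t is large. *)
Lemma borel_step (F : fps R n) k f : smooth_on setT f -> ord_ge k (F - taylor f) ->
  exists g, [/\ smooth_on setT g, ord_ge k.+1 (F - taylor (f + g)) &
    forall s (x : 'rV[R]_n), (size s < k)%N -> (forall i, `|x 0 i| <= 1) ->
      `|foldr partial g s x| <= h k].
Proof.
move=> sf Ff; have [r [ur rP]] := mdeg_list k.
pose c m := (F - taylor f) m.
pose g t := \sum_(m <- r) qmon (c m) (mword m) 0 1 t.
have oT : open [set: 'rV[R]_n] by exact: openT.
have sq t m : smooth_on setT (qmon (c m) (mword m) 0 1 t) by exact: smooth_on_qmon.
have sg t : smooth_on setT (g t) := smooth_on_sum r oT (sq t).
have Fg t : ord_ge k.+1 (F - taylor (f + g t)).
  rewrite (taylorD (smooth_at0_setT sf) (smooth_at0_setT (sg t))) (taylor_sum r (sq t)).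
  have -> : F - (taylor f + \sum_(m <- r) taylor (qmon (c m) (mword m) 0 1 t)) =
     (F - taylor f - \sum_(m <- r) c m *: fps_mon m) -
     \sum_(m <- r) (taylor (qmon (c m) (mword m) 0 1 t) - c m *: fps_mon m).
    by rewrite sumrB opprB addrA subrK opprD addrA.
  apply: ord_geB; last first.
    rewrite big_seq; apply: ord_ge_sum => m; rewrite rP => /eqP mk.
    by have := @taylor_qmon (c m) (mword m) t; rewrite size_mword mk mcount_mword.
  move=> m; rewrite ltnS leq_eqVlt => /orP[/eqP mk|mk]; last first.
    rewrite fps_addE fps_oppE Ff // sub0r fps_sumE big1_seq ?oppr0 // => m' /=.
    rewrite rP => /eqP m'k; rewrite fps_scaleE /fps_mon; case: eqP; last by rewrite mulr0.
    by move=> e; rewrite e m'k ltnn in mk.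
  have mr : m \in r by rewrite rP mk.
  rewrite fps_addE fps_oppE fps_sumE (big_rem _ mr) /= big1_seq => [|m' /=].
    by rewrite fps_scaleE /fps_mon eqxx mulr1 addr0 subrr.
  rewrite mem_rem_uniq // inE => /andP[m'm _]; rewrite fps_scaleE /fps_mon.
  by rewrite eq_sym (negPf m'm) mulr0.
have dec d : exists C, (d < k)%N -> 0 <= C /\ forall (s : seq 'I_n) (t : R) (x : 'rV[R]_n), size s = d ->
    1 <= t -> (forall i, `|x 0 i| <= 1) -> `|foldr partial (g t) s x| <= C / t.
  have [dk|] := ltnP d k; last by exists 0.
  have [C C0 H] : decays d (fun s t x => \sum_(m <- r) foldr partial (qmon (c m) (mword m) 0 1 t) s x).
    apply: decays_sum => m; rewrite rP => /eqP mk; apply: decays_qmon => //.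
    by rewrite muln0 add0n size_mword mk.
  exists C => _; split=> // s t x sd t1 x1.
  by rewrite (foldr_partial_sum _ s oT (sq t)) //; exact: H.
have /boolp.choice[C CP] := dec.
pose K := \sum_(d < k) C d.
have K0 : 0 <= K by apply: sumr_ge0 => d _; case: (CP d (ltn_ord d)).
have hk0 : 0 < h k by rewrite exprn_gt0.
(* Large enough for [C d / t <= h k] whenever [d < k]: [K] dominates these constants, and
   [t * h k = h k + K]. *)
pose t := 1 + K / h k.
have t1 : 1 <= t by rewrite lerDl divr_ge0 // ltW.
have t0 : 0 < t by exact: lt_le_trans t1.
exists (g t); split; [exact: sg|exact: Fg|move=> s x sk x1].
have [_ H] := CP _ sk; apply: le_trans (H s t x erefl t1 x1) _.
rewrite ler_pdivrMr // mulrDr mulr1 mulrCA divff ?gt_eqF // mulr1.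
apply: (@le_trans _ _ K); last by rewrite lerDr ltW.
rewrite /K (bigD1 (Ordinal sk)) //= lerDl; apply: sumr_ge0 => d _.
by case: (CP d (ltn_ord d)).
Qed.

(** The partial sum [S N] of the corrections has the expansion [F] below degree [N], while low-order
    derivatives of the sum of the series at 0 are within [2 * h N] of those of [S N]; letting [N]
    grow identifies the coefficients. *)
Lemma borel (F : fps R n) : exists f, smooth_at0 f /\ taylor f = F.
Proof.
have /boolp.choice[G GP] : forall kf : nat * ('rV[R]_n -> R), exists g,
    smooth_on setT kf.2 -> ord_ge kf.1 (F - taylor kf.2) ->
    [/\ smooth_on setT g, ord_ge kf.1.+1 (F - taylor (kf.2 + g)) &
    forall s (x : 'rV[R]_n), (size s < kf.1)%N -> (forall i, `|x 0 i| <= 1) ->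
      `|foldr partial g s x| <= h kf.1].
  move=> [k f] /=; have [sf|nsf] := pselect (smooth_on setT f); last by exists 0.
  have [Ff|nFf] := pselect (ord_ge k (F - taylor f)); last by exists 0.
  by have [g gP] := borel_step sf Ff; exists g.
pose S := fix S k : 'rV[R]_n -> R := if k is k'.+1 then S k' + G (k', S k') else cst 0.
have oT : open [set: 'rV[R]_n] by exact: openT.
have SP k : smooth_on setT (S k) /\ ord_ge k (F - taylor (S k)).
  elim: k => [|k [IH1 IH2]]; first by split; [exact: smooth_on_cst|].
  have [s1 s2 _] := GP (k, S k) IH1 IH2.
  by split; [exact: (smooth_onD oT IH1 s1)|exact: s2].
pose g k := G (k, S k).
have gP k := GP (k, S k) (SP k).1 (SP k).2.
have SE k : S k = psum g k by elim: k => //= k IH; rewrite -IH.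
(* The unit ball of row vectors is a cube, which gives the bounds on coordinates assumed in the
   estimates. *)
pose U := ball (0 : 'rV[R]_n) 1.
have oU : open U by exact: ball_open.
have U1 x : U x -> forall i, `|x 0 i| <= 1.
  move=> [_ Ux] i; have := Ux 0 i.
  by rewrite -ball_normE /= mxE sub0r normrN => /ltW.
have sgU k : smooth_on U (g k).
  by have [sg _ _] := gP k; apply: smooth_on_sub sg.
have gU k s x : (size s < k)%N -> U x -> `|foldr partial (g k) s x| <= h k.
  by move=> sk Ux; have [_ _ H] := gP k; apply: H => //; exact: U1.
have [f [sf fP]] := smooth_series oU sgU gU.
have U0 : U 0 by apply: ballxx.
have sf0 : smooth_at0 f by exists U; [split; [exact: oU|exact: U0]|exact: sf].
exists f; split=> //; apply/funext => m.
have fact0 : 0 < (\prod_i (m i)`!)%:R :> R.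
  by rewrite ltr0n prodn_gt0 // => i; exact: fact_gt0.
apply/eqP; rewrite -subr_eq0 -normr_le0; apply/ler_addgt0Pl => e e0; rewrite addr0.
have e'0 : 0 < e * (\prod_i (m i)`!)%:R by rewrite mulr_gt0.
have [N [mN hN]] := half_pow_small (mdeg m).+1 e'0.
have := fP (mword m) 0 N; rewrite size_mword => /(_ mN U0).
have FS : F m = taylor (S N) m.
  by have := (SP N).2 m mN; rewrite fps_addE fps_oppE => /eqP; rewrite subr_eq0 => /eqP.
rewrite FS SE /taylor !mpartialE -mulrBl normrM normfV (gtr0_norm fact0) => H.
rewrite ler_pdivrMr //; apply: le_trans H _; exact: hN.
Qed.
End Borel.

(** * Germs of vector fields *)

Section GermAlgebra.
Variables (R : realType) (n : nat).
Local Notation germ := (germ R n).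
Implicit Types (u v : germ) (f g : smooth_fun R n).
Local Notation gd := (@germ_partial R n).

Lemma germ_surj u : exists f, u = \pi_germ f.
Proof. by exists (repr u); rewrite reprK. Qed.

Lemma smooth_at0_val f : smooth_at0 (f : 'rV[R]_n -> R).
Proof. exact/smooth_predP/smooth_valP. Qed.

Lemma smooth_fun_of (h : 'rV[R]_n -> R) : smooth_at0 h -> exists f, smooth_val f = h.
Proof. by move=> /smooth_predP sh; exists (SmoothFun sh). Qed.

Lemma germ_scaleE a f : a *: (\pi_germ f : germ) = \pi_germ (smooth_scale a f).
Proof. exact: germ_scale_pi. Qed.

Lemma germ_scaleAl a u v : a *: (u * v) = (a *: u) * v.
Proof.
have [f ->] := germ_surj u; have [g ->] := germ_surj v.
rewrite germ_scaleE -!germ_piM germ_scaleE; congr \pi_germ; apply: val_inj.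
by apply/funext => x; exact: (mulrA a (f x) (g x)).
Qed.
HB.instance Definition _ := GRing.Lmodule_isLalgebra.Build R germ germ_scaleAl.

Lemma germ_scaleAr a u v : a *: (u * v) = u * (a *: v).
Proof. by rewrite mulrC germ_scaleAl mulrC. Qed.
HB.instance Definition _ := GRing.Lalgebra_isAlgebra.Build R germ germ_scaleAr.

Lemma germ_partial_linear i : linear (gd i).
Proof.
move=> a u v; have [f ->] := germ_surj u; have [g ->] := germ_surj v.
rewrite germ_scaleE -germ_piD !germ_partial_pi germ_scaleE -germ_piD.
apply/germ_eqP.
have sf := smooth_at0_val f; have sg := smooth_at0_val g.
have H1 := partialD_at0 i (smooth_at0Z a sf) sg.
have H2 := partialM_at0 i (smooth_at0_cst a) sf.
apply: filterS (filterI H1 H2) => x [E1 E2].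
apply: etrans E1 _; change (partial i (a *: (f : 'rV[R]_n -> R)) x + partial i g x =
  a * partial i f x + partial i g x); congr (_ + _).
apply: etrans E2 _.
change (partial i (cst a) x * f x + a * partial i f x = a * partial i f x).
by rewrite partial_cst mul0r add0r.
Qed.

Lemma germ_partialM i u v : gd i (u * v) = gd i u * v + u * gd i v.
Proof.
have [f ->] := germ_surj u; have [g ->] := germ_surj v.
rewrite -germ_piM !germ_partial_pi -!germ_piM -germ_piD; apply/germ_eqP.
exact: (partialM_at0 i (smooth_at0_val f) (smooth_at0_val g)).
Qed.

Lemma germ_partialC i j u : gd i (gd j u) = gd j (gd i u).
Proof.
have [f ->] := germ_surj u; rewrite !germ_partial_pi; apply/germ_eqP.
have [U [oU U0] sf] := smooth_at0_val f.
apply: filterS (open_nbhs_nbhs (conj oU U0)) => x Ux.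
exact: (@partialC R n U f i j x oU sf Ux).
Qed.

Lemma germ_taylorD u v : germ_taylor (u + v) = germ_taylor u + germ_taylor v.
Proof.
have [f ->] := germ_surj u; have [g ->] := germ_surj v.
rewrite -germ_piD !germ_taylor_pi.
exact: (taylorD (smooth_at0_val f) (smooth_at0_val g)).
Qed.

Lemma germ_taylorM u v : germ_taylor (u * v) = germ_taylor u * germ_taylor v.
Proof.
have [f ->] := germ_surj u; have [g ->] := germ_surj v.
rewrite -germ_piM !germ_taylor_pi.
exact: (taylorM (smooth_at0_val f) (smooth_at0_val g)).
Qed.

Lemma germ_taylorZ a u : germ_taylor (a *: u) = a *: germ_taylor u.
Proof.
have [f ->] := germ_surj u; rewrite germ_scaleE !germ_taylor_pi.
have := taylorM (smooth_at0_cst a) (smooth_at0_val f).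
by rewrite taylor_cst -scalerAl mul1r.
Qed.

Lemma germ_pi1 : \pi_germ 1 = 1 :> germ.
Proof.
have [r rE] := germ_surj 1.
by rewrite -[LHS]mulr1 rE -germ_piM mul1r.
Qed.

Lemma germ_taylor1 : germ_taylor (1 : germ) = 1.
Proof. by rewrite -germ_pi1 germ_taylor_pi; have := taylor_cst n (1 : R); rewrite scale1r. Qed.

Lemma germ_taylor0 : germ_taylor (0 : germ) = 0.
Proof. by rewrite -(scale0r 0) germ_taylorZ scale0r. Qed.

Lemma germ_taylor_partial i u : germ_taylor (gd i u) = fps_partial i (germ_taylor u).
Proof.
have [f ->] := germ_surj u; rewrite germ_partial_pi !germ_taylor_pi.
exact: (taylor_partial i (smooth_at0_val f)).
Qed.

Lemma germ_taylor_sum I (r : seq I) (F : I -> germ) :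
  germ_taylor (\sum_(i <- r) F i) = \sum_(i <- r) germ_taylor (F i).
Proof.
elim: r => [|i r IH]; first by rewrite !big_nil germ_taylor0.
by rewrite !big_cons germ_taylorD IH.
Qed.

Lemma germ_borel (F : fps R n) : exists u, germ_taylor u = F.
Proof.
have [f [sf <-]] := borel F; have [h <-] := smooth_fun_of sf.
by exists (\pi_germ h); rewrite germ_taylor_pi.
Qed.

Definition germ_eval u : R := germ_taylor u [ffun=> 0%N].

Lemma germ_eval_is_additive : {morph germ_eval : u v / u - v}.
Proof.
move=> u v; rewrite /germ_eval germ_taylorD fps_addE; congr (_ + _).
by rewrite -scaleN1r germ_taylorZ fps_scaleE mulN1r.
Qed.
HB.instance Definition _ := GRing.isZmodMorphism.Build germ R germ_eval germ_eval_is_additive.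

Lemma germ_eval_is_monoid : monoid_morphism germ_eval.
Proof.
split; first by rewrite /germ_eval germ_taylor1 fps_1E eqxx.
by move=> u v; rewrite /germ_eval germ_taylorM fps_mul0E.
Qed.
HB.instance Definition _ := GRing.isMonoidMorphism.Build germ R germ_eval germ_eval_is_monoid.

(** By continuity a representative is nonzero on a neighborhood of 0, where its reciprocal is
    smooth: the ring of germs is local. *)
Lemma germ_inverse u : germ_eval u != 0 -> exists v, v * u = 1.
Proof.
have [f ->] := germ_surj u; rewrite /germ_eval germ_taylor_pi taylor0 => f0.
have [U [oU U0] sf] := smooth_at0_val f.
have cf : {for 0, continuous (f : 'rV[R]_n -> R)} := smooth_on_continuous sf U0.
have Nf : \forall x \near (0 : 'rV[R]_n), f x != 0.
  exact: (cvgr_neq0 _ cf f0).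
have : nbhs (0 : 'rV[R]_n) (U `&` [set x | f x != 0]).
  by apply: filterI; [exact: open_nbhs_nbhs (conj oU U0)|exact: Nf].
rewrite nbhsE => -[W [oW W0] WP].
have sW : smooth_on W (f : 'rV[R]_n -> R) by apply: smooth_on_sub sf => x /WP[].
have sV := smooth_on_inv oW (fun x Wx => (WP x Wx).2) sW.
have sV0 : smooth_at0 (fun x => (f x)^-1) by exact: (smooth_on_at0 (conj oW W0) sV).
have [g gE] := smooth_fun_of sV0.
exists (\pi_germ g); rewrite -germ_piM -germ_pi1; apply/germ_eqP.
apply: filterS Nf => x fx; change (smooth_val g x * f x = 1).
by rewrite gE mulVf.
Qed.
End GermAlgebra.

(** * Germs of vector fields determined by their action on [phi] *)

Section Rectification.
Variables (R : realType) (n : nat) (phi : 'I_n -> germ R n).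
Local Notation gd := (@germ_partial R n).
Local Notation svf := (smooth_vfield R n).
Implicit Types (X Y : svf) (M N : 'M[R]_n).
Hypothesis phi2 : forall j, ord_ge 2 (germ_taylor (phi j) - fps_var j).

Let J : 'M[germ R n]_n := \matrix_(i, j) gd i (phi j).

(** At 0 the matrix is the identity, so its determinant is a unit in the ring of germs, and the
    adjugate provides the inverse. *)
Lemma jacobian_invertible : exists K : 'M[germ R n]_n, K *m J = 1%:M /\ J *m K = 1%:M.
Proof.
have evJ : map_mx (@germ_eval R n) J = 1%:M.
  apply/matrixP => i j; rewrite !mxE /germ_eval germ_taylor_partial.
  have : ord_ge 1 (fps_partial i (germ_taylor (phi j) - fps_var j)) by exact: ord_ge_partial.
  move/ord_ge1; rewrite -(scaleN1r (fps_var j)) addrC fps_partial_linear fps_addE fps_scaleE.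
  rewrite fps_partial_var mulN1r addrC => /eqP; rewrite subr_eq0 => /eqP ->.
  by case: (i == j); rewrite ?mulr1n ?mulr0n ?fps_1E ?eqxx.
have [v vJ] : exists v, v * \det J = 1.
  by apply: germ_inverse; rewrite -det_map_mx evJ det1 oner_neq0.
exists (v *: \adj J); rewrite -scalemxAl -scalemxAr mul_adj_mx mul_mx_adj.
by rewrite scale_scalar_mx vJ.
Qed.

Lemma vapply_phi X j : vapply gd X (phi j) = ((\row_i X i) *m J) 0 j.
Proof. by rewrite mxE; apply: eq_bigr => i _; rewrite !mxE. Qed.

Lemma smooth_vapply_inj X Y : (forall j, vapply gd X (phi j) = vapply gd Y (phi j)) -> X = Y.
Proof.
move=> XY; have [K [_ JK]] := jacobian_invertible.
have E : (\row_i X i) *m J = (\row_i Y i) *m J.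
  by apply/rowP => j; rewrite -!vapply_phi.
have : (\row_i X i) = (\row_i Y i).
  by rewrite -[LHS]mulmx1 -JK mulmxA E -mulmxA JK mulmx1.
by move=> /rowP e; apply/ffunP => i; have := e i; rewrite !mxE.
Qed.

Lemma rectified_field_exists M : exists X, forall j, vapply gd X (phi j) = \sum_i M i j *: phi i.
Proof.
have [K [KJ _]] := jacobian_invertible.
pose y := \row_j (\sum_i M i j *: phi i) : 'rV[germ R n]_n.
exists [ffun i => (y *m K) 0 i] => j; rewrite vapply_phi.
have -> : \row_i [ffun i => (y *m K) 0 i] i = y *m K.
  by apply/rowP => i; rewrite mxE ffunE.
by rewrite -mulmxA KJ mulmx1 mxE.
Qed.

Lemma germ_bracketE X Y u : vapply gd (smooth_bracket X Y) u =
  vapply gd X (vapply gd Y u) - vapply gd Y (vapply gd X u).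
Proof.
apply: vapply_bracket; try by [apply: germ_partial_linear|apply: germ_partialM].
by move=> i j v; exact: germ_partialC.
Qed.

Lemma germ_vapply_sum X (c : 'I_n -> R) (F : 'I_n -> germ R n) :
  vapply gd X (\sum_i c i *: F i) = \sum_i c i *: vapply gd X (F i).
Proof.
have V := vapply_linear (@germ_partial_linear R n) X.
have V0 : vapply gd X 0 = 0.
  by rewrite /vapply big1 // => i _; rewrite (derivation0 (@germ_partial_linear R n)) mulr0.
elim: (index_enum _) => [|i r IH]; first by rewrite !big_nil.
by rewrite !big_cons V IH.
Qed.

Lemma taylor_vapply X u :
  germ_taylor (vapply gd X u) = vapply (@fps_partial R n) (taylor_vfield X) (germ_taylor u).
Proof.
rewrite /vapply germ_taylor_sum; apply: eq_bigr => i _.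
by rewrite germ_taylorM germ_taylor_partial ffunE.
Qed.

(** [S M] is the field with [X phi = phi M]. Each clause is checked by applying both sides to [phi]:
    for germs through the invertible Jacobian matrix, for Taylor expansions through [vapply_inj]. *)
Lemma rectified_fields : exists S : 'M[R]_n -> svf,
  [/\ forall a M N, S (a *: M + N) = a *: S M + S N,
      forall M N, S (mxbr M N) = smooth_bracket (S M) (S N) &
      forall M (X : formal_vfield R n), (forall j, vapply (@fps_partial R n) X (germ_taylor (phi j)) =
           \sum_i M i j *: germ_taylor (phi i)) -> taylor_vfield (S M) = X].
Proof.
have /boolp.choice[S SP] := rectified_field_exists.
exists S; split.
- move=> a M N; apply: smooth_vapply_inj => j; rewrite vapplyDl !SP scaler_sumr -big_split.
  by apply: eq_bigr => i _ /=; rewrite !mxE scalerDl scalerA.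
- move=> M N; apply: smooth_vapply_inj => j; rewrite germ_bracketE !SP !germ_vapply_sum.
  have E (A B : 'M[R]_n) : \sum_i A i j *: vapply gd (S B) (phi i) = \sum_k (B *m A) k j *: phi k.
    transitivity (\sum_i \sum_k (A i j * B k i) *: phi k).
      by apply: eq_bigr => i _; rewrite SP scaler_sumr; apply: eq_bigr => k _; rewrite scalerA.
    rewrite exchange_big /=; apply: eq_bigr => k _; rewrite mxE scaler_suml.
    by apply: eq_bigr => i _; rewrite mulrC.
  rewrite !E -sumrB; apply: eq_bigr => i _.
  by rewrite !mxE scalerBl.
- move=> M X XP; apply/eqP; rewrite -subr_eq0; apply/eqP.
  apply: (@vapply_inj _ _ _ [ffun j => germ_taylor (phi j)]) => j; rewrite ffunE //.
  rewrite addrC -scaleN1r vapplyDl XP -taylor_vapply SP germ_taylor_sum.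
  rewrite scaleN1r addrC; apply/eqP; rewrite subr_eq0; apply/eqP.
  by apply: eq_bigr => i _; rewrite germ_taylorZ.
Qed.
End Rectification.

Theorem mainTheorem1 (R : realType) (n : nat) (Lhat : set (formal_vfield R n)) :
  lie_subalgebra (@formal_bracket R n) Lhat ->
  fin_dim Lhat ->
  lie_semisimple (@formal_bracket R n) Lhat ->
  (forall X, Lhat X -> vanishes_at0 X) ->
  exists L : set (smooth_vfield R n),
    [/\ lie_subalgebra (@smooth_bracket R n) L,
        (@taylor_vfield R n) @` L = Lhat &
        lie_isomorphism (@smooth_bracket R n) (@formal_bracket R n) L Lhat
          (@taylor_vfield R n)].
Proof.
move=> LL fL sL L0.
have L1 X : Lhat X -> vord 1 X by move=> /L0/vanishes_at0P.
have [psi [psiD psi2]] := formal_linearization LL fL sL L1.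
have /boolp.choice[phi phiE] : forall j, exists u, germ_taylor u = psi j.
  by move=> j; exact: germ_borel.
have phi2 j : ord_ge 2 (germ_taylor (phi j) - fps_var j) by rewrite phiE.
have [S [Slin Sbr TS]] := rectified_fields phi2.
(* The inverse of the Taylor map: by [psiD], a field [X] of [Lhat] acts on [psi] through
   [linpart X], so the lift of [linpart X] expands to [X]. *)
pose f X := S (linpart X).
have flin a X Y : Lhat X -> Lhat Y -> f (a *: X + Y) = a *: f X + f Y.
  by move=> _ _; rewrite /f linpart_linear Slin.
have fbr X Y : Lhat X -> Lhat Y -> f (formal_bracket X Y) = smooth_bracket (f X) (f Y).
  by move=> LX LY; rewrite /f linpart_bracket ?Sbr //; exact: L1.
have Tf X : Lhat X -> taylor_vfield (f X) = X.
  move=> LX; apply: TS => j; rewrite phiE; apply/eqP; rewrite -subr_eq0; apply/eqP.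
  have /ffunP/(_ j) := psiD X LX; rewrite !ffunE => E; rewrite -[RHS]E; congr (_ - _).
  by apply: eq_bigr => i _; rewrite phiE.
have TL : (@taylor_vfield R n) @` (f @` Lhat) = Lhat.
  rewrite eqEsubset; split=> [_ [_ [X LX <-] <-]|X LX]; first by rewrite Tf.
  by exists (f X); [exists X|exact: Tf].
exists (f @` Lhat); split=> //; first exact: lie_subalgebra_image LL flin fbr.
split.
- split.
  + by move=> _ [X LX <-]; rewrite /= Tf.
  + by move=> _ _ /set_mem[X LX <-] /set_mem[Y LY <-]; rewrite !Tf // => ->.
  + by move=> X LX; exists (f X); [exists X|exact: Tf].
- move=> a _ _ [X LX <-] [Y LY <-]; rewrite -flin // !Tf //.
  exact: LL.1.2.
- move=> _ _ [X LX <-] [Y LY <-]; rewrite -fbr // !Tf //.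
  exact: LL.2.
Qed.
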